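(* Let $\Omega$ be any one of the three domains: the unit disc $\mathbb{D}$, the bidisc $\mathbb{D}^2$, or the symmetrized bidisc $G=\{(z+w,zw):|z|<1,\ |w|<1\}\subset\mathbb{C}^2$. Then $\Omega$ has a minimal universal set for the Carathéodory extremal problem, and this minimal universal set is unique up to equivalence: any two minimal universal sets for the Carathéodory extremal problem on $\Omega$ are equivalent.
   Context: $\mathbb{D}$ is the open unit disc in $\mathbb{C}$. Datums. A datum $\delta$ in an open set $U\subseteq\mathbb{C}^n$ is either discrete, $\delta=(s_1,s_2)$ with $s_1,s_2\in U$, or infinitesimal, $\delta=(s,v)$ with $s\in U$, $v\in\mathbb{C}^n$. It is degenerate if $s_1=s_2$ (discrete case) or $v=0$ (infinitesimal case), and nondegenerate otherwise. If $F:U\to\mathbb{D}$ is holomorphic, then $F(\delta)=(F(s_1),F(s_2))$ for discrete $\delta$ and $F(\delta)=(F(s),D_vF(s))$ for infinitesimal $\delta$, where $D_vF(s)=\lim_{z\to0}(F(s+zv)-F(s))/z$. For a datum in $\mathbb{D}$: $|(z_1,z_2)|=\tanh^{-1}\left|\frac{z_1-z_2}{1-\overline{z_2}z_1}\right|$ (discrete), $|(z,v)|=\frac{|v|}{1-|z|^2}$ (infinitesimal). Carathéodory problem. For a domain $U$ (connected open set in $\mathbb{C}^n$) and a nondegenerate datum $\delta$ in $U$, $|\delta|_{\rm car}=\sup\{|F(\delta)|: F:U\to\mathbb{D}\text{ holomorphic}\}$. A holomorphic $C:U\to\mathbb{D}$ solves $\mathrm{Car}\,\delta$ if $|C(\delta)|=|\delta|_{\rm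 car}$. Universal set. A set $\mathcal{C}$ of holomorphic maps $U\to\mathbb{D}$ is a universal set for the Carathéodory extremal problem on $U$ if for every nondegenerate datum $\delta$ in $U$ (discrete or infinitesimal) some $C\in\mathcal{C}$ solves $\mathrm{Car}\,\delta$. It is a minimal universal set if, in addition, no proper subset of $\mathcal{C}$ is a universal set for the Carathéodory extremal problem on $U$. Equivalence. Two universal sets $\mathcal{C}$ and $\mathcal{C}'$ on $U$ are equivalent if there is a choice, for every $\varphi\in\mathcal{C}$, of an automorphism $m_\varphi$ of $\mathbb{D}$ such that $\mathcal{C}'=\{m_\varphi\circ\varphi:\varphi\in\mathcal{C}\}$. *)

(* Defs.v *)
(* Coquelicot's complex numbers C; the ambient space C^n is an arbitrary normed
   module V over C, instantiated at C and at C * C. *)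
From Stdlib Require Import Reals Ensembles ClassicalEpsilon.
From Coquelicot Require Import Coquelicot.
Open Scope R_scope.

Notation CSpace := (NormedModule C_AbsRing).

Definition C2 : CSpace := prod_NormedModule C_AbsRing C_NormedModule C_NormedModule.

Definition pts {V : CSpace} (U : V -> Prop) : Type := {x : V | U x}.

Definition unit_disc : C_NormedModule -> Prop := fun z => Cmod z < 1.

Definition bidisc : C2 -> Prop := fun x => Cmod (fst x) < 1 /\ Cmod (snd x) < 1.

Definition sym_bidisc : C2 -> Prop := fun x =>
  exists z w : C, Cmod z < 1 /\ Cmod w < 1 /\ x = ((z + w)%C, (z * w)%C).

(* Maps U -> D are functions on the subtype, so that two maps are equal exactly
   when they agree on U.  Analytic notions are applied to the extension by 0;
   as U is always open, the values off U play no role in them. *)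
Definition ext {V : CSpace} {U : V -> Prop} (F : pts U -> pts unit_disc) (x : V) : C :=
  match excluded_middle_informative (U x) with
  | left h => proj1_sig (F (exist _ x h))
  | right _ => RtoC 0
  end.

(* Complex differentiability (C-linear Frechet differential) at every point. *)
Definition holomorphic {V : CSpace} {U : V -> Prop} (F : pts U -> pts unit_disc) : Prop :=
  forall s : V, U s ->
    ex_filterdiff (K := C_AbsRing) (U := V) (V := C_NormedModule) (ext F) (locally s).

Inductive datum {V : CSpace} (U : V -> Prop) : Type :=
| Discrete (s1 s2 : pts U)
| Infinitesimal (s : pts U) (v : V).
Arguments Discrete {V U} s1 s2.
Arguments Infinitesimal {V U} s v.

Definition nondegenerate {V : CSpace} {U : V -> Prop} (d : datum U) : Prop :=
  match d with
  | Discrete s1 s2 => s1 <> s2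
  | Infinitesimal _ v => v <> zero
  end.

(* [C_lim] is the limit along punctured neighbourhoods, whenever that limit
   exists; it does when F is holomorphic and U is open. *)
Definition dir_deriv {V : CSpace} {U : V -> Prop} (F : pts U -> pts unit_disc)
    (s v : V) : C :=
  C_lim (fun z : C => ((ext F (plus s (scal z v)) - ext F s) / z)%C) (RtoC 0).

Definition push {V : CSpace} {U : V -> Prop} (F : pts U -> pts unit_disc)
    (d : datum U) : datum unit_disc :=
  match d with
  | Discrete s1 s2 => Discrete (F s1) (F s2)
  | Infinitesimal s v => Infinitesimal (F s) (dir_deriv F (proj1_sig s) v : C_NormedModule)
  end.

(* The inverse of [tanh], for |x| < 1. *)
Definition artanh (x : R) : R := / 2 * ln ((1 + x) / (1 - x)).

Definition datum_abs (d : datum unit_disc) : R :=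
  match d with
  | Discrete z1 z2 =>
      let a : C := proj1_sig z1 in
      let b : C := proj1_sig z2 in
      artanh (Cmod ((a - b) / (RtoC 1 - Cconj b * a))%C)
  | Infinitesimal z v => Cmod v / (1 - Cmod (proj1_sig z) ^ 2)
  end.

Definition car {V : CSpace} {U : V -> Prop} (d : datum U) : Rbar :=
  Lub_Rbar (fun r => exists F : pts U -> pts unit_disc,
                       holomorphic F /\ r = datum_abs (push F d)).

Definition solves_car {V : CSpace} {U : V -> Prop} (F : pts U -> pts unit_disc)
    (d : datum U) : Prop :=
  holomorphic F /\ Finite (datum_abs (push F d)) = car d.

Definition universal_set {V : CSpace} (U : V -> Prop)
    (S : Ensemble (pts U -> pts unit_disc)) : Prop :=
  (forall F, In _ S F -> holomorphic F) /\
  (forall d : datum U, nondegenerate d -> exists F, In _ S F /\ solves_car F d).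

Definition minimal_universal_set {V : CSpace} (U : V -> Prop)
    (S : Ensemble (pts U -> pts unit_disc)) : Prop :=
  universal_set U S /\
  ~ (exists S', Strict_Included _ S' S /\ universal_set U S').

Definition disc_automorphism (m : pts unit_disc -> pts unit_disc) : Prop :=
  holomorphic m /\
  exists m' : pts unit_disc -> pts unit_disc,
    holomorphic m' /\ (forall x, m' (m x) = x) /\ (forall x, m (m' x) = x).

(* [S'] = { m_F o F : F in S }; the values of [m] off [S] are irrelevant. *)
Definition equivalent {V : CSpace} {U : V -> Prop}
    (S S' : Ensemble (pts U -> pts unit_disc)) : Prop :=
  exists m : (pts U -> pts unit_disc) -> (pts unit_disc -> pts unit_disc),
    (forall F, In _ S F -> disc_automorphism (m F)) /\
    forall G, In _ S' G <-> exists F, In _ S F /\ G = (fun x => m F (F x)).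

(* Main.v *)
Require Import Defs.
From Stdlib Require Import Reals Ensembles ClassicalEpsilon Lra Lia Psatz.
From Stdlib Require Import FunctionalExtensionality PropExtensionality ProofIrrelevance.
From Coquelicot Require Import Coquelicot.
Open Scope R_scope.

(* Schwarz-Pick is obtained from the mean value property of z |-> f z / z on circles about 0, and
   this from Goursat's theorem on rectangles for f (exp z).

   A family Phi of holomorphic maps that is universal, and such that each Phi i is up to
   automorphisms the only solution for some datum delta i not solved by the others, is a minimal
   universal set, and every other one is obtained from it by composing with automorphisms.  The
   families are {id}, the two coordinates, and Phi_w (s, p) = (2 w p - s) / (2 - w s), |w| = 1.

   A map solves the problem for a datum as soon as an analytic disc through the datum is sent to
   the unit disc by an automorphism.  In the symmetrized bidisc let w maximize |Phi_w delta|, and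
   let points be pairs {l + sqrt q, l - sqrt q} in the upper half-plane, the boundary point 1 / w
   being moved to infinity.  Then Phi_w is the mean l, and the other Phi_h are l - t - q / (l - t), t real,
   up to automorphisms.  Maximality of w gives a real quadratic q (l) = a l^2 + b l + c
   through the datum, nonnegative on the real line and with a <= 1, and l |-> (l, q (l)) is the
   desired disc.

   For uniqueness, an extremal F equals M (l) on one such disc.  Quadratics through the same point
   with larger or smaller a give competing discs, so dF / dq vanishes along the disc, hence F = M (l)
   on every disc meeting it, and two steps of this kind reach every point.  The bidisc is treated
   in the same way with the discs z |-> (z, c m (z)), m an automorphism and |c| <= 1. *)

(** * Complex differentiation *)

(** The quotient f z / z is only known to be continuous at 0. In the variable exp z the circles
    about 0 become vertical segments of length 2 PI, the point 0 is never met, and the horizontal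
    sides of a rectangle cancel by periodicity, so Goursat's theorem on rectangles suffices.

    In the symmetrized bidisc the half-plane model turns maximality over the circle into a
    polynomial inequality in the real parameter t, the maximizing map itself sitting at t =
    infinity; the vanishing of its leading coefficient is what makes the quadratic real. The bound a
    <= 1 keeps the disc inside the domain; the excluded limit case is q = (l - t)^2, where one root
    of the pair stays on the real line.

    Uniqueness requires room on both sides of an extremal disc, because the derivative across it is
    killed by two opposite perturbations. The characterizing datum is therefore taken on the disc q
    = (l^2 + 1) / 2, among the strictly positive quadratics with 0 < a < 1. Every point of the
    domain lies on such a disc, but two of these discs need not meet, whence the second step through
    a larger quadratic. *)

Lemma filterdiff_eps {V W : CSpace} (f : V -> W) (s : V) (l : V -> W) :
  filterdiff f (locally s) l <->
  is_linear l /\ forall eps, 0 < eps -> exists del, 0 < del /\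
    forall x, norm (minus x s) < del ->
      norm (minus (minus (f x) (f s)) (l (minus x s))) <= eps * norm (minus x s).
Proof.
  split; intros [Hl H]; split; trivial.
  - intros eps Heps.
    destruct (H s (fun P HP => HP) (mkposreal eps Heps)) as [d Hd].
    exists d; split; [apply cond_pos|].
    intros x Hx; apply Hd; now apply norm_compat1.
  - intros x Hx eps.
    apply is_filter_lim_locally_unique in Hx; subst x.
    destruct (H eps (cond_pos eps)) as [d [Hd Hd']].
    assert (Hn : 0 < norm_factor (V := V)) by apply norm_factor_gt_0.
    (* Balls of a normed module are comparable to norm balls only up to [norm_factor], so the radius
       is divided by it. *)
    exists (mkposreal _ (Rdiv_lt_0_compat _ _ Hd Hn)).
    intros y Hy; apply Hd'.
    apply norm_compat2 in Hy; simpl in Hy.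
    replace (norm_factor * (d / norm_factor)) with d in Hy by (field; lra).
    exact Hy.
Qed.

Definition cdiff (f : C -> C) (z l : C) : Prop :=
  filterdiff (K := C_AbsRing) (U := C_NormedModule) (V := C_NormedModule)
    f (locally z) (fun h : C => (l * h)%C).

Lemma is_linear_Cmult (l : C) :
  is_linear (K := C_AbsRing) (U := C_NormedModule) (V := C_NormedModule)
    (fun h : C => (l * h)%C).
Proof.
  apply (is_linear_scal_r (K := C_AbsRing) (V := C_NormedModule) l).
  exact Cmult_comm.
Qed.

Lemma cdiff_eps (f : C -> C) (z l : C) :
  cdiff f z l <->
  forall eps, 0 < eps -> exists del, 0 < del /\
    forall w, Cmod (w - z) < del ->
      Cmod (f w - f z - l * (w - z))%C <= eps * Cmod (w - z).
Proof.
  unfold cdiff; rewrite filterdiff_eps; split.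
  - now intros [_ H].
  - intros H; split; [apply is_linear_Cmult | exact H].
Qed.

Lemma norm_fst_le (x : C2) : Cmod (fst x) <= norm x.
Proof.
  change (norm x) with (sqrt (Cmod (fst x) ^ 2 + Cmod (snd x) ^ 2)).
  rewrite <- (sqrt_pow2 (Cmod (fst x))) at 1 by apply Cmod_ge_0.
  apply sqrt_le_1_alt; nra.
Qed.

Lemma norm_snd_le (x : C2) : Cmod (snd x) <= norm x.
Proof.
  change (norm x) with (sqrt (Cmod (fst x) ^ 2 + Cmod (snd x) ^ 2)).
  rewrite <- (sqrt_pow2 (Cmod (snd x))) at 1 by apply Cmod_ge_0.
  apply sqrt_le_1_alt; nra.
Qed.

Lemma filterdiff_Cmult (x : C2) :
  filterdiff (K := C_AbsRing) (U := C2) (V := C_NormedModule)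
    (fun t : C2 => (fst t * snd t)%C) (locally x)
    (fun t : C2 => (fst t * snd x + fst x * snd t)%C).
Proof.
  apply filterdiff_eps; split.
  - apply (is_linear_comp (K := C_AbsRing) (U := C2) (V := C2) (W := C_NormedModule)
      (fun t => ((fst t * snd x)%C, (fst x * snd t)%C))
      (fun t => (fst t + snd t)%C)).
    + apply (is_linear_prod (K := C_AbsRing) (T := C2) (U := C_NormedModule) (V := C_NormedModule)
        (fun t => (fst t * snd x)%C) (fun t => (fst x * snd t)%C)).
      * apply (is_linear_ext (K := C_AbsRing) (U := C2) (V := C_NormedModule)
          (fun t => (snd x * fst t)%C)); [intros; apply Cmult_comm|].
        apply (is_linear_comp (K := C_AbsRing) (U := C2) (V := C_NormedModule) (W := C_NormedModule)
          fst (fun h => (snd x * h)%C)); [apply is_linear_fst | apply is_linear_Cmult].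
      * apply (is_linear_comp (K := C_AbsRing) (U := C2) (V := C_NormedModule) (W := C_NormedModule)
          snd (fun h => (fst x * h)%C)); [apply is_linear_snd | apply is_linear_Cmult].
    + apply (is_linear_plus (K := C_AbsRing) (V := C_NormedModule)).
  - intros eps Heps; exists eps; split; trivial.
    intros y Hy.
    assert (H1 := norm_fst_le (minus y x)). assert (H2 := norm_snd_le (minus y x)).
    destruct x as [x1 x2], y as [y1 y2].
    change (fst (minus (y1, y2) (x1, x2) : C2)) with (y1 - x1)%C in H1.
    change (snd (minus (y1, y2) (x1, x2) : C2)) with (y2 - x2)%C in H2.
    change (Cmod ((y1 * y2 - x1 * x2) - ((y1 - x1) * x2 + x1 * (y2 - x2)))%C <=
      eps * norm (minus (y1, y2) (x1, x2) : C2)).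
    (* The remainder of the product is the product of the two increments, which is quadratic in the
       norm. *)
    replace ((y1 * y2 - x1 * x2) - ((y1 - x1) * x2 + x1 * (y2 - x2)))%C
      with ((y1 - x1) * (y2 - x2))%C by ring.
    rewrite Cmod_mult.
    apply Rmult_le_compat; try apply Cmod_ge_0; [|exact H2].
    apply Rlt_le; exact (Rle_lt_trans _ _ _ H1 Hy).
Qed.

Lemma cdiff_inv (z : C) : z <> 0 -> cdiff Cinv z (- / (z * z))%C.
Proof.
  intros Hz; apply cdiff_eps; intros eps Heps.
  assert (Hz' : 0 < Cmod z) by now apply Cmod_gt_0.
  (* The first bound keeps |w| above |z| / 2; the second then makes |w - z| / (|w| |z|^2) at most
     eps. *)
  exists (Rmin (Cmod z / 2) (eps * Cmod z ^ 3 / 2)); split.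
  { apply Rmin_pos; [lra|]. assert (0 < Cmod z ^ 3) by now apply pow_lt. nra. }
  intros w Hw.
  assert (Hw1 : Cmod (w - z) < Cmod z / 2) by (eapply Rlt_le_trans; [exact Hw|apply Rmin_l]).
  assert (Hw2 : Cmod (w - z) < eps * Cmod z ^ 3 / 2) by (eapply Rlt_le_trans; [exact Hw|apply Rmin_r]).
  assert (Hwz : Cmod z / 2 < Cmod w).
  { assert (H := Cmod_triangle (z - w) w).
    replace (z - w + w)%C with z in H by ring.
    rewrite <- (Cmod_opp (z - w)) in H.
    replace (- (z - w))%C with (w - z)%C in H by ring. lra. }
  assert (Hw0 : w <> 0) by (apply Cmod_gt_0; lra).
  replace (/ w - / z - - / (z * z) * (w - z))%C with ((w - z) * ((w - z) / (w * (z * z))))%C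
    by (field; auto).
  rewrite Cmod_mult, (Rmult_comm (Cmod (w - z))).
  apply Rmult_le_compat_r; [apply Cmod_ge_0|].
  rewrite Cmod_div, !Cmod_mult
    by (apply Cmult_neq_0; [|apply Cmult_neq_0]; trivial).
  assert (Hp : 0 < Cmod w * (Cmod z * Cmod z)).
  { apply Rmult_lt_0_compat; [lra|]. now apply Rmult_lt_0_compat. }
  apply (Rmult_le_reg_r (Cmod w * (Cmod z * Cmod z))); trivial.
  unfold Rdiv; rewrite Rmult_assoc, Rinv_l, Rmult_1_r by lra.
  apply Rlt_le, (Rlt_le_trans _ _ _ Hw2).
  replace (eps * Cmod z ^ 3 / 2) with (eps * ((Cmod z / 2) * (Cmod z * Cmod z))) by (field).
  apply Rmult_le_compat_l; [lra|]. apply Rmult_le_compat_r; [nra|lra].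
Qed.

Definition vdiff {V : CSpace} (f : V -> C) (s : V) (l : V -> C) : Prop :=
  filterdiff (K := C_AbsRing) (U := V) (V := C_NormedModule) f (locally s) l.

Lemma vdiff_ext {V : CSpace} (f : V -> C) s l l' :
  vdiff f s l -> (forall v, l v = l' v) -> vdiff f s l'.
Proof. intros H E; now apply (filterdiff_ext_lin _ _ _ H). Qed.

Lemma vdiff_const {V : CSpace} (c : C) (s : V) : vdiff (fun _ => c) s (fun _ => RtoC 0).
Proof. apply (filterdiff_const (K := C_AbsRing) (U := V) (V := C_NormedModule)). Qed.

Lemma vdiff_plus {V : CSpace} (f g : V -> C) s lf lg :
  vdiff f s lf -> vdiff g s lg ->
  vdiff (fun x => f x + g x)%C s (fun v => lf v + lg v)%C.
Proof. apply (filterdiff_plus_fct (K := C_AbsRing) (U := V) (V := C_NormedModule)). Qed.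

Lemma vdiff_opp {V : CSpace} (f : V -> C) s lf :
  vdiff f s lf -> vdiff (fun x => - f x)%C s (fun v => - lf v)%C.
Proof. apply (filterdiff_opp_fct (K := C_AbsRing) (U := V) (V := C_NormedModule)). Qed.

Lemma vdiff_mult {V : CSpace} (f g : V -> C) s lf lg :
  vdiff f s lf -> vdiff g s lg ->
  vdiff (fun x => f x * g x)%C s (fun v => lf v * g s + f s * lg v)%C.
Proof.
  intros Hf Hg.
  apply (filterdiff_comp'_2 (K := C_AbsRing) (T := V) (U := C_NormedModule)
    (V := C_NormedModule) (W := C_NormedModule) f g Cmult s lf lg
    (fun a b => a * g s + f s * b)%C Hf Hg).
  exact (filterdiff_Cmult (f s, g s)).
Qed.

Lemma vdiff_comp {V : CSpace} (g : C -> C) (f : V -> C) s lf l :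
  vdiff f s lf -> cdiff g (f s) l -> vdiff (fun x => g (f x)) s (fun v => l * lf v)%C.
Proof.
  intros Hf Hg.
  exact (filterdiff_comp' (K := C_AbsRing) (U := V) (V := C_NormedModule) (W := C_NormedModule)
    f g s lf (fun h => l * h)%C Hf Hg).
Qed.

Lemma vdiff_div {V : CSpace} (f g : V -> C) s lf lg :
  vdiff f s lf -> vdiff g s lg -> g s <> 0 ->
  vdiff (fun x => f x / g x)%C s (fun v => (lf v * g s - f s * lg v) / (g s * g s))%C.
Proof.
  intros Hf Hg H0. unfold Cdiv.
  eapply vdiff_ext; [apply vdiff_mult; [exact Hf|]; apply vdiff_comp; [exact Hg|now apply cdiff_inv]|].
  intros v; cbv beta; field; trivial.
Qed.

Lemma vdiff_fst (s : C2) : vdiff (V := C2) fst s fst.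
Proof. apply filterdiff_linear; apply is_linear_fst. Qed.
Lemma vdiff_snd (s : C2) : vdiff (V := C2) snd s snd.
Proof. apply filterdiff_linear; apply is_linear_snd. Qed.

Lemma vdiff_locally {V : CSpace} (f g : V -> C) s l :
  locally s (fun x => f x = g x) -> vdiff f s l -> vdiff g s l.
Proof. apply (filterdiff_ext_locally (K := C_AbsRing) (U := V) (V := C_NormedModule)). Qed.

Lemma cdiff_id (z : C) : cdiff (fun w => w) z 1.
Proof.
  apply (vdiff_ext (V := C_NormedModule) _ _ (fun v => v)).
  - apply (filterdiff_id (K := C_AbsRing) (V := C_NormedModule)).
  - intros v; symmetry; apply Cmult_1_l.
Qed.

Lemma cdiff_locally (f g : C -> C) (z l : C) del :
  0 < del -> (forall w, Cmod (w - z) < del -> f w = g w) -> cdiff f z l -> cdiff g z l.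
Proof.
  intros Hdel E; rewrite !cdiff_eps; intros H eps Heps.
  destruct (H eps Heps) as [d [Hd H']].
  exists (Rmin d del); split; [now apply Rmin_pos|].
  intros w Hw.
  rewrite <- !E.
  - apply H'; eapply Rlt_le_trans; [exact Hw|apply Rmin_l].
  - replace (z - z)%C with (RtoC 0) by ring. now rewrite Cmod_0.
  - eapply Rlt_le_trans; [exact Hw|apply Rmin_r].
Qed.

Lemma cdiff_eq (f : C -> C) z l l' : cdiff f z l -> l = l' -> cdiff f z l'.
Proof. now intros H <-. Qed.

Lemma cdiff_const c z : cdiff (fun _ => c) z 0.
Proof.
  apply (vdiff_ext (V := C_NormedModule) _ _ (fun _ => RtoC 0)); [apply vdiff_const|].
  intros v; ring.
Qed.

Lemma cdiff_plus f g z lf lg :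
  cdiff f z lf -> cdiff g z lg -> cdiff (fun x => f x + g x)%C z (lf + lg).
Proof.
  intros Hf Hg.
  eapply (vdiff_ext (V := C_NormedModule)); [exact (vdiff_plus (V := C_NormedModule) _ _ _ _ _ Hf Hg)|].
  intros v; cbv beta; ring.
Qed.

Lemma cdiff_opp f z lf : cdiff f z lf -> cdiff (fun x => - f x)%C z (- lf).
Proof.
  intros Hf.
  eapply (vdiff_ext (V := C_NormedModule)); [exact (vdiff_opp (V := C_NormedModule) _ _ _ Hf)|].
  intros v; cbv beta; ring.
Qed.

Lemma cdiff_minus f g z lf lg :
  cdiff f z lf -> cdiff g z lg -> cdiff (fun x => f x - g x)%C z (lf - lg).
Proof. intros Hf Hg; apply cdiff_plus; [trivial | now apply cdiff_opp]. Qed.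

Lemma cdiff_mult f g z lf lg :
  cdiff f z lf -> cdiff g z lg -> cdiff (fun x => f x * g x)%C z (lf * g z + f z * lg).
Proof.
  intros Hf Hg.
  eapply (vdiff_ext (V := C_NormedModule)); [exact (vdiff_mult (V := C_NormedModule) _ _ _ _ _ Hf Hg)|].
  intros v; cbv beta; ring.
Qed.

Lemma cdiff_div f g z lf lg :
  cdiff f z lf -> cdiff g z lg -> g z <> 0 ->
  cdiff (fun x => f x / g x)%C z ((lf * g z - f z * lg) / (g z * g z)).
Proof.
  intros Hf Hg H0.
  eapply (vdiff_ext (V := C_NormedModule)); [exact (vdiff_div (V := C_NormedModule) _ _ _ _ _ Hf Hg H0)|].
  intros v; cbv beta; field; trivial.
Qed.

Lemma cdiff_comp g f z lf lg :
  cdiff f z lf -> cdiff g (f z) lg -> cdiff (fun x => g (f x)) z (lg * lf).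
Proof.
  intros Hf Hg.
  eapply (vdiff_ext (V := C_NormedModule)); [exact (vdiff_comp (V := C_NormedModule) _ _ _ _ _ Hf Hg)|].
  intros v; cbv beta; ring.
Qed.

Lemma cdiff_unique f z l l' : cdiff f z l -> cdiff f z l' -> l = l'.
Proof.
  rewrite !cdiff_eps; intros H H'.
  destruct (Ceq_dec l l') as [E|E]; [exact E|exfalso].
  assert (E' : 0 < Cmod (l - l')).
  { apply Cmod_gt_0; intros E0; apply E.
    replace l with (l - l' + l')%C by ring; rewrite E0; ring. }
  destruct (H (Cmod (l - l') / 4)) as [d [Hd Hd']]; [lra|].
  destruct (H' (Cmod (l - l') / 4)) as [e [He He']]; [lra|].
  set (m := Rmin d e / 2).
  assert (Hm : 0 < m) by (unfold m; assert (0 < Rmin d e) by (now apply Rmin_pos); lra).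
  assert (Hm1 : m < d) by (unfold m; assert (Rmin d e <= d) by apply Rmin_l; unfold m in Hm; lra).
  assert (Hm2 : m < e) by (unfold m; assert (Rmin d e <= e) by apply Rmin_r; unfold m in Hm; lra).
  assert (Em : Cmod (z + m - z)%C = m).
  { replace (z + m - z)%C with (RtoC m) by ring. rewrite Cmod_R; now apply Rabs_pos_eq, Rlt_le. }
  specialize (Hd' (z + m)%C). specialize (He' (z + m)%C). rewrite Em in Hd', He'.
  specialize (Hd' Hm1). specialize (He' Hm2).
  assert (T := Cmod_triangle (f (z + m) - f z - l' * (z + m - z))%C
                 (- (f (z + m) - f z - l * (z + m - z)))%C).
  rewrite Cmod_opp in T.
  replace (f (z + m) - f z - l' * (z + m - z) + - (f (z + m) - f z - l * (z + m - z)))%C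
    with ((l - l') * m)%C in T by ring.
  rewrite Cmod_mult, Cmod_R, (Rabs_pos_eq m) in T by lra.
  nra.
Qed.

Lemma cdiff_cont f z l : cdiff f z l -> forall eps, 0 < eps -> exists del, 0 < del /\
  forall w, Cmod (w - z) < del -> Cmod (f w - f z) < eps.
Proof.
  rewrite cdiff_eps; intros H eps Heps.
  destruct (H 1 Rlt_0_1) as [d [Hd H']].
  assert (Hl := Cmod_ge_0 l).
  assert (He : 0 < eps / (Cmod l + 2)) by (apply Rdiv_lt_0_compat; lra).
  exists (Rmin d (eps / (Cmod l + 2))); split; [now apply Rmin_pos|].
  intros w Hw.
  assert (Hw1 := Rlt_le_trans _ _ _ Hw (Rmin_l _ _)).
  assert (Hw2 := Rlt_le_trans _ _ _ Hw (Rmin_r _ _)).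
  specialize (H' w Hw1).
  assert (T := Cmod_triangle (f w - f z - l * (w - z))%C (l * (w - z))%C).
  replace (f w - f z - l * (w - z) + l * (w - z))%C with (f w - f z)%C in T by ring.
  rewrite Cmod_mult in T.
  apply (Rmult_lt_compat_l (Cmod l + 2)) in Hw2; [|lra].
  replace ((Cmod l + 2) * (eps / (Cmod l + 2))) with eps in Hw2 by (field; lra).
  assert (H0 := Cmod_ge_0 (w - z)). nra.
Qed.

(** * Goursat's theorem and the mean value property *)

Lemma nested_intervals (x w : nat -> R) :
  (forall n, 0 <= w n) -> (forall n, x n <= x (S n)) ->
  (forall n, x (S n) + w (S n) <= x n + w n) ->
  exists z, forall n, x n <= z <= x n + w n.
Proof.
  intros Hw Hx Hr.
  assert (Hx' : forall n k, x n <= x (n + k)%nat).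
  { intros n k; induction k; [rewrite Nat.add_0_r; lra|].
    rewrite Nat.add_succ_r; specialize (Hx (n + k)%nat); lra. }
  assert (Hr' : forall n k, x (n + k)%nat + w (n + k)%nat <= x n + w n).
  { intros n k; induction k; [rewrite Nat.add_0_r; lra|].
    rewrite Nat.add_succ_r; specialize (Hr (n + k)%nat); lra. }
  assert (Hmn : forall m n, x m <= x n + w n).
  { intros m n; destruct (Nat.le_ge_cases m n) as [L|L].
    - replace n with (m + (n - m))%nat by lia. specialize (Hx' m (n - m)%nat).
      specialize (Hw (m + (n - m))%nat); lra.
    - replace m with (n + (m - n))%nat by lia. specialize (Hr' n (m - n)%nat).
      specialize (Hw (n + (m - n))%nat); lra. }
  destruct (completeness (fun r => exists n, r = x n)) as [z [Hz1 Hz2]].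
  - exists (x 0%nat + w 0%nat); intros r [n ->]; apply Hmn.
  - now exists (x 0%nat), 0%nat.
  - exists z; intros n; split.
    + apply Hz1; now exists n.
    + apply Hz2; intros r [m ->]; apply Hmn.
Qed.

Lemma Cmod_le_abs (x y : R) : Cmod (x, y) <= Rabs x + Rabs y.
Proof.
  replace (x, y) with (RtoC x + Ci * RtoC y)%C by (unfold Ci, RtoC, Cmult, Cplus; simpl; f_equal; ring).
  eapply Rle_trans; [apply Cmod_triangle|].
  rewrite Cmod_mult, Cmod_Ci, !Cmod_R; lra.
Qed.

Lemma im_le_Cmod (z : C) : Rabs (Im z) <= Cmod z.
Proof. eapply Rle_trans; [apply Rmax_r | apply Rmax_Cmod]. Qed.

(** * Goursat's theorem on rectangles in the left half-plane, the preimage of the punctured disc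
    under exp *)

Section Goursat.

Variable f : C -> C.
Hypothesis Hf : forall z, Re z < 0 -> exists l, cdiff f z l.

Let u x y := Re (f (x, y)).
Let v x y := Im (f (x, y)).

(** Increments are measured in the sum norm, in which a rectangle with sides w and h has diameter w
    + h. *)
Lemma CR_equations x0 y0 : x0 < 0 -> exists a b, forall eps, 0 < eps ->
  exists del, 0 < del /\ forall x y, Rabs (x - x0) + Rabs (y - y0) < del ->
    Rabs (u x y - u x0 y0 - (a * (x - x0) - b * (y - y0))) <= eps * (Rabs (x - x0) + Rabs (y - y0)) /\
    Rabs (v x y - v x0 y0 - (b * (x - x0) + a * (y - y0))) <= eps * (Rabs (x - x0) + Rabs (y - y0)).
Proof.
  intros Hx.
  destruct (Hf (x0, y0) Hx) as [[a b] Hl].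
  exists a, b; intros eps Heps.
  destruct (proj1 (cdiff_eps _ _ _) Hl eps Heps) as [d [Hd H]].
  exists d; split; [exact Hd|]; intros x y Hxy.
  assert (L := Cmod_le_abs (x - x0) (y - y0)).
  change (x - x0, y - y0) with ((x, y) - (x0, y0))%C in L.
  specialize (H (x, y) (Rle_lt_trans _ _ _ L Hxy)).
  assert (H' := Rle_trans _ _ _ H (Rmult_le_compat_l _ _ _ (Rlt_le _ _ Heps) L)).
  split; (eapply Rle_trans; [|exact H']).
  - eapply Rle_trans; [|apply re_le_Cmod]; apply Req_le; f_equal; unfold u, Re; simpl; ring.
  - eapply Rle_trans; [|apply im_le_Cmod]; apply Req_le; f_equal; unfold v, Im; simpl; ring.
Qed.

Lemma CR_continuous x0 y0 : x0 < 0 ->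
  continuous (fun x => v x y0) x0 /\ continuous (fun y => u x0 y) y0.
Proof.
  intros Hx; destruct (Hf (x0, y0) Hx) as [l Hl].
  assert (H := cdiff_cont _ _ _ Hl).
  split; apply filterlim_locally; intros [e He]; destruct (H e He) as [d [Hd H']];
    exists (mkposreal d Hd); intros t Ht.
  - apply (Rle_lt_trans _ (Cmod (f (t, y0) - f (x0, y0))%C)); [exact (im_le_Cmod (f (t, y0) - f (x0, y0))%C)|].
    apply H'. eapply Rle_lt_trans; [apply (Cmod_le_abs (t - x0) (y0 - y0))|].
    rewrite Rminus_diag, Rabs_R0, Rplus_0_r. exact Ht.
  - apply (Rle_lt_trans _ (Cmod (f (x0, t) - f (x0, y0))%C)); [exact (re_le_Cmod (f (x0, t) - f (x0, y0))%C)|].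
    apply H'. eapply Rle_lt_trans; [apply (Cmod_le_abs (x0 - x0) (t - y0))|].
    rewrite Rminus_diag, Rabs_R0, Rplus_0_l. exact Ht.
Qed.

Lemma ex_RInt_v y a b : a <= b -> b < 0 -> ex_RInt (fun x => v x y) a b.
Proof.
  intros Hab Hb; apply (ex_RInt_continuous (V := R_CompleteNormedModule)); intros z Hz.
  rewrite Rmax_right in Hz by lra. exact (proj1 (CR_continuous z y ltac:(lra))).
Qed.

Lemma ex_RInt_u x c d : x < 0 -> ex_RInt (fun y => u x y) c d.
Proof. intros Hx; apply (ex_RInt_continuous (V := R_CompleteNormedModule)); intros z _; exact (proj2 (CR_continuous x z Hx)). Qed.

(* Imaginary part of the integral of f along the boundary of [a,b] x [c,d]. *)
Let J a b c d :=
  (RInt (fun x => v x c) a b - RInt (fun x => v x d) a b) +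
  (RInt (fun y => u b y) c d - RInt (fun y => u a y) c d).

Lemma J_split_h a m b c d : a <= m -> m <= b -> b < 0 -> J a b c d = J a m c d + J m b c d.
Proof.
  intros H1 H2 H3; unfold J.
  rewrite <- (RInt_Chasles (fun x => v x c) a m b), <- (RInt_Chasles (fun x => v x d) a m b)
    by (apply ex_RInt_v; lra).
  unfold plus; simpl; ring.
Qed.

Lemma J_split_v a b c m d : a <= b -> b < 0 -> J a b c d = J a b c m + J a b m d.
Proof.
  intros H1 H2; unfold J.
  rewrite <- (RInt_Chasles (fun y => u b y) c m d), <- (RInt_Chasles (fun y => u a y) c m d)
    by (apply ex_RInt_u; lra).
  unfold plus; simpl; ring.
Qed.

(** The affine part of f contributes nothing: the corrections A * h and - (A * w) added to the two
    integrands below have integrals that cancel. What remains is a remainder of size 2 eps (w + h),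
    integrated over sides of length w and h. *)
Lemma J_small x0 y0 eps : x0 < 0 -> 0 < eps -> exists del, 0 < del /\
  forall a c w h, 0 <= w -> 0 <= h -> w + h < del -> a <= x0 <= a + w -> c <= y0 <= c + h ->
    a + w < 0 -> Rabs (J a (a + w) c (c + h)) <= eps * (2 * (w + h) ^ 2).
Proof.
  intros Hx Heps.
  destruct (CR_equations x0 y0 Hx) as [A [B H]].
  destruct (H eps Heps) as [d [Hd Hd']]; clear H.
  exists d; split; [exact Hd|].
  intros a c w h Hw Hh Hwh Ha Hc Haw.
  assert (Hbox : forall x y, a <= x <= a + w -> c <= y <= c + h ->
     Rabs (x - x0) + Rabs (y - y0) <= w + h).
  { intros x y H1 H2. apply Rplus_le_compat; apply Rabs_le; lra. }
  assert (Hv : Rabs (RInt (fun x => v x c - v x (c + h) + A * h) a (a + w)) <= (a + w - a) * (2 * eps * (w + h))).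
  { apply abs_RInt_le_const; [lra| |].
    - apply (ex_RInt_plus (V := R_NormedModule) (fun x => v x c - v x (c + h)) (fun _ => A * h)).
      + apply (ex_RInt_minus (V := R_NormedModule)); apply ex_RInt_v; lra.
      + apply ex_RInt_const.
    - intros t Ht.
      assert (B1 := Hbox t c Ht ltac:(lra)). assert (B2 := Hbox t (c + h) Ht ltac:(lra)).
      destruct (Hd' t c) as [_ E1]; [lra|]. destruct (Hd' t (c + h)) as [_ E2]; [lra|].
      apply (Rmult_le_compat_l eps) in B1; [|lra]. apply (Rmult_le_compat_l eps) in B2; [|lra].
      replace (v t c - v t (c + h) + A * h) with
        ((v t c - v x0 y0 - (B * (t - x0) + A * (c - y0))) -
         (v t (c + h) - v x0 y0 - (B * (t - x0) + A * (c + h - y0)))) by ring.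
      eapply Rle_trans; [apply Rabs_triang|]; rewrite Rabs_Ropp; lra. }
  assert (Hu : Rabs (RInt (fun y => u (a + w) y - u a y + - (A * w)) c (c + h)) <= (c + h - c) * (2 * eps * (w + h))).
  { apply abs_RInt_le_const; [lra| |].
    - apply (ex_RInt_plus (V := R_NormedModule) (fun y => u (a + w) y - u a y) (fun _ => - (A * w))).
      + apply (ex_RInt_minus (V := R_NormedModule)); apply ex_RInt_u; lra.
      + apply ex_RInt_const.
    - intros t Ht.
      assert (B1 := Hbox a t ltac:(lra) Ht). assert (B2 := Hbox (a + w) t ltac:(lra) Ht).
      destruct (Hd' a t) as [E1 _]; [lra|]. destruct (Hd' (a + w) t) as [E2 _]; [lra|].
      apply (Rmult_le_compat_l eps) in B1; [|lra]. apply (Rmult_le_compat_l eps) in B2; [|lra].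
      replace (u (a + w) t - u a t + - (A * w)) with
        ((u (a + w) t - u x0 y0 - (A * (a + w - x0) - B * (t - y0))) -
         (u a t - u x0 y0 - (A * (a - x0) - B * (t - y0)))) by ring.
      eapply Rle_trans; [apply Rabs_triang|]; rewrite Rabs_Ropp; lra. }
  assert (E1 : RInt (fun x => v x c - v x (c + h) + A * h) a (a + w) =
     RInt (fun x => v x c) a (a + w) - RInt (fun x => v x (c + h)) a (a + w) + w * (A * h)).
  { transitivity (RInt (fun x => v x c - v x (c + h)) a (a + w) + RInt (fun _ => A * h) a (a + w)).
    - apply (RInt_plus (V := R_CompleteNormedModule) (fun x => v x c - v x (c + h)) (fun _ => A * h)).
      + apply (ex_RInt_minus (V := R_NormedModule)); apply ex_RInt_v; lra.
      + apply ex_RInt_const.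
    - rewrite RInt_const. f_equal.
      + apply (RInt_minus (V := R_CompleteNormedModule)); apply ex_RInt_v; lra.
      + unfold scal; simpl; unfold mult; simpl; ring. }
  assert (E2 : RInt (fun y => u (a + w) y - u a y + - (A * w)) c (c + h) =
     RInt (fun y => u (a + w) y) c (c + h) - RInt (fun y => u a y) c (c + h) - h * (A * w)).
  { transitivity (RInt (fun y => u (a + w) y - u a y) c (c + h) + RInt (fun _ => - (A * w)) c (c + h)).
    - apply (RInt_plus (V := R_CompleteNormedModule) (fun y => u (a + w) y - u a y) (fun _ => - (A * w))).
      + apply (ex_RInt_minus (V := R_NormedModule)); apply ex_RInt_u; lra.
      + apply ex_RInt_const.
    - rewrite RInt_const. apply (f_equal2 Rplus).
      + apply (RInt_minus (V := R_CompleteNormedModule)); apply ex_RInt_u; lra.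
      + unfold scal; simpl; unfold mult; simpl; ring. }
  unfold J.
  set (I1 := RInt (fun x => v x c) a (a + w)) in *.
  set (I2 := RInt (fun x => v x (c + h)) a (a + w)) in *.
  set (I3 := RInt (fun y => u (a + w) y) c (c + h)) in *.
  set (I4 := RInt (fun y => u a y) c (c + h)) in *.
  rewrite E1 in Hv; rewrite E2 in Hu.
  replace (I1 - I2 + (I3 - I4)) with ((I1 - I2 + w * (A * h)) + (I3 - I4 - h * (A * w))) by ring.
  eapply Rle_trans; [apply Rabs_triang|].
  eapply Rle_trans; [apply Rplus_le_compat; [exact Hv|exact Hu]|].
  apply Req_le; ring.
Qed.

Lemma goursat_rectangle a c w h : 0 <= w -> 0 <= h -> a + w < 0 -> J a (a + w) c (c + h) = 0.
Proof.
  intros Hw Hh Haw.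
  destruct (Req_dec (J a (a + w) c (c + h)) 0) as [E|E]; [exact E|exfalso].
  set (K := Rabs (J a (a + w) c (c + h))).
  assert (HK : 0 < K) by now apply Rabs_pos_lt.
  set (wn n := w / 2 ^ n). set (hn n := h / 2 ^ n).
  assert (H2n : forall n, 0 < 2 ^ n) by (intros; apply pow_lt; lra).
  assert (Hwn : forall n, 0 <= wn n) by (intros; apply Rdiv_le_0_compat; auto).
  assert (Hhn : forall n, 0 <= hn n) by (intros; apply Rdiv_le_0_compat; auto).
  assert (Ewn : forall n, wn n = wn (S n) + wn (S n)).
  { intros n; unfold wn; simpl; field. specialize (H2n n); lra. }
  assert (Ehn : forall n, hn n = hn (S n) + hn (S n)).
  { intros n; unfold hn; simpl; field. specialize (H2n n); lra. }
  (* Invariant of the bisection: the rectangle with lower left corner p and sides w / 2^n, h / 2^n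
     still carries the share K / 4^n of the integral. *)
  set (P n (p : R * R) := fst p + wn n < 0 /\
        K / 4 ^ n <= Rabs (J (fst p) (fst p + wn n) (snd p) (snd p + hn n))).
  assert (step : forall n p, P n p -> exists q, P (S n) q /\
     fst p <= fst q /\ fst q + wn (S n) <= fst p + wn n /\
     snd p <= snd q /\ snd q + hn (S n) <= snd p + hn n).
  { intros n [x y] [Hx HP]; simpl in *.
    assert (W := Hwn (S n)). assert (W' := Hhn (S n)).
    rewrite (Ewn n) in Hx.
    rewrite (Ewn n), (Ehn n) in HP.
    assert (Ewn' := Ewn n). assert (Ehn' := Ehn n).
    set (w1 := wn (S n)) in *. set (h1 := hn (S n)) in *.
    rewrite (J_split_h x (x + w1)) in HP by lra.
    rewrite (J_split_v x (x + w1) y (y + h1)), (J_split_v (x + w1) (x + (w1 + w1)) y (y + h1)) in HP by lra.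
    assert (Es : x + (w1 + w1) = x + w1 + w1) by ring.
    assert (Et : y + (h1 + h1) = y + h1 + h1) by ring.
    rewrite Es, Et in HP.
    set (J1 := J x (x + w1) y (y + h1)) in *.
    set (J2 := J x (x + w1) (y + h1) (y + h1 + h1)) in *.
    set (J3 := J (x + w1) (x + w1 + w1) y (y + h1)) in *.
    set (J4 := J (x + w1) (x + w1 + w1) (y + h1) (y + h1 + h1)) in *.
    assert (H4 : K / 4 ^ n = 4 * (K / 4 ^ S n)).
    { simpl; field. apply pow_nonzero; lra. }
    rewrite H4 in HP.
    set (k := K / 4 ^ S n) in *.
    assert (T : Rabs (J1 + J2 + (J3 + J4)) <= Rabs J1 + Rabs J2 + (Rabs J3 + Rabs J4)).
    { eapply Rle_trans; [apply Rabs_triang|]; apply Rplus_le_compat; apply Rabs_triang. }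
    destruct (Rle_dec k (Rabs J1)) as [L|L];
      [|destruct (Rle_dec k (Rabs J2)) as [L'|L'];
        [|destruct (Rle_dec k (Rabs J3)) as [L''|L'']]].
    - exists (x, y); unfold P; simpl; fold w1 h1 k; repeat split; try lra. exact L.
    - exists (x, y + h1); unfold P; simpl; fold w1 h1 k; repeat split; try lra. exact L'.
    - exists (x + w1, y); unfold P; simpl; fold w1 h1 k; repeat split; try lra. exact L''.
    - assert (L4 : k <= Rabs J4) by lra.
      exists (x + w1, y + h1); unfold P; simpl; fold w1 h1 k; repeat split; try lra. exact L4. }
  set (next n p := epsilon (inhabits (0, 0)) (fun q => P (S n) q /\
     fst p <= fst q /\ fst q + wn (S n) <= fst p + wn n /\
     snd p <= snd q /\ snd q + hn (S n) <= snd p + hn n)).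
  assert (Hnext : forall n p, P n p -> P (S n) (next n p) /\
     fst p <= fst (next n p) /\ fst (next n p) + wn (S n) <= fst p + wn n /\
     snd p <= snd (next n p) /\ snd (next n p) + hn (S n) <= snd p + hn n).
  { intros n p Hp; unfold next; apply epsilon_spec; now apply step. }
  set (s := nat_rect (fun _ => (R * R)%type) (a, c) next).
  assert (Hs : forall n, P n (s n)).
  { induction n; [|now apply Hnext].
    assert (E0 : wn 0%nat = w) by (unfold wn; simpl; field).
    assert (E0' : hn 0%nat = h) by (unfold hn; simpl; field).
    unfold P; simpl fst; simpl snd; rewrite E0, E0'; split; [exact Haw|].
    change (K / 1 <= K); lra. }
  assert (Hs' : forall n, fst (s n) <= fst (s (S n)) /\ fst (s (S n)) + wn (S n) <= fst (s n) + wn n /\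
     snd (s n) <= snd (s (S n)) /\ snd (s (S n)) + hn (S n) <= snd (s n) + hn n).
  { intros n; exact (proj2 (Hnext n (s n) (Hs n))). }
  destruct (nested_intervals (fun n => fst (s n)) wn) as [x0 Hx0]; [exact Hwn|apply Hs'|apply Hs'|].
  destruct (nested_intervals (fun n => snd (s n)) hn) as [y0 Hy0]; [exact Hhn|apply Hs'|apply Hs'|].
  assert (Hx00 : x0 < 0).
  { destruct (Hs 0%nat) as [H0 _]. specialize (Hx0 0%nat); cbv beta in Hx0; lra. }
  assert (Hwh : 0 <= w + h) by lra.
  (* [J_small] will bound K / 4^n by eps * 2 (w + h)^2 / 4^n, which for this eps is at most half of
     K / 4^n; the + 1 covers w + h = 0. *)
  set (eps := K / (4 * ((w + h) ^ 2 + 1))).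
  assert (Hsq : 0 <= (w + h) ^ 2) by apply pow2_ge_0.
  assert (Heps : 0 < eps) by (apply Rdiv_lt_0_compat; lra).
  destruct (J_small x0 y0 eps Hx00 Heps) as [del [Hdel HJ]].
  destruct (pow_lt_1_zero (/ 2) ltac:(rewrite Rabs_pos_eq; lra) (del / (w + h + 1)) ltac:(apply Rdiv_lt_0_compat; lra))
    as [n Hn].
  specialize (Hn n (Nat.le_refl n)). rewrite Rabs_pos_eq in Hn by (apply pow_le; lra).
  rewrite pow_inv in Hn.
  assert (Hsum : wn n + hn n = (w + h) * / 2 ^ n) by (unfold wn, hn, Rdiv; ring).
  assert (Hi : 0 < / 2 ^ n) by (apply Rinv_0_lt_compat, H2n).
  assert (Hsd : wn n + hn n < del).
  { rewrite Hsum. apply (Rmult_lt_compat_l (w + h + 1)) in Hn; [|lra].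
    replace ((w + h + 1) * (del / (w + h + 1))) with del in Hn by (field; lra). lra. }
  destruct (Hs n) as [Hn1 Hn2].
  assert (HJn := HJ _ _ _ _ (Hwn n) (Hhn n) Hsd (Hx0 n) (Hy0 n) Hn1).
  assert (H4 : / 4 ^ n = / 2 ^ n * / 2 ^ n).
  { rewrite <- Rinv_mult, <- Rpow_mult_distr. now replace (2 * 2) with 4 by ring. }
  assert (F : K / 4 ^ n <= eps * (2 * ((w + h) * / 2 ^ n) ^ 2)) by (rewrite <- Hsum; lra).
  unfold Rdiv in F. rewrite H4 in F.
  assert (F2 : eps * (2 * ((w + h) * / 2 ^ n) ^ 2) = (eps * (2 * (w + h) ^ 2)) * (/ 2 ^ n * / 2 ^ n)) by ring.
  rewrite F2 in F.
  apply Rmult_le_reg_r in F; [|nra].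
  assert (F3 : K = eps * (4 * ((w + h) ^ 2 + 1))) by (unfold eps; field; lra).
  nra.
Qed.

(** By periodicity the two horizontal sides of the rectangle cancel. Applied to g (exp z) with p = 2
    PI, this says that the integral of g over a circle about 0 does not depend on the radius. *)
Lemma RInt_Re_period_const a b p : 0 <= p -> (forall x, f (x, p) = f (x, 0)) -> a <= b -> b < 0 ->
  RInt (fun y => Re (f (b, y))) 0 p = RInt (fun y => Re (f (a, y))) 0 p.
Proof.
  intros Hp Hper Hab Hb.
  assert (H := goursat_rectangle a 0 (b - a) p ltac:(lra) Hp ltac:(lra)).
  unfold J in H. replace (a + (b - a)) with b in H by ring. rewrite Rplus_0_l in H.
  unfold v in H.
  rewrite (RInt_ext (fun x => Im (f (x, p))) (fun x => Im (f (x, 0)))) in H by (intros; now rewrite Hper).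
  unfold u in H. lra.
Qed.

End Goursat.

(** * The complex exponential *)

Definition cexp (z : C) : C := (exp (Re z) * cos (Im z), exp (Re z) * sin (Im z)).

Lemma cexp_plus z w : cexp (z + w) = (cexp z * cexp w)%C.
Proof.
  destruct z as [a b], w as [c d]; unfold cexp, Cmult, Cplus, Re, Im; simpl.
  rewrite exp_plus, cos_plus, sin_plus; f_equal; ring.
Qed.

Lemma Cmod_cexp z : Cmod (cexp z) = exp (Re z).
Proof.
  unfold cexp, Cmod; simpl.
  transitivity (sqrt (exp (Re z) ^ 2)).
  - f_equal. assert (H := sin2_cos2 (Im z)); unfold Rsqr in H. nra.
  - apply sqrt_pow2, Rlt_le, exp_pos.
Qed.

Lemma derivable_lim_small f l : derivable_pt_lim f 0 l -> forall eps, 0 < eps ->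
  exists del, 0 < del /\ forall h, Rabs h < del -> Rabs (f h - f 0 - l * h) <= eps * Rabs h.
Proof.
  intros H eps Heps. destruct (H eps Heps) as [[d Hd] H'].
  exists d; split; [exact Hd|]. intros h Hh.
  destruct (Req_dec h 0) as [->|H0].
  { rewrite Rabs_R0, !Rmult_0_r; rewrite Rminus_0_r, Rminus_diag, Rabs_R0; lra. }
  specialize (H' h H0 Hh). rewrite Rplus_0_l in H'.
  replace (f h - f 0 - l * h) with (((f h - f 0) / h - l) * h) by (field; trivial).
  rewrite Rabs_mult. apply Rmult_le_compat_r; [apply Rabs_pos|lra].
Qed.

Lemma cdiff_cexp z : cdiff cexp z (cexp z).
Proof.
  apply cdiff_eps; intros eps Heps.
  assert (HE := exp_pos (Re z)).
  (* The accuracy demanded of the expansions of exp, sin and cos at 0: the errors add up to at most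
     8 e |w - z|, before multiplication by exp (Re z). *)
  set (e := Rmin 1 (eps / (10 * exp (Re z)))).
  assert (He : 0 < e) by (apply Rmin_pos; [lra|apply Rdiv_lt_0_compat; lra]).
  assert (He1 : e <= 1) by apply Rmin_l.
  assert (He2 : 10 * exp (Re z) * e <= eps).
  { assert (H : e <= eps / (10 * exp (Re z))) by apply Rmin_r.
    apply (Rmult_le_compat_l (10 * exp (Re z))) in H; [|lra].
    replace (10 * exp (Re z) * (eps / (10 * exp (Re z)))) with eps in H by (field; lra). exact H. }
  assert (Lexp := derivable_pt_lim_exp 0). rewrite exp_0 in Lexp.
  assert (Lsin := derivable_pt_lim_sin 0). rewrite cos_0 in Lsin.
  assert (Lcos := derivable_pt_lim_cos 0). rewrite sin_0, Ropp_0 in Lcos.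
  destruct (derivable_lim_small _ _ Lexp e He) as [d1 [Hd1 E1]].
  destruct (derivable_lim_small _ _ Lsin e He) as [d2 [Hd2 E2]].
  destruct (derivable_lim_small _ _ Lcos e He) as [d3 [Hd3 E3]].
  set (d := Rmin (Rmin d1 d2) (Rmin d3 e)).
  assert (Hd : 0 < d) by (unfold d; repeat (assumption || apply Rmin_pos)).
  assert (Hdd : d <= d1 /\ d <= d2 /\ d <= d3 /\ d <= e).
  { unfold d; repeat split.
    - eapply Rle_trans; [apply Rmin_l|apply Rmin_l].
    - eapply Rle_trans; [apply Rmin_l|apply Rmin_r].
    - eapply Rle_trans; [apply Rmin_r|apply Rmin_l].
    - eapply Rle_trans; [apply Rmin_r|apply Rmin_r]. }
  exists d; split; [exact Hd|]. intros w Hw.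
  assert (Hre := re_le_Cmod (w - z)). assert (Him := im_le_Cmod (w - z)).
  destruct (w - z)%C as [h k] eqn:Ehk. 
  assert (Ew : w = (z + (h, k))%C) by (rewrite <- Ehk; ring).
  rewrite Ew, cexp_plus.
  replace (cexp z * cexp (h, k) - cexp z - cexp z * (h, k))%C
    with (cexp z * (cexp (h, k) - 1 - (h, k)))%C by ring.
  rewrite Cmod_mult, Cmod_cexp.
  simpl in Hre, Him.
  assert (Hh : Rabs h < d) by lra. assert (Hk : Rabs k < d) by lra.
  specialize (E1 h ltac:(lra)). specialize (E2 k ltac:(lra)). specialize (E3 k ltac:(lra)).
  rewrite exp_0 in E1. rewrite sin_0 in E2. rewrite cos_0 in E3.
  set (m := Cmod (h, k)) in *.
  assert (Hm : Cmod (cexp (h, k) - 1 - (h, k))%C <= 10 * e * m).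
  { eapply Rle_trans; [apply Cmod_le_abs|].
    unfold cexp, Re, Im; simpl fst; simpl snd.
    set (eh := exp h - 1 - 1 * h) in *. set (sk := sin k - 0 - 1 * k) in *. set (ck := cos k - 1 - 0 * k) in *.
    assert (Q0 := Rabs_pos h). assert (Q1 := Rabs_pos k).
    assert (Hc : Rabs (cos k) <= 1) by (apply Rabs_le; assert (B := COS_bound k); lra).
    replace (exp h * cos k + - (1) + - h) with (eh * cos k + (1 + h) * ck) by (unfold eh, ck; ring).
    replace (exp h * sin k + - 0 + - k) with ((eh + h) * (sk + k) + sk) by (unfold eh, sk; ring).
    assert (A1 : Rabs (eh * cos k + (1 + h) * ck) <= e * m + 2 * (e * m)).
    { eapply Rle_trans; [apply Rabs_triang|]; rewrite !Rabs_mult.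
      assert (Rabs (1 + h) <= 2) by (eapply Rle_trans; [apply Rabs_triang|]; rewrite Rabs_R1; lra).
      assert (0 <= Rabs eh) by apply Rabs_pos. assert (0 <= Rabs ck) by apply Rabs_pos.
      assert (0 <= Rabs (cos k)) by apply Rabs_pos.
      apply Rplus_le_compat; [nra|apply Rmult_le_compat; try nra; apply Rabs_pos]. }
    assert (A2 : Rabs ((eh + h) * (sk + k) + sk) <= 4 * e * m + e * m).
    { eapply Rle_trans; [apply Rabs_triang|]; rewrite !Rabs_mult.
      assert (Rabs (eh + h) <= 2 * e) by (eapply Rle_trans; [apply Rabs_triang|]; nra).
      assert (Rabs (sk + k) <= 2 * m) by (eapply Rle_trans; [apply Rabs_triang|]; nra).
      assert (0 <= Rabs (eh + h)) by apply Rabs_pos. assert (0 <= Rabs (sk + k)) by apply Rabs_pos.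
      apply Rplus_le_compat; nra. }
    assert (0 <= e * m) by (apply Rmult_le_pos; [lra|apply Cmod_ge_0]). lra. }
  assert (H0 : 0 <= m) by apply Cmod_ge_0.
  apply (Rmult_le_compat_l (exp (Re z))) in Hm; [|lra].
  apply (Rmult_le_compat_r m) in He2; [|lra]. lra.
Qed.

Definition cis (r t : R) : C := (r * cos t, r * sin t).

Lemma Cmod_cis r t : 0 <= r -> Cmod (cis r t) = r.
Proof.
  intros Hr; unfold cis, Cmod; simpl.
  transitivity (sqrt (r ^ 2)); [f_equal|now apply sqrt_pow2].
  assert (H := sin2_cos2 t); unfold Rsqr in H. nra.
Qed.

Lemma cis_cexp r t : 0 < r -> cis r t = cexp (ln r, t).
Proof. intros Hr; unfold cis, cexp, Re, Im; simpl; now rewrite exp_ln. Qed.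

(** * The mean value property for maps that are continuous at 0 and differentiable in the punctured
    disc *)

Section MeanValue.

Variable g : C -> C.
Hypothesis Hg0 : forall eps, 0 < eps -> exists del, 0 < del /\ forall z, Cmod z < del -> Cmod (g z - g 0)%C < eps.
Hypothesis Hg : forall z, 0 < Cmod z < 1 -> exists l, cdiff g z l.

Lemma circle_continuous r t : 0 < r < 1 -> continuous (fun t => Re (g (cis r t))) t.
Proof.
  intros Hr.
  assert (H : exists l, cdiff (fun z => g (cexp z)) (ln r, t) l).
  { destruct (Hg (cexp (ln r, t))) as [l Hl].
    - rewrite <- cis_cexp, Cmod_cis; lra.
    - eexists; exact (cdiff_comp _ _ _ _ _ (cdiff_cexp _) Hl). }
  destruct H as [l Hl]. assert (H := cdiff_cont _ _ _ Hl).
  apply filterlim_locally; intros [e He]; destruct (H e He) as [d [Hd H']].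
  exists (mkposreal d Hd); intros s Hs.
  apply (Rle_lt_trans _ (Cmod (g (cexp (ln r, s)) - g (cexp (ln r, t)))%C)).
  - rewrite !cis_cexp by lra. exact (re_le_Cmod (g (cexp (ln r, s)) - g (cexp (ln r, t)))%C).
  - apply H'. eapply Rle_lt_trans; [apply (Cmod_le_abs (ln r - ln r) (s - t))|].
    rewrite Rminus_diag, Rabs_R0, Rplus_0_l. exact Hs.
Qed.

(** The integral over a circle is independent of the radius, and for small radii continuity at 0
    brings it arbitrarily close to 2 PI * Re (g 0). *)
Lemma mean_value r : 0 < r < 1 -> RInt (fun t => Re (g (cis r t))) 0 (2 * PI) = 2 * PI * Re (g 0).
Proof.
  intros Hr. assert (HPI := PI_RGT_0).
  destruct (Req_dec (RInt (fun t => Re (g (cis r t))) 0 (2 * PI)) (2 * PI * Re (g 0))) as [E|E]; [exact E|exfalso].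
  set (D := Rabs (RInt (fun t => Re (g (cis r t))) 0 (2 * PI) - 2 * PI * Re (g 0))).
  assert (HD : 0 < D) by (apply Rabs_pos_lt; lra).
  set (eps := D / (4 * PI)).
  assert (Heps : 0 < eps) by (apply Rdiv_lt_0_compat; lra).
  destruct (Hg0 eps Heps) as [d [Hd Hd']].
  set (r' := Rmin r (d / 2)).
  assert (Hr' : 0 < r') by (apply Rmin_pos; lra).
  assert (Hr'r : r' <= r) by apply Rmin_l.
  assert (Hr'd : r' < d) by (assert (r' <= d / 2) by apply Rmin_r; lra).
  assert (Hc : RInt (fun t => Re (g (cis r t))) 0 (2 * PI) = RInt (fun t => Re (g (cis r' t))) 0 (2 * PI)).
  { rewrite (RInt_ext (fun t => Re (g (cis r t))) (fun t => Re (g (cexp (ln r, t))))) by (intros; rewrite cis_cexp; trivial; lra).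
    rewrite (RInt_ext (fun t => Re (g (cis r' t))) (fun t => Re (g (cexp (ln r', t))))) by (intros; rewrite cis_cexp; trivial; lra).
    apply (RInt_Re_period_const (fun z => g (cexp z))).
    - intros z Hz. destruct (Hg (cexp z)) as [l Hl].
      + rewrite Cmod_cexp; split; [apply exp_pos|]. rewrite <- exp_0. now apply exp_increasing.
      + eexists; exact (cdiff_comp _ _ _ _ _ (cdiff_cexp _) Hl).
    - lra.
    - intros x; unfold cexp, Re, Im; simpl.
      now rewrite cos_2PI, cos_0, sin_2PI, sin_0.
    - apply ln_le; lra.
    - rewrite <- ln_1; apply ln_increasing; lra. }
  assert (HI : ex_RInt (fun t => Re (g (cis r' t))) 0 (2 * PI)).
  { apply (ex_RInt_continuous (V := R_CompleteNormedModule)); intros; apply circle_continuous; lra. }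
  assert (HB : Rabs (RInt (fun t => Re (g (cis r' t)) - Re (g 0)) 0 (2 * PI)) <= (2 * PI - 0) * eps).
  { apply abs_RInt_le_const; [lra| |].
    - apply (ex_RInt_minus (V := R_NormedModule)); [exact HI|apply ex_RInt_const].
    - intros t _. eapply Rle_trans; [exact (re_le_Cmod (g (cis r' t) - g 0)%C)|].
      apply Rlt_le, Hd'. rewrite Cmod_cis; lra. }
  assert (HE : RInt (fun t => Re (g (cis r' t)) - Re (g 0)) 0 (2 * PI) =
    RInt (fun t => Re (g (cis r' t))) 0 (2 * PI) - 2 * PI * Re (g 0)).
  { transitivity (RInt (fun t => Re (g (cis r' t))) 0 (2 * PI) - RInt (fun _ => Re (g 0)) 0 (2 * PI)).
    - apply (RInt_minus (V := R_CompleteNormedModule)); [exact HI|apply ex_RInt_const].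
    - rewrite RInt_const. unfold scal; simpl; unfold mult; simpl. ring. }
  rewrite HE, <- Hc in HB. fold D in HB.
  assert (D = eps * (4 * PI)) by (unfold eps; field; lra).
  nra.
Qed.

Lemma mean_value_upper_bound M r : 0 < r < 1 -> (forall t, Re (g (cis r t)) <= M) -> Re (g 0) <= M.
Proof.
  intros Hr HM. assert (HPI := PI_RGT_0).
  assert (HI : ex_RInt (fun t => Re (g (cis r t))) 0 (2 * PI)).
  { apply (ex_RInt_continuous (V := R_CompleteNormedModule)); intros; now apply circle_continuous. }
  assert (H : RInt (fun t => Re (g (cis r t))) 0 (2 * PI) <= RInt (fun _ => M) 0 (2 * PI)).
  { apply RInt_le; [lra|exact HI|apply ex_RInt_const|]. intros; apply HM. }
  rewrite mean_value, RInt_const in H by trivial.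
  unfold scal in H; simpl in H; unfold mult in H; simpl in H. nra.
Qed.

(* The integrand M - Re g is continuous, nonnegative and has integral 0. *)
Lemma mean_value_extremal M r : 0 < r < 1 -> (forall t, Re (g (cis r t)) <= M) -> Re (g 0) = M ->
  forall t, 0 < t < 2 * PI -> Re (g (cis r t)) = M.
Proof.
  intros Hr HM H0 t Ht. assert (HPI := PI_RGT_0).
  destruct (Rle_lt_or_eq_dec _ _ (HM t)) as [L|L]; [exfalso|exact L].
  assert (Hct := circle_continuous r t Hr).
  assert (HL : 0 < (M - Re (g (cis r t))) / 2) by lra.
  destruct (proj1 (filterlim_locally _ _) Hct (mkposreal _ HL)) as [[d Hd] Hd'].
  set (e := Rmin (d / 2) (Rmin (t / 2) ((2 * PI - t) / 2))).
  assert (He : 0 < e) by (unfold e; repeat apply Rmin_pos; lra).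
  assert (He1 : e <= d / 2) by apply Rmin_l.
  assert (He2 : e <= t / 2) by (eapply Rle_trans; [apply Rmin_r|apply Rmin_l]).
  assert (He3 : e <= (2 * PI - t) / 2) by (eapply Rle_trans; [apply Rmin_r|apply Rmin_r]).
  assert (HI : forall a b, ex_RInt (fun t => Re (g (cis r t))) a b).
  { intros a b; apply (ex_RInt_continuous (V := R_CompleteNormedModule)); intros; now apply circle_continuous. }
  assert (Hab : forall a b, a <= b -> RInt (fun t => Re (g (cis r t))) a b <= (b - a) * M).
  { intros a b L'. transitivity (RInt (fun _ => M) a b).
    - apply RInt_le; [lra|apply HI|apply ex_RInt_const|]. intros; apply HM.
    - rewrite RInt_const; unfold scal; simpl; unfold mult; simpl; lra. }
  (* Around t the integrand stays below M by at least half of the gap at t, so the total integral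
     falls short of 2 PI * M. *)
  assert (Hmid : RInt (fun t => Re (g (cis r t))) (t - e) (t + e) <= (2 * e) * (M - (M - Re (g (cis r t))) / 2)).
  { transitivity (RInt (fun _ => M - (M - Re (g (cis r t))) / 2) (t - e) (t + e)).
    - apply RInt_le; [lra|apply HI|apply ex_RInt_const|]. intros s Hs.
      assert (B : ball t d s) by (change (Rabs (s - t) < d); apply Rabs_def1; lra).
      specialize (Hd' s B). change (Rabs (Re (g (cis r s)) - Re (g (cis r t))) < (M - Re (g (cis r t))) / 2) in Hd'.
      apply Rabs_def2 in Hd'. lra.
    - rewrite RInt_const; unfold scal; simpl; unfold mult; simpl; lra. }
  assert (HMV := mean_value r Hr).
  rewrite <- (RInt_Chasles (fun t => Re (g (cis r t))) 0 (t - e) (2 * PI)) in HMV by apply HI.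
  rewrite <- (RInt_Chasles (fun t => Re (g (cis r t))) (t - e) (t + e) (2 * PI)) in HMV by apply HI.
  unfold plus in HMV; simpl in HMV.
  assert (K1 := Hab 0 (t - e) ltac:(lra)). assert (K2 := Hab (t + e) (2 * PI) ltac:(lra)).
  rewrite H0 in HMV. nra.
Qed.

End MeanValue.

(** * The Schwarz-Pick lemma *)

(** Unlike [Cmod], the squared modulus is a polynomial in the coordinates, accessible to [ring] and
    [nra]. *)
Definition Csq (z : C) : R := fst z * fst z + snd z * snd z.

Lemma Cmod_sq z : Cmod z * Cmod z = Csq z.
Proof.
  unfold Cmod, Csq. rewrite sqrt_sqrt; [ring|]. nra.
Qed.

Lemma Csq_ge_0 z : 0 <= Csq z.
Proof. unfold Csq; nra. Qed.

Lemma Csq_mult z w : Csq (z * w) = Csq z * Csq w.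
Proof. unfold Csq; destruct z, w; simpl; ring. Qed.

Lemma Csq_conj z : Csq (Cconj z) = Csq z.
Proof. unfold Csq; destruct z; simpl; ring. Qed.

Lemma Csq_opp z : Csq (- z) = Csq z.
Proof. unfold Csq; destruct z; simpl; ring. Qed.

Lemma Csq_pos (z : C) : z <> 0 -> 0 < Csq z.
Proof.
  intros Hz. assert (H := proj1 (Cmod_gt_0 z) Hz). rewrite <- Cmod_sq. nra.
Qed.

Lemma Csq_eq_0 (z : C) : Csq z = 0 -> z = 0.
Proof.
  intros H. destruct (Ceq_dec z 0) as [E|E]; [exact E|].
  apply Csq_pos in E; lra.
Qed.

Lemma Csq_neq_0 (z : C) : 0 < Csq z -> z <> 0.
Proof. intros H E. rewrite E in H. unfold Csq in H; simpl in H; lra. Qed.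

Lemma Csq_div (z w : C) : w <> 0 -> Csq (z / w) = Csq z / Csq w.
Proof.
  intros Hw. assert (H := Csq_pos _ Hw).
  apply (Rmult_eq_reg_r (Csq w)); [|lra].
  rewrite <- Csq_mult. replace (z / w * w)%C with z by (field; trivial). field; lra.
Qed.

Lemma Csq_Cmod z : Cmod z < 1 <-> Csq z < 1.
Proof. rewrite <- Cmod_sq. assert (H := Cmod_ge_0 z). split; intros; nra. Qed.

Lemma Cmod_le_Csq z w : Csq z <= Csq w <-> Cmod z <= Cmod w.
Proof.
  rewrite <- !Cmod_sq. assert (H := Cmod_ge_0 z). assert (H' := Cmod_ge_0 w). split; intros; nra.
Qed.

Lemma conj_mult_self z : (Cconj z * z)%C = RtoC (Csq z).
Proof. unfold Csq, RtoC; destruct z; unfold Cmult, Cconj; simpl; f_equal; ring. Qed.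

(** The automorphism of the disc that sends 0 to b and - b to 0; its inverse is [mob (- b)]. *)
Definition mob (b u : C) : C := ((u + b) / (1 + Cconj b * u))%C.

Lemma mob_den b u : Csq b < 1 -> Csq u < 1 -> (1 + Cconj b * u <> 0)%C.
Proof.
  intros Hb Hu E.
  assert (H : Csq (Cconj b * u) = 1).
  { replace (Cconj b * u)%C with (- (1))%C.
    - unfold Csq; simpl; ring.
    - replace (Cconj b * u)%C with (1 + Cconj b * u - 1)%C by ring. rewrite E; ring. }
  rewrite Csq_mult, Csq_conj in H. assert (A := Csq_ge_0 b). assert (B := Csq_ge_0 u). nra.
Qed.

Lemma one_minus_Csq_mob b u : Csq b < 1 -> Csq u < 1 ->
  1 - Csq (mob b u) = (1 - Csq b) * (1 - Csq u) / Csq (1 + Cconj b * u).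
Proof.
  intros Hb Hu. assert (H := mob_den b u Hb Hu). assert (H' := Csq_pos _ H).
  unfold mob; rewrite Csq_div by trivial.
  replace (1 - Csq (u + b) / Csq (1 + Cconj b * u))
    with ((Csq (1 + Cconj b * u) - Csq (u + b)) / Csq (1 + Cconj b * u)) by (field; lra).
  f_equal. unfold Csq; destruct b, u; simpl; ring.
Qed.

Lemma mob_disc b u : Csq b < 1 -> Csq u < 1 -> Csq (mob b u) < 1.
Proof.
  intros Hb Hu. assert (H := one_minus_Csq_mob b u Hb Hu).
  assert (0 < (1 - Csq b) * (1 - Csq u) / Csq (1 + Cconj b * u)).
  { apply Rdiv_lt_0_compat; [nra|]. now apply Csq_pos, mob_den. }
  lra.
Qed.

Lemma cdiff_mob b u : Csq b < 1 -> Csq u < 1 ->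
  cdiff (mob b) u (RtoC (1 - Csq b) / ((1 + Cconj b * u) * (1 + Cconj b * u)))%C.
Proof.
  intros Hb Hu. assert (H := mob_den b u Hb Hu).
  eapply cdiff_eq.
  - unfold mob; apply cdiff_div; [apply cdiff_plus; [apply cdiff_id|apply cdiff_const]| |exact H].
    apply cdiff_plus; [apply cdiff_const|]. apply cdiff_mult; [apply cdiff_const|apply cdiff_id].
  - cbv beta. replace (RtoC (1 - Csq b)) with (1 - Cconj b * b)%C
      by (rewrite conj_mult_self; unfold RtoC, Cminus, Cplus, Copp; simpl; f_equal; ring).
    field; exact H.
Qed.

Lemma mob_0 (b : C) : mob b 0 = b.
Proof. unfold mob. replace (1 + Cconj b * 0)%C with (RtoC 1) by ring. field. Qed.

Lemma mob_opp_self (b : C) : mob (- b) b = 0.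
Proof. unfold mob, Cdiv. ring. Qed.

Lemma mob_opp b u : Csq b < 1 -> Csq u < 1 -> mob (- b) (mob b u) = u.
Proof.
  intros Hb Hu. assert (H := mob_den b u Hb Hu).
  assert (Hbb : (1 - Cconj b * b)%C <> 0).
  { rewrite conj_mult_self. intros E; apply (f_equal fst) in E; simpl in E; lra. }
  unfold mob. rewrite Copp_conj. field. split; [exact H|].
  replace (1 + Cconj b * u + - Cconj b * (u + b))%C with (1 - Cconj b * b)%C by ring. exact Hbb.
Qed.

Lemma mob_opp' b u : Csq b < 1 -> Csq u < 1 -> mob b (mob (- b) u) = u.
Proof.
  intros Hb Hu. replace b with (- - b)%C at 1 by ring. apply mob_opp; rewrite ?Csq_opp; trivial.
Qed.

Definition maps_disc (f : C -> C) : Prop :=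
  forall z, Csq z < 1 -> Csq (f z) < 1 /\ exists l, cdiff f z l.

Lemma maps_disc_mob b : Csq b < 1 -> maps_disc (mob b).
Proof.
  intros Hb z Hz; split; [now apply mob_disc|]. eexists; now apply cdiff_mob.
Qed.

Lemma maps_disc_comp f g : maps_disc f -> maps_disc g -> maps_disc (fun z => f (g z)).
Proof.
  intros Hf Hg z Hz. destruct (Hg z Hz) as [H1 [l Hl]]. destruct (Hf _ H1) as [H2 [m Hm]].
  split; [exact H2|]. eexists; exact (cdiff_comp _ _ _ _ _ Hl Hm).
Qed.

Section Schwarz.

Variable f : C -> C.
Hypothesis Hf : maps_disc f.
Hypothesis f0 : f 0 = 0.
Variable l : C.
Hypothesis Hl : cdiff f 0 l.

(** The Schwarz quotient f z / z, completed by l at 0, times a factor k. For k = [Cconj l] the value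
    at 0 is the real number |l|^2, so that the mean value property for real parts is enough. *)
Let g (k z : C) : C := if Ceq_dec z 0 then (k * l)%C else (k * (f z / z))%C.

Lemma quotient_cont (k : C) eps : 0 < eps -> exists del, 0 < del /\ forall z, Cmod z < del -> Cmod (g k z - g k 0)%C < eps.
Proof.
  intros Heps. assert (Hk := Cmod_ge_0 k).
  assert (He : 0 < eps / (Cmod k + 1)) by (apply Rdiv_lt_0_compat; lra).
  destruct (proj1 (cdiff_eps _ _ _) Hl _ He) as [d [Hd H]].
  exists d; split; [exact Hd|]. intros z Hz.
  unfold g. destruct (Ceq_dec 0 0) as [_|N]; [|now elim N].
  destruct (Ceq_dec z 0) as [E|E].
  - replace (k * l - k * l)%C with (RtoC 0) by ring. now rewrite Cmod_0.
  - specialize (H z). rewrite f0 in H. replace (z - 0)%C with z in H by ring. specialize (H Hz).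
    replace (k * (f z / z) - k * l)%C with (k * ((f z - 0 - l * z) / z))%C by (field; trivial).
    rewrite Cmod_mult, Cmod_div by trivial.
    assert (Hz0 : 0 < Cmod z) by now apply Cmod_gt_0.
    assert (Cmod (f z - 0 - l * z)%C / Cmod z <= eps / (Cmod k + 1)).
    { apply (Rmult_le_reg_r (Cmod z)); [exact Hz0|].
      unfold Rdiv at 1; rewrite Rmult_assoc, Rinv_l by lra. lra. }
    apply (Rle_lt_trans _ (Cmod k * (eps / (Cmod k + 1)))); [now apply Rmult_le_compat_l|].
    apply (Rmult_lt_reg_r (Cmod k + 1)); [lra|].
    replace (Cmod k * (eps / (Cmod k + 1)) * (Cmod k + 1)) with (Cmod k * eps) by (field; lra). nra.
Qed.

Lemma quotient_diff (k z : C) : 0 < Cmod z < 1 -> exists m, cdiff (g k) z m.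
Proof.
  intros Hz. destruct (Hf z) as [_ [m Hm]]; [apply Csq_Cmod; lra|].
  assert (H0 : z <> 0) by (apply Cmod_gt_0; lra).
  eexists. apply (cdiff_locally (fun z => k * (f z / z))%C _ _ _ (Cmod z)); [lra| |].
  - intros w Hw. unfold g. destruct (Ceq_dec w 0) as [E|E]; [|reflexivity].
    exfalso. rewrite E in Hw. replace (0 - z)%C with (- z)%C in Hw by ring. rewrite Cmod_opp in Hw; lra.
  - apply cdiff_mult; [apply cdiff_const|]. apply cdiff_div; [exact Hm|apply cdiff_id|exact H0].
Qed.

Lemma g_0 (k : C) : g k 0 = (k * l)%C.
Proof. unfold g. destruct (Ceq_dec 0 0) as [_|N]; [reflexivity|now elim N]. Qed.

Lemma g_ne (k z : C) : z <> 0 -> g k z = (k * (f z / z))%C.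
Proof. intros H. unfold g. destruct (Ceq_dec z 0) as [E|_]; [now elim H|reflexivity]. Qed.

Lemma schwarz_derivative : Cmod l <= 1.
Proof.
  destruct (Rle_dec (Cmod l) 1) as [L|L]; [exact L|exfalso].
  assert (Hl1 : 1 < Cmod l) by lra.
  (* On the circle of radius r the mean value bound reads |l|^2 <= |l| / r, which fails for every r
     between 1 / |l| and 1. *)
  set (r := (1 + / Cmod l) / 2).
  assert (Hi : 0 < / Cmod l) by (apply Rinv_0_lt_compat; lra).
  assert (Hi1 : / Cmod l < 1) by (rewrite <- Rinv_1; apply Rinv_lt_contravar; lra).
  assert (Hr : 0 < r < 1) by (unfold r; lra).
  assert (H := mean_value_upper_bound (g (Cconj l)) (quotient_cont _) (quotient_diff _) (Cmod l / r) r Hr).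
  rewrite g_0, conj_mult_self in H.
  assert (H' : Csq l <= Cmod l / r).
  { apply H. intros t. assert (Hc := Cmod_cis r t ltac:(lra)).
    assert (Hc0 : cis r t <> 0) by (apply Cmod_gt_0; lra).
    rewrite g_ne by trivial.
    eapply Rle_trans; [apply Rle_abs|]. eapply Rle_trans; [apply re_le_Cmod|].
    rewrite Cmod_mult, Cmod_conj, Cmod_div, Hc by trivial.
    destruct (Hf (cis r t)) as [Hft _]; [apply Csq_Cmod; lra|].
    apply Csq_Cmod in Hft. unfold Rdiv. apply Rmult_le_compat_l; [lra|].
    assert (0 < / r) by (apply Rinv_0_lt_compat; lra). nra. }
  rewrite <- Cmod_sq in H'.
  assert (H2 : Cmod l * r <= 1).
  { apply (Rmult_le_reg_l (Cmod l / r)); [apply Rdiv_lt_0_compat; lra|].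
    replace (Cmod l / r * (Cmod l * r)) with (Cmod l * Cmod l) by (field; lra). lra. }
  assert (H3 : Cmod l * r = (Cmod l + 1) / 2) by (unfold r; field; lra).
  lra.
Qed.

(* g is extremal in the maximum principle at 0, so it is constant on each circle. *)
Lemma schwarz_rigid_negative r :
  (forall z, Csq z < 1 -> Cmod (f z) <= Cmod z) -> Cmod l = 1 -> 0 < r < 1 -> f (RtoC (- r)) = (l * RtoC (- r))%C.
Proof.
  intros Hle Hl1 Hr. assert (HPI := PI_RGT_0).
  (* The angle PI is interior to (0, 2 PI), where [mean_value_extremal] applies; this is why the
     negative real axis is treated first. *)
  assert (Ec : cis r PI = RtoC (- r)).
  { unfold cis, RtoC; rewrite cos_PI, sin_PI; f_equal; ring. }
  assert (Hbd : forall t, Cmod (g (Cconj l) (cis r t)) <= 1).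
  { intros t. assert (Hc := Cmod_cis r t ltac:(lra)).
    assert (Hc0 : cis r t <> 0) by (apply Cmod_gt_0; lra).
    rewrite g_ne by trivial.
    rewrite Cmod_mult, Cmod_conj, Cmod_div, Hl1, Rmult_1_l by trivial.
    apply (Rmult_le_reg_r (Cmod (cis r t))); [lra|].
    unfold Rdiv; rewrite Rmult_assoc, Rinv_l, Rmult_1_l, Rmult_1_r by lra.
    apply Hle. apply Csq_Cmod; lra. }
  assert (H := mean_value_extremal (g (Cconj l)) (quotient_cont _) (quotient_diff _) 1 r Hr).
  rewrite g_0, conj_mult_self in H.
  assert (HE : Re (g (Cconj l) (cis r PI)) = 1).
  { apply H; [|rewrite <- Cmod_sq, Hl1; simpl; ring|lra].
    intros t. eapply Rle_trans; [apply Rle_abs|]. eapply Rle_trans; [apply re_le_Cmod|apply Hbd]. }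
  assert (Hb := Hbd PI).
  assert (Hg1 : g (Cconj l) (cis r PI) = 1).
  { assert (S := Cmod_sq (g (Cconj l) (cis r PI))).
    assert (P := Cmod_ge_0 (g (Cconj l) (cis r PI))).
    destruct (g (Cconj l) (cis r PI)) as [x y]; unfold Re, Csq in *; simpl in *. subst x.
    unfold RtoC; f_equal. nra. }
  rewrite Ec in Hg1.
  assert (N : RtoC (- r) <> 0) by (intros E; apply (f_equal fst) in E; simpl in E; lra).
  rewrite g_ne in Hg1 by trivial.
  transitivity (l * (Cconj l * (f (RtoC (- r)) / RtoC (- r))) * RtoC (- r))%C; [|rewrite Hg1; ring].
  transitivity ((Cconj l * l) * f (RtoC (- r)))%C.
  - rewrite conj_mult_self, <- Cmod_sq, Hl1, Rmult_1_r. ring.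
  - field; trivial.
Qed.

End Schwarz.

(** A rotation e with z = e * (- |z|) reduces any z to a point of the negative real axis. *)
Lemma schwarz_rigid (f : C -> C) (l : C) : maps_disc f -> f 0 = 0 -> cdiff f 0 l ->
  (forall z, Csq z < 1 -> Cmod (f z) <= Cmod z) -> Cmod l = 1 ->
  forall z, Csq z < 1 -> f z = (l * z)%C.
Proof.
  intros Hf f0 Hl Hle Hl1 z Hz.
  destruct (Ceq_dec z 0) as [->|H0]; [rewrite f0; ring|].
  assert (Hz0 : 0 < Cmod z) by now apply Cmod_gt_0.
  apply Csq_Cmod in Hz.
  assert (Hzc : RtoC (Cmod z) <> 0) by (intros E; apply (f_equal fst) in E; simpl in E; lra).
  set (e := (- z / Cmod z)%C).
  assert (He : Cmod e = 1).
  { unfold e; rewrite Cmod_div, Cmod_opp, Cmod_R, Rabs_pos_eq by (trivial; lra). field; lra. }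
  assert (He' : Csq e = 1) by (rewrite <- Cmod_sq, He; ring).
  assert (Ez : z = (e * RtoC (- Cmod z))%C).
  { unfold e. replace (RtoC (- Cmod z)) with (- RtoC (Cmod z))%C by (unfold RtoC, Copp; simpl; f_equal; ring).
    field; trivial. }
  assert (Hd : cdiff (fun w => e * w)%C 0 e).
  { eapply cdiff_eq; [apply cdiff_mult; [apply cdiff_const|apply cdiff_id]|]. cbv beta; ring. }
  transitivity (l * e * RtoC (- Cmod z))%C; [|rewrite Ez at 2; ring].
  rewrite Ez at 1.
  apply (schwarz_rigid_negative (fun w => f (e * w)%C)) with (l := (l * e)%C).
  - intros w Hw. destruct (Hf (e * w)%C) as [H1 [m Hm]]; [rewrite Csq_mult, He'; lra|].
    split; [exact H1|]. eexists. apply (cdiff_comp f (fun w => e * w)%C); [|exact Hm].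
    apply cdiff_mult; [apply cdiff_const|apply cdiff_id].
  - now replace (e * 0)%C with (RtoC 0) by ring.
  - apply (cdiff_comp f (fun w => e * w)%C); [exact Hd|]. now replace (e * 0)%C with (RtoC 0) by ring.
  - intros w Hw. eapply Rle_trans; [apply Hle; rewrite Csq_mult, He'; lra|].
    rewrite Cmod_mult, He; lra.
  - rewrite Cmod_mult, Hl1, He; ring.
  - lra.
Qed.

Lemma RtoC_ne_0 x : x <> 0 -> RtoC x <> 0.
Proof. intros H E; apply (f_equal fst) in E; now simpl in E. Qed.

Lemma schwarz_normalize f a l : maps_disc f -> Csq a < 1 -> cdiff f a l ->
  let F := fun z => mob (- f a) (f (mob a z)) in
  maps_disc F /\ F 0 = 0 /\ cdiff F 0 (l * RtoC (1 - Csq a) / RtoC (1 - Csq (f a))).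
Proof.
  intros Hf Ha Hl F. destruct (Hf a Ha) as [Hfa _].
  assert (Hfa' : Csq (- f a) < 1) by now rewrite Csq_opp.
  split; [|split].
  - apply (maps_disc_comp (mob (- f a))); [now apply maps_disc_mob|].
    apply maps_disc_comp; [exact Hf|now apply maps_disc_mob].
  - unfold F. rewrite mob_0. apply mob_opp_self.
  - assert (H0 : Csq 0 < 1) by (unfold Csq; simpl; lra).
    assert (D := cdiff_mob a 0 Ha H0).
    assert (D2 : cdiff f (mob a 0) l) by now rewrite mob_0.
    assert (D3 := cdiff_comp _ _ _ _ _ D D2).
    assert (D4 := cdiff_mob (- f a) (f (mob a 0)) Hfa' ltac:(now rewrite mob_0)).
    assert (D5 := cdiff_comp _ _ _ _ _ D3 D4).
    eapply cdiff_eq; [exact D5|]. rewrite mob_0, Csq_opp, Copp_conj.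
    replace (1 + - Cconj (f a) * f a)%C with (RtoC (1 - Csq (f a))).
    + replace (1 + Cconj a * 0)%C with (RtoC 1) by ring. field. apply RtoC_ne_0; lra.
    + replace (- Cconj (f a) * f a)%C with (- (Cconj (f a) * f a))%C by ring. rewrite conj_mult_self.
      unfold RtoC, Cplus, Copp; simpl; f_equal; ring.
Qed.

Lemma Cmod_scaled l a b : Csq a < 1 -> Csq b < 1 ->
  Cmod (l * RtoC (1 - Csq a) / RtoC (1 - Csq b))%C = Cmod l * (1 - Csq a) / (1 - Csq b).
Proof.
  intros Ha Hb. rewrite Cmod_div, Cmod_mult, !Cmod_R, !Rabs_pos_eq; try lra.
  apply RtoC_ne_0; lra.
Qed.

Lemma schwarz_pick_derivative f a l : maps_disc f -> Csq a < 1 -> cdiff f a l ->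
  Cmod l * (1 - Csq a) <= 1 - Csq (f a).
Proof.
  intros Hf Ha Hl. destruct (Hf a Ha) as [Hfa _].
  destruct (schwarz_normalize f a l Hf Ha Hl) as [H1 [H2 H3]].
  assert (H := schwarz_derivative _ H1 H2 _ H3).
  rewrite Cmod_scaled in H by trivial.
  apply (Rmult_le_compat_r (1 - Csq (f a))) in H; [|lra].
  unfold Rdiv in H; rewrite Rmult_assoc, Rinv_l in H by lra. lra.
Qed.

Lemma artanh_lt x y : -1 < x -> x < y -> y < 1 -> artanh x < artanh y.
Proof.
  intros Hx Hxy Hy. unfold artanh. apply Rmult_lt_compat_l; [lra|].
  apply ln_increasing; [apply Rdiv_lt_0_compat; lra|].
  apply (Rmult_lt_reg_r ((1 - x) * (1 - y))); [nra|].
  replace ((1 + x) / (1 - x) * ((1 - x) * (1 - y))) with ((1 + x) * (1 - y)) by (field; lra).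
  replace ((1 + y) / (1 - y) * ((1 - x) * (1 - y))) with ((1 + y) * (1 - x)) by (field; lra).
  nra.
Qed.

Lemma artanh_le x y : -1 < x < 1 -> -1 < y < 1 -> x <= y <-> artanh x <= artanh y.
Proof.
  intros Hx Hy; split; intros H.
  - destruct H as [H| ->]; [|lra]. apply Rlt_le, artanh_lt; lra.
  - destruct (Rle_dec x y) as [L|L]; [exact L|]. assert (artanh y < artanh x) by (apply artanh_lt; lra). lra.
Qed.

Lemma derivable_artanh x : -1 < x < 1 -> derivable_pt_lim artanh x (/ (1 - x * x)).
Proof.
  intros Hx. apply is_derive_Reals. unfold artanh.
  auto_derive.
  - repeat split; try lra. apply Rdiv_lt_0_compat; lra.
  - field. repeat split; nra.
Qed.

Lemma cdiff_real_line f t l : cdiff f (RtoC t) l -> derivable_pt_lim (fun t => Re (f (RtoC t))) t (Re l).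
Proof.
  intros H eps Heps. destruct (proj1 (cdiff_eps _ _ _) H (eps / 2) ltac:(lra)) as [d [Hd H']].
  exists (mkposreal d Hd). intros h Hh Hhd; simpl in Hhd.
  assert (E : (RtoC (t + h) - RtoC t)%C = RtoC h) by (unfold RtoC, Cminus, Cplus, Copp; simpl; f_equal; ring).
  specialize (H' (RtoC (t + h))). rewrite E, Cmod_R in H'. specialize (H' Hhd).
  assert (H2 := Rle_trans _ _ _ (re_le_Cmod _) H').
  assert (Hp := Rabs_pos_lt _ Hh).
  apply (Rmult_lt_reg_r (Rabs h)); [exact Hp|]. rewrite <- Rabs_mult.
  replace (((Re (f (RtoC (t + h))) - Re (f (RtoC t))) / h - Re l) * h)
    with (Re (f (RtoC (t + h)) - f (RtoC t) - l * RtoC h)%C).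
  - nra.
  - unfold Re; simpl. field; trivial.
Qed.

(* The infinitesimal inequality is integrated along the radius through a. *)
Lemma schwarz_le (f : C -> C) : maps_disc f -> f 0 = 0 -> forall a, Csq a < 1 -> Cmod (f a) <= Cmod a.
Proof.
  intros Hf f0 a Ha.
  destruct (Ceq_dec (f a) 0) as [E|E]; [rewrite E, Cmod_0; apply Cmod_ge_0|].
  assert (Hfa : 0 < Cmod (f a)) by now apply Cmod_gt_0.
  assert (Hfa0 : RtoC (Cmod (f a)) <> 0) by (apply RtoC_ne_0; lra).
  (* A rotation with c * f a = |f a|, so that the real function u below runs from 0 to |f a|. *)
  set (c := (Cconj (f a) / Cmod (f a))%C).
  assert (Hc : Cmod c = 1).
  { unfold c; rewrite Cmod_div, Cmod_conj, Cmod_R, Rabs_pos_eq by (trivial; lra). field; lra. }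
  set (d z := epsilon (inhabits (RtoC 0)) (fun l => cdiff f z l)).
  assert (Hd : forall z, Csq z < 1 -> cdiff f z (d z)).
  { intros z Hz; unfold d; apply epsilon_spec; now apply Hf. }
  set (u t := Re (c * f (RtoC t * a))%C).
  set (A := Cmod a). assert (HA0 : 0 <= A) by apply Cmod_ge_0. assert (HA1 : A < 1) by now apply Csq_Cmod.
  assert (Hta : forall t, 0 <= t <= 1 -> Csq (RtoC t * a) = t * t * (A * A) /\ Csq (RtoC t * a) < 1).
  { intros t Ht. assert (E0 : Csq (RtoC t * a) = t * t * (A * A)).
    { rewrite Csq_mult. unfold A; rewrite Cmod_sq. f_equal. unfold Csq; simpl; ring. }
    split; [exact E0|]. rewrite E0. unfold A; rewrite Cmod_sq.
    assert (0 <= Csq a) by apply Csq_ge_0. assert (0 <= t * t <= 1) by nra. nra. }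
  assert (Hu : forall t, 0 <= t <= 1 -> derivable_pt_lim u t (Re (c * (d (RtoC t * a)%C * a)))).
  { intros t Ht. apply cdiff_real_line with (f := fun z => (c * f (z * a))%C).
    eapply cdiff_eq.
    - apply cdiff_mult; [apply cdiff_const|]. apply (cdiff_comp f (fun z => z * a)%C).
      + apply cdiff_mult; [apply cdiff_id|apply cdiff_const].
      + apply Hd. now apply Hta.
    - cbv beta. ring. }
  assert (Huf : forall t, u t * u t <= Csq (f (RtoC t * a)%C)).
  { intros t. assert (H : Rabs (u t) <= Cmod (c * f (RtoC t * a))%C) by apply re_le_Cmod.
    rewrite Cmod_mult, Hc, Rmult_1_l in H. rewrite <- Cmod_sq.
    assert (P := Rabs_pos (u t)).
    replace (u t * u t) with (Rabs (u t) * Rabs (u t)) by (rewrite <- Rabs_mult; apply Rabs_pos_eq, Rle_0_sqr).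
    nra. }
  assert (Hu1 : forall t, 0 <= t <= 1 -> -1 < u t < 1).
  { intros t Ht. specialize (Huf t). destruct (Hf _ (proj2 (Hta t Ht))) as [B _]. split; nra. }
  (* The first term is the hyperbolic distance from 0 to t * a; the infinitesimal inequality makes
     the derivative of the difference nonnegative, and the difference vanishes at t = 0. *)
  destruct (MVT_cor2 (fun t => artanh (t * A) - artanh (u t))
     (fun t => / (1 - (t * A) * (t * A)) * A - / (1 - u t * u t) * Re (c * (d (RtoC t * a)%C * a))) 0 1)
     as [t [Ht1 Ht2]]; [lra| |].
  { intros t Ht. apply derivable_pt_lim_minus.
    - apply (derivable_pt_lim_comp (fun t => t * A) artanh).
      + apply is_derive_Reals. auto_derive; [trivial|ring].
      + apply derivable_artanh. split; nra.
    - apply (derivable_pt_lim_comp u artanh); [now apply Hu|]. apply derivable_artanh. now apply Hu1. }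
  assert (U0 : u 0 = 0).
  { unfold u. replace (RtoC 0 * a)%C with (RtoC 0) by ring. rewrite f0. simpl; ring. }
  assert (U1 : u 1 = Cmod (f a)).
  { unfold u. replace (RtoC 1 * a)%C with a by ring.
    replace (c * f a)%C with (RtoC (Cmod (f a))); [reflexivity|].
    unfold c. transitivity ((Cconj (f a) * f a) / Cmod (f a))%C; [|field; trivial].
    rewrite conj_mult_self, <- Cmod_sq, RtoC_mult. field; trivial. }
  rewrite U0, U1, Rmult_0_l, Rmult_1_l in Ht1.
  destruct (Hta t ltac:(lra)) as [T1 T2]. destruct (Hf _ T2) as [T3 _].
  assert (SP := schwarz_pick_derivative f _ _ Hf T2 (Hd _ T2)).
  rewrite T1 in SP.
  assert (Hre : Re (c * (d (RtoC t * a)%C * a)) <= Cmod (d (RtoC t * a)%C) * A).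
  { eapply Rle_trans; [apply Rle_abs|]. eapply Rle_trans; [apply re_le_Cmod|]. rewrite !Cmod_mult, Hc. unfold A; lra. }
  set (D := Cmod (d (RtoC t * a)%C)) in *. set (ut := u t) in *. set (w := Csq (f (RtoC t * a)%C)) in *.
  assert (Huw := Huf t). fold ut w in Huw.
  assert (Hp1 : 0 < 1 - t * A * (t * A)) by nra. assert (Hp2 : 0 < 1 - ut * ut) by nra.
  assert (Hge : 0 <= / (1 - t * A * (t * A)) * A - / (1 - ut * ut) * Re (c * (d (RtoC t * a)%C * a))).
  { assert (Q : / (1 - ut * ut) * Re (c * (d (RtoC t * a)%C * a)) <= / (1 - t * A * (t * A)) * A); [|lra].
    apply (Rmult_le_reg_l ((1 - ut * ut) * (1 - t * A * (t * A)))); [nra|].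
    replace ((1 - ut * ut) * (1 - t * A * (t * A)) * (/ (1 - t * A * (t * A)) * A))
      with ((1 - ut * ut) * A) by (field; lra).
    replace ((1 - ut * ut) * (1 - t * A * (t * A)) * (/ (1 - ut * ut) * Re (c * (d (RtoC t * a)%C * a))))
      with ((1 - t * A * (t * A)) * Re (c * (d (RtoC t * a)%C * a))) by (field; lra).
    apply (Rle_trans _ ((1 - t * A * (t * A)) * (D * A))); [apply Rmult_le_compat_l; lra|].
    replace ((1 - t * A * (t * A)) * (D * A)) with (D * (1 - t * t * (A * A)) * A) by ring.
    apply Rmult_le_compat_r; [exact HA0|]. lra. }
  apply (artanh_le (Cmod (f a)) A); [rewrite <- U1; apply Hu1; lra|lra|].
  lra.
Qed.

Lemma schwarz_pick_rigid f a l : maps_disc f -> Csq a < 1 -> cdiff f a l ->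
  1 - Csq (f a) <= Cmod l * (1 - Csq a) ->
  forall z, Csq z < 1 -> f z = mob (f a) (l * RtoC (1 - Csq a) / RtoC (1 - Csq (f a)) * mob (- a) z).
Proof.
  intros Hf Ha Hl Heq z Hz. destruct (Hf a Ha) as [Hfa _].
  assert (Hle := schwarz_pick_derivative f a l Hf Ha Hl).
  destruct (schwarz_normalize f a l Hf Ha Hl) as [H1 [H2 H3]].
  assert (Hma : Csq (mob (- a) z) < 1) by (apply mob_disc; rewrite ?Csq_opp; trivial).
  assert (H := schwarz_rigid _ _ H1 H2 H3 (schwarz_le _ H1 H2)).
  rewrite Cmod_scaled in H by trivial.
  specialize (H ltac:(replace (Cmod l * (1 - Csq a)) with (1 - Csq (f a)) by lra; field; lra) _ Hma).
  cbv beta in H. rewrite mob_opp' in H by trivial.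
  rewrite <- H, mob_opp'; trivial. now apply Hf.
Qed.

(** The pseudohyperbolic distance; [datum_abs] of a discrete datum is its [artanh], which is
    increasing, so discrete data are compared through it. *)
Definition pdist (a b : C) : R := Cmod ((a - b) / (1 - Cconj b * a))%C.

Lemma pdist_mob a b : pdist a b = Cmod (mob (- b) a).
Proof. unfold pdist, mob. f_equal. rewrite Copp_conj. f_equal. ring. Qed.

Lemma schwarz_pick f a b : maps_disc f -> Csq a < 1 -> Csq b < 1 -> pdist (f a) (f b) <= pdist a b.
Proof.
  intros Hf Ha Hb. destruct (Hf b Hb) as [Hfb [l Hl]].
  destruct (schwarz_normalize f b l Hf Hb Hl) as [H1 [H2 _]].
  assert (Hma : Csq (mob (- b) a) < 1) by (apply mob_disc; rewrite ?Csq_opp; trivial).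
  assert (H := schwarz_le _ H1 H2 _ Hma). cbv beta in H.
  rewrite mob_opp' in H by trivial. now rewrite !pdist_mob.
Qed.

(** * Holomorphic maps into the disc and universal families *)

Lemma minus_plus_cancel {G : AbelianGroup} (s w : G) : minus (plus s w) s = w.
Proof. unfold minus. rewrite (plus_comm s w), <- plus_assoc. transitivity (plus w zero); [apply (f_equal (plus w)), (plus_opp_r s)|apply plus_zero_r]. Qed.

Lemma Cminus_plus_cancel (x y : C) : (x - y + y)%C = x.
Proof. ring. Qed.

Lemma Cminus_0_r (x : C) : (x - 0)%C = x.
Proof. ring. Qed.

Section Domain.

Context {V : CSpace} {U : V -> Prop}.
Implicit Types (F G : pts U -> pts unit_disc) (d : datum U).

Lemma ext_in F (s : V) (h : U s) : ext F s = proj1_sig (F (exist _ s h)).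
Proof.
  unfold ext. destruct (excluded_middle_informative (U s)) as [h'|n]; [|now elim n].
  now rewrite (proof_irrelevance _ h' h).
Qed.

Lemma ext_pt F (s : pts U) : ext F (proj1_sig s) = proj1_sig (F s).
Proof. destruct s as [s h]; apply ext_in. Qed.

Lemma ext_disc F s : U s -> Csq (ext F s) < 1.
Proof. intros h; rewrite (ext_in F s h). apply Csq_Cmod, proj2_sig. Qed.

Lemma map_eq F G : (forall s, U s -> ext F s = ext G s) -> F = G.
Proof.
  intros H; apply functional_extensionality; intros x.
  assert (E := H _ (proj2_sig x)). rewrite !ext_pt in E.
  destruct (F x) as [a ha], (G x) as [b hb]; simpl in E. subst b.
  f_equal; apply proof_irrelevance.
Qed.

(** Restricting the differential provided by [holomorphic] to the line z |-> s + z v identifies it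
    with the limit [dir_deriv], which thereby becomes linear in v. *)
Lemma vdiff_ext_dir F s : holomorphic F -> U s -> vdiff (ext F) s (dir_deriv F s).
Proof.
  intros HF Hs. destruct (HF s Hs) as [l Hl].
  apply (vdiff_ext _ _ l); [exact Hl|]. intros v; symmetry.
  unfold dir_deriv. apply is_C_lim_unique. apply filterlim_locally. intros eps.
  destruct (proj1 (filterdiff_eps _ _ _) Hl) as [Hlin H].
  assert (Hn := norm_ge_0 v).
  destruct (H (eps / (norm v + 1))) as [d [Hd H']]; [apply Rdiv_lt_0_compat; [apply cond_pos|lra]|].
  (* The factor 2 absorbs the norm factor sqrt 2 of the complex plane, and the + 1 covers v = 0. *)
  assert (Hd2 : 0 < d / (2 * (norm v + 1))) by (apply Rdiv_lt_0_compat; lra).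
  exists (mkposreal _ Hd2). intros z; change C in (type of z); intros Hz Hz0.
  apply (norm_compat1 (V := C_NormedModule)).
  apply (norm_compat2 (V := C_NormedModule)) in Hz.
  change (Cmod (z - 0)%C < sqrt 2 * (d / (2 * (norm v + 1)))) in Hz.
  replace (z - 0)%C with z in Hz by ring.
  assert (Hsq : sqrt 2 <= 2).
  { rewrite <- (sqrt_pow2 2) at 2 by lra. apply sqrt_le_1_alt; lra. }
  assert (Hz1 : Cmod z < d / (norm v + 1)).
  { eapply Rlt_le_trans; [exact Hz|].
    replace (d / (norm v + 1)) with (2 * (d / (2 * (norm v + 1)))) by (field; lra).
    apply Rmult_le_compat_r; lra. }
  assert (Hzp : 0 < Cmod z) by now apply Cmod_gt_0.
  assert (E : minus (plus s (scal z v)) s = scal z v).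
  { exact (minus_plus_cancel s (scal z v)). }
  assert (Hsc : norm (scal z v) <= Cmod z * norm v) by exact (norm_scal z v).
  specialize (H' (plus s (scal z v))). rewrite E in H'.
  assert (Hlt : norm (scal z v) < d).
  { eapply Rle_lt_trans; [exact Hsc|].
    apply (Rmult_lt_compat_r (norm v + 1)) in Hz1; [|lra].
    replace (d / (norm v + 1) * (norm v + 1)) with d in Hz1 by (field; lra). nra. }
  specialize (H' Hlt).
  rewrite (linear_scal l Hlin) in H'.
  change (Cmod (ext F (plus s (scal z v)) - ext F s - z * l v)%C <= eps / (norm v + 1) * norm (scal z v)) in H'.
  change (Cmod ((ext F (plus s (scal z v)) - ext F s) / z - l v)%C < eps).
  replace ((ext F (plus s (scal z v)) - ext F s) / z - l v)%C
    with ((ext F (plus s (scal z v)) - ext F s - z * l v) / z)%C by (field; trivial).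
  rewrite Cmod_div by trivial.
  apply (Rmult_lt_reg_r (Cmod z)); [exact Hzp|].
  unfold Rdiv at 1; rewrite Rmult_assoc, Rinv_l, Rmult_1_r by lra.
  assert (He : 0 < eps / (norm v + 1)) by (apply Rdiv_lt_0_compat; [apply cond_pos|lra]).
  eapply Rle_lt_trans; [exact H'|].
  apply (Rle_lt_trans _ (eps / (norm v + 1) * (Cmod z * norm v))); [now apply Rmult_le_compat_l; [lra|]|].
  replace (eps * Cmod z) with (eps / (norm v + 1) * (Cmod z * (norm v + 1))) by (field; lra).
  apply Rmult_lt_compat_l; [exact He|]. nra.
Qed.

Lemma dir_deriv_linear F s : holomorphic F -> U s ->
  (forall v w, dir_deriv F s (plus v w) = (dir_deriv F s v + dir_deriv F s w)%C) /\
  (forall k v, dir_deriv F s (scal k v) = (k * dir_deriv F s v)%C).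
Proof.
  intros HF Hs. destruct (vdiff_ext_dir F s HF Hs) as [Hl _]. split.
  - intros v w; apply (linear_plus _ Hl).
  - intros k v; apply (linear_scal _ Hl).
Qed.

(** Along the line z |-> s + z v both differentials give the derivative of a function of one
    variable, which is unique. *)
Lemma vdiff_unique (f : V -> C) s l l' : vdiff f s l -> vdiff f s l' -> forall v, l v = l' v.
Proof.
  intros H H' v.
  assert (Hlin : forall m : V -> C, vdiff f s m -> cdiff (fun z : C => f (plus s (scal z v))) 0 (m v)).
  { intros m Hm. assert (Hml : is_linear (V := C_NormedModule) m) by apply Hm.
    apply (vdiff_ext (V := C_NormedModule) _ _ (fun h : C => m (scal h v))).
    - apply (filterdiff_comp' (K := C_AbsRing) (U := C_NormedModule) (V := V) (W := C_NormedModule)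
        (fun z : C => plus s (scal z v)) f (RtoC 0) (fun h => scal h v) m).
      + apply filterdiff_eps; split.
        * split.
          -- intros x y; apply (scal_distr_r (K := C_AbsRing) x y v).
          -- intros x y; symmetry; apply (scal_assoc (K := C_AbsRing) x y v).
          -- exists (norm v + 1); assert (Hn := norm_ge_0 v); split; [lra|]. intros x.
             eapply Rle_trans; [apply (norm_scal x v)|]. change (Cmod x * norm v <= (norm v + 1) * Cmod x).
             assert (P := Cmod_ge_0 x). nra.
        * intros eps Heps; exists 1; split; [lra|]. intros x _.
          replace (minus (minus (plus s (scal x v)) (plus s (scal (RtoC 0) v))) (scal (minus x (RtoC 0)) v))
            with (zero : V).
          -- rewrite norm_zero. apply Rmult_le_pos; [lra|apply norm_ge_0].
          -- replace (scal (RtoC 0) v) with (zero : V) by (symmetry; exact (scal_zero_l v)).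
             replace (minus x (RtoC 0) : C_Ring) with x by exact (eq_sym (Cminus_0_r x)).
             rewrite plus_zero_r. symmetry.
             etransitivity; [exact (f_equal2 minus (minus_plus_cancel s (scal x v)) eq_refl)|exact (plus_opp_r (scal x v))].
      + replace (plus s (scal (RtoC 0) v)) with s; [exact Hm|].
        replace (scal (RtoC 0) v) with (zero : V) by (symmetry; exact (scal_zero_l v)). symmetry; apply plus_zero_r.
    - intros h. rewrite (linear_scal m Hml). apply Cmult_comm. }
  exact (cdiff_unique _ _ _ _ (Hlin l H) (Hlin l' H')).
Qed.

(** The chain rule along an analytic disc k; through it every competitor F is reduced to a self-map
    of the disc, to which Schwarz-Pick applies. *)
Lemma cdiff_ext_curve F (k : C -> V) (z : C) (v : V) : holomorphic F -> U (k z) ->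
  filterdiff (K := C_AbsRing) (U := C_NormedModule) (V := V) k (locally z) (fun h : C => scal h v) ->
  cdiff (fun w => ext F (k w)) z (dir_deriv F (k z) v).
Proof.
  intros HF Hs Hk.
  apply (vdiff_ext (V := C_NormedModule) _ _ (fun h : C => dir_deriv F (k z) (scal h v))).
  - exact (filterdiff_comp' (K := C_AbsRing) (U := C_NormedModule) (V := V) (W := C_NormedModule)
      k (ext F) z (fun h => scal h v) (dir_deriv F (k z)) Hk (vdiff_ext_dir F _ HF Hs)).
  - intros h. rewrite (proj2 (dir_deriv_linear F _ HF Hs)). apply Cmult_comm.
Qed.

Lemma solves_car_iff F d : solves_car F d <->
  holomorphic F /\ forall G, holomorphic G -> datum_abs (push G d) <= datum_abs (push F d).
Proof.
  unfold solves_car, car.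
  set (E := fun r => exists F, holomorphic F /\ r = datum_abs (push F d)).
  assert (H := Lub_Rbar_correct E).
  split; intros [HF HE]; split; trivial.
  - intros G HG. destruct H as [H _]. rewrite <- HE in H.
    exact (H _ (ex_intro _ G (conj HG eq_refl))).
  - symmetry; apply is_lub_Rbar_unique; split.
    + intros r [G [HG ->]]. now apply HE.
    + intros b Hb. apply Hb. now exists F.
Qed.

End Domain.

Lemma filterdiff_pair (k1 k2 : C -> C) (z l1 l2 : C) : cdiff k1 z l1 -> cdiff k2 z l2 ->
  filterdiff (K := C_AbsRing) (U := C_NormedModule) (V := C2) (fun w => (k1 w, k2 w)) (locally z)
    (fun h : C => scal (V := C2) h ((l1, l2) : C2)).
Proof.
  intros H1 H2.
  apply (filterdiff_ext_lin (K := C_AbsRing) (U := C_NormedModule) (V := C2) _ (fun h : C => ((l1 * h)%C, (l2 * h)%C))).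
  - apply (filterdiff_comp'_2 (K := C_AbsRing) (T := C_NormedModule) (U := C_NormedModule) (V := C_NormedModule)
      (W := C2) k1 k2 (fun a b => (a, b)) z _ _ (fun a b => (a, b)) H1 H2).
    apply (filterdiff_ext (K := C_AbsRing) (U := C2) (V := C2) (fun t => t)); [now intros [a b]|].
    apply (filterdiff_ext_lin (K := C_AbsRing) (U := C2) (V := C2) _ (fun t => t)); [|now intros [a b]].
    apply filterdiff_id.
  - intros h. change (((l1 * h)%C, (l2 * h)%C) = ((h * l1)%C, (h * l2)%C)). f_equal; apply Cmult_comm.
Qed.

Lemma filterdiff_cdiff (k : C -> C) (z l : C) : cdiff k z l ->
  filterdiff (K := C_AbsRing) (U := C_NormedModule) (V := C_NormedModule) k (locally z)
    (fun h : C => scal (V := C_NormedModule) h (l : C_NormedModule)).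
Proof.
  intros H. apply (filterdiff_ext_lin (K := C_AbsRing) (U := C_NormedModule) (V := C_NormedModule) _ _ _ H).
  intros h. apply Cmult_comm.
Qed.

Lemma maps_disc_ext (m : pts unit_disc -> pts unit_disc) : holomorphic m -> maps_disc (ext m).
Proof.
  intros Hm z Hz. assert (Hz' : unit_disc z) by now apply Csq_Cmod.
  split; [now apply ext_disc|]. exists (dir_deriv m z (RtoC 1 : C_NormedModule)).
  apply (cdiff_ext_curve m (fun w => w) z (RtoC 1)); trivial.
  apply filterdiff_cdiff, cdiff_id.
Qed.

Lemma norm_locally {V : CSpace} (s : V) (P : V -> Prop) :
  (exists del, 0 < del /\ forall x, norm (minus x s) < del -> P x) -> locally s P.
Proof.
  intros [d [Hd H]].
  assert (Hn : 0 < norm_factor (V := V)) by apply norm_factor_gt_0.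
  exists (mkposreal _ (Rdiv_lt_0_compat _ _ Hd Hn)).
  intros y Hy; apply H.
  apply norm_compat2 in Hy; simpl in Hy.
  replace (norm_factor * (d / norm_factor)) with d in Hy by (field; lra).
  exact Hy.
Qed.

Lemma open_unit_disc (s : C_NormedModule) : unit_disc s -> locally s unit_disc.
Proof.
  intros Hs. apply norm_locally. unfold unit_disc in *. exists (1 - Cmod s); split; [lra|].
  intros x; change C in (type of x); change C in (type of s); intros Hx.
  change (Cmod (x - s)%C < 1 - Cmod s) in Hx.
  assert (T := Cmod_triangle (x - s) s). replace (x - s + s)%C with x in T by ring. lra.
Qed.

Lemma holomorphic_formula {V : CSpace} {U : V -> Prop} (F : pts U -> pts unit_disc) (f : V -> C) :
  (forall s, U s -> locally s U) -> (forall s, U s -> ext F s = f s) ->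
  (forall s, U s -> exists l, vdiff f s l) -> holomorphic F.
Proof.
  intros HU HF Hf s Hs. destruct (Hf s Hs) as [l Hl]. exists l.
  apply (vdiff_locally f); [|exact Hl].
  apply (filter_imp U); [|now apply HU]. intros x Hx; symmetry; now apply HF.
Qed.

Lemma dir_deriv_formula {V : CSpace} {U : V -> Prop} (F : pts U -> pts unit_disc) (f : V -> C) s l :
  (forall s, U s -> locally s U) -> (forall s, U s -> ext F s = f s) -> holomorphic F ->
  U s -> vdiff f s l -> forall v, dir_deriv F s v = l v.
Proof.
  intros HU HF HF' Hs Hl. apply (vdiff_unique (ext F) s).
  - now apply vdiff_ext_dir.
  - apply (vdiff_locally f); [|exact Hl].
    apply (filter_imp U); [|now apply HU]. intros x Hx; symmetry; now apply HF.
Qed.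

Lemma ext_comp {V : CSpace} {U : V -> Prop} (m : pts unit_disc -> pts unit_disc) (F : pts U -> pts unit_disc) s :
  U s -> ext (fun x => m (F x)) s = ext m (ext F s).
Proof. intros h. rewrite !(ext_in _ s h). symmetry; apply ext_pt. Qed.

Definition to_disc {A : Type} (f : A -> C) (H : forall x, Csq (f x) < 1) : A -> pts unit_disc :=
  fun x => exist unit_disc (f x) (proj2 (Csq_Cmod _) (H x)).

Lemma disc_automorphism_of (f g : C -> C) : maps_disc f -> maps_disc g ->
  (forall z, Csq z < 1 -> g (f z) = z) -> (forall z, Csq z < 1 -> f (g z) = z) ->
  exists m, disc_automorphism m /\ forall z, Csq z < 1 -> ext m z = f z.
Proof.
  intros Hf Hg Hgf Hfg.
  assert (P : forall x : pts unit_disc, Csq (proj1_sig x) < 1) by (intros x; apply Csq_Cmod, proj2_sig).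
  set (mf := to_disc (fun x : pts unit_disc => f (proj1_sig x)) (fun x => proj1 (Hf _ (P x)))).
  set (mg := to_disc (fun x : pts unit_disc => g (proj1_sig x)) (fun x => proj1 (Hg _ (P x)))).
  assert (Ef : forall z, unit_disc z -> ext mf z = f z) by (intros z h; now rewrite (ext_in _ z h)).
  assert (Eg : forall z, unit_disc z -> ext mg z = g z) by (intros z h; now rewrite (ext_in _ z h)).
  assert (Hol : forall (m : pts unit_disc -> pts unit_disc) k, maps_disc k -> (forall z, unit_disc z -> ext m z = k z) -> holomorphic m).
  { intros m k Hk Hm. apply (holomorphic_formula m k); [apply open_unit_disc|exact Hm|].
    intros s Hs. destruct (Hk s) as [_ [l Hl]]; [now apply Csq_Cmod|]. now exists (fun h => l * h)%C. }
  exists mf; split; [split; [now apply (Hol mf f)|]|].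
  - exists mg; split; [now apply (Hol mg g)|].
    split; intros x; assert (Hx := P x); destruct x as [z hz]; unfold mf, mg, to_disc; simpl in *.
    + assert (E := Hgf z Hx). apply eq_sig_hprop; [intros; apply proof_irrelevance|exact E].
    + assert (E := Hfg z Hx). apply eq_sig_hprop; [intros; apply proof_irrelevance|exact E].
  - intros z Hz. apply Ef. now apply Csq_Cmod.
Qed.

Lemma disc_automorphism_mob b c a : Csq a < 1 -> Csq b < 1 -> Csq c = 1 ->
  exists m, disc_automorphism m /\ forall z, Csq z < 1 -> ext m z = mob b (c * mob a z)%C.
Proof.
  intros Ha Hb Hc.
  assert (Hc0 : c <> 0) by (apply Csq_neq_0; lra).
  assert (Hci : Csq (/ c) = 1).
  { assert (H := Csq_div 1 c Hc0). replace (1 / c)%C with (/ c)%C in H by (field; trivial).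
    rewrite H, Hc. unfold Csq; simpl; field. }
  assert (Hrot : forall c, Csq c = 1 -> maps_disc (fun z => c * z)%C).
  { intros k Hk z Hz. split; [rewrite Csq_mult, Hk; lra|].
    eexists; apply cdiff_mult; [apply cdiff_const|apply cdiff_id]. }
  assert (Ha' : Csq (- a) < 1) by now rewrite Csq_opp.
  assert (Hb' : Csq (- b) < 1) by now rewrite Csq_opp.
  apply (disc_automorphism_of _ (fun z => mob (- a) (/ c * mob (- b) z)%C)).
  - apply (maps_disc_comp (mob b)); [now apply maps_disc_mob|].
    apply (maps_disc_comp (fun z => c * z)%C); [now apply Hrot|now apply maps_disc_mob].
  - apply (maps_disc_comp (mob (- a))); [now apply maps_disc_mob|].
    apply (maps_disc_comp (fun z => / c * z)%C); [now apply Hrot|now apply maps_disc_mob].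
  - intros z Hz. assert (H := mob_disc a z Ha Hz).
    rewrite mob_opp; [|exact Hb|rewrite Csq_mult, Hc; lra].
    replace (/ c * (c * mob a z))%C with (mob a z) by (field; trivial). now apply mob_opp.
  - intros z Hz. assert (H := mob_disc (- b) z Hb' Hz).
    rewrite mob_opp'; [|exact Ha|rewrite Csq_mult, Hci; lra].
    replace (c * (/ c * mob (- b) z))%C with (mob (- b) z) by (field; trivial). now apply mob_opp'.
Qed.

Lemma holomorphic_comp {V : CSpace} {U : V -> Prop} (m : pts unit_disc -> pts unit_disc) (F : pts U -> pts unit_disc) :
  (forall s, U s -> locally s U) -> holomorphic m -> holomorphic F -> holomorphic (fun x => m (F x)).
Proof.
  intros HU Hm HF. apply (holomorphic_formula _ (fun s => ext m (ext F s))); [exact HU|intros; now apply ext_comp|].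
  intros s Hs. destruct (maps_disc_ext m Hm _ (ext_disc F s Hs)) as [_ [l Hl]].
  eexists. exact (vdiff_comp _ _ _ _ _ (vdiff_ext_dir F s HF Hs) Hl).
Qed.

Lemma pdist_lt_1 a b : Csq a < 1 -> Csq b < 1 -> 0 <= pdist a b < 1.
Proof.
  intros Ha Hb; split; [apply Cmod_ge_0|]. rewrite pdist_mob.
  apply Csq_Cmod, mob_disc; rewrite ?Csq_opp; trivial.
Qed.

Lemma push_le_iff {V : CSpace} {U : V -> Prop} (F G : pts U -> pts unit_disc) (d : datum U) :
  datum_abs (push F d) <= datum_abs (push G d) <->
  match d with
  | Discrete s1 s2 => pdist (ext F (proj1_sig s1)) (ext F (proj1_sig s2)) <= pdist (ext G (proj1_sig s1)) (ext G (proj1_sig s2))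
  | Infinitesimal s v =>
     Cmod (dir_deriv F (proj1_sig s) v) / (1 - Csq (ext F (proj1_sig s))) <=
     Cmod (dir_deriv G (proj1_sig s) v) / (1 - Csq (ext G (proj1_sig s)))
  end.
Proof.
  destruct d as [s1 s2|s v]; simpl.
  - rewrite !ext_pt.
    assert (H : forall a b : pts unit_disc, -1 < pdist (proj1_sig a) (proj1_sig b) < 1).
    { intros a b. assert (H := pdist_lt_1 (proj1_sig a) (proj1_sig b)).
      specialize (H (proj1 (Csq_Cmod _) (proj2_sig a)) (proj1 (Csq_Cmod _) (proj2_sig b))). lra. }
    symmetry; apply artanh_le; apply H.
  - rewrite !ext_pt, !Rmult_1_r, !Cmod_sq. reflexivity.
Qed.

Lemma push_comp_le {V : CSpace} {U : V -> Prop} (m : pts unit_disc -> pts unit_disc) (F : pts U -> pts unit_disc) (d : datum U) :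
  (forall s, U s -> locally s U) -> holomorphic m -> holomorphic F ->
  datum_abs (push (fun x => m (F x)) d) <= datum_abs (push F d).
Proof.
  intros HU Hm HF. apply push_le_iff. assert (Hmd := maps_disc_ext m Hm).
  destruct d as [s1 s2|s v].
  - rewrite (ext_comp m F _ (proj2_sig s1)), (ext_comp m F _ (proj2_sig s2)). apply schwarz_pick; [exact Hmd| |]; apply ext_disc, proj2_sig.
  - assert (Hs := proj2_sig s). cbv beta in Hs. set (x := proj1_sig s) in *.
    destruct (Hmd _ (ext_disc F x Hs)) as [Hd [l Hl]].
    rewrite (dir_deriv_formula _ (fun s => ext m (ext F s)) x (fun v => l * dir_deriv F x v)%C HU).
    + rewrite ext_comp by exact Hs. rewrite Cmod_mult.
      assert (SP := schwarz_pick_derivative _ _ _ Hmd (ext_disc F x Hs) Hl).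
      assert (P := ext_disc F x Hs). assert (Q := Cmod_ge_0 (dir_deriv F x v)).
      apply (Rmult_le_reg_r ((1 - Csq (ext m (ext F x))) * (1 - Csq (ext F x)))); [nra|].
      replace (Cmod l * Cmod (dir_deriv F x v) / (1 - Csq (ext m (ext F x))) * ((1 - Csq (ext m (ext F x))) * (1 - Csq (ext F x))))
        with (Cmod l * (1 - Csq (ext F x)) * Cmod (dir_deriv F x v)) by (field; lra).
      replace (Cmod (dir_deriv F x v) / (1 - Csq (ext F x)) * ((1 - Csq (ext m (ext F x))) * (1 - Csq (ext F x))))
        with ((1 - Csq (ext m (ext F x))) * Cmod (dir_deriv F x v)) by (field; lra).
      now apply Rmult_le_compat_r.
    + intros; now apply ext_comp.
    + now apply holomorphic_comp.
    + exact Hs.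
    + exact (vdiff_comp _ _ _ _ _ (vdiff_ext_dir F x HF Hs) Hl).
Qed.

(** Neither m nor its inverse increases the length of a datum, so m preserves it. *)
Lemma solves_car_automorphism {V : CSpace} {U : V -> Prop} m (F : pts U -> pts unit_disc) (d : datum U) :
  (forall s, U s -> locally s U) -> disc_automorphism m ->
  solves_car F d -> solves_car (fun x => m (F x)) d.
Proof.
  intros HU [Hm [m' [Hm' [E1 E2]]]]. rewrite !solves_car_iff. intros [HF H].
  assert (HmF := holomorphic_comp m F HU Hm HF).
  split; [exact HmF|]. intros G HG. eapply Rle_trans; [now apply H|].
  assert (L := push_comp_le m' _ d HU Hm' HmF). cbv beta in L.
  replace (fun x => m' (m (F x))) with F in L; [exact L|].
  apply functional_extensionality; intros; now rewrite E1.
Qed.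

Lemma disc_automorphism_comp m n : disc_automorphism m -> disc_automorphism n ->
  disc_automorphism (fun x => m (n x)).
Proof.
  intros [Hm [m' [Hm' [E1 E2]]]] [Hn [n' [Hn' [E3 E4]]]].
  split; [now apply (holomorphic_comp m n open_unit_disc)|].
  exists (fun x => n' (m' x)). split; [now apply (holomorphic_comp n' m' open_unit_disc)|].
  split; intros x; [now rewrite E1|now rewrite E4].
Qed.

(** * A criterion for the existence and uniqueness of minimal universal sets *)

Section Family.

Context {V : CSpace} {U : V -> Prop} {I : Type}.
Variables (Phi : I -> pts U -> pts unit_disc) (delta : I -> datum U).
Hypothesis HU : forall s, U s -> locally s U.
Hypothesis HPhi : forall i, holomorphic (Phi i).
Hypothesis Phi_universal : forall d : datum U, nondegenerate d -> exists i, solves_car (Phi i) d.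
Hypothesis delta_nondegenerate : forall i, nondegenerate (delta i).
Hypothesis delta_unique : forall i F, solves_car F (delta i) ->
  exists m, disc_automorphism m /\ F = (fun x => m (Phi i x)).
Hypothesis delta_separates : forall i j, solves_car (Phi j) (delta i) -> j = i.

Lemma Phi_solves_delta i : solves_car (Phi i) (delta i).
Proof.
  destruct (Phi_universal _ (delta_nondegenerate i)) as [j Hj].
  now rewrite (delta_separates i j Hj) in Hj.
Qed.

Lemma Phi_minimal : minimal_universal_set U (fun F => exists i, F = Phi i).
Proof.
  split; [split|].
  - intros F [i ->]; apply HPhi.
  - intros d Hd. destruct (Phi_universal d Hd) as [i Hi]. exists (Phi i); split; [now exists i|exact Hi].
  - intros [S' [[Hinc Hne] [_ HS']]]. apply Hne.
    apply functional_extensionality; intros F; apply propositional_extensionality; split; [apply Hinc|].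
    intros [i ->]. destruct (HS' _ (delta_nondegenerate i)) as [G [HG Hs]].
    destruct (Hinc G HG) as [j ->]. now rewrite (delta_separates i j Hs) in HG.
Qed.

(** For each i the set S must contain a solution for [delta i], that is, some m i o Phi i. These
    maps alone are already universal, so by minimality they exhaust S. *)
Lemma minimal_universal_set_shape S : minimal_universal_set U S ->
  exists m : I -> pts unit_disc -> pts unit_disc, (forall i, disc_automorphism (m i)) /\
    forall G, In _ S G <-> exists i, G = (fun x => m i (Phi i x)).
Proof.
  intros [[Hhol HS] Hmin].
  assert (H : forall i, exists m, disc_automorphism m /\ In _ S (fun x => m (Phi i x))).
  { intros i. destruct (HS _ (delta_nondegenerate i)) as [F [HF Hs]].
    destruct (delta_unique i F Hs) as [m [Hm ->]]. now exists m. }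
  set (m i := proj1_sig (constructive_indefinite_description _ (H i))).
  assert (Hm : forall i, disc_automorphism (m i) /\ In _ S (fun x => m i (Phi i x))).
  { intros i; exact (proj2_sig (constructive_indefinite_description _ (H i))). }
  exists m; split; [apply Hm|].
  set (T := fun G => exists i, G = (fun x => m i (Phi i x))).
  assert (HT : Included _ T S) by (intros G [i ->]; apply Hm).
  destruct (classic (T = S)) as [E|N]; [rewrite <- E; intros G; reflexivity|].
  exfalso; apply Hmin. exists T; split; [split; trivial|]. split.
  - intros F HF; apply Hhol; now apply HT.
  - intros d Hd. destruct (Phi_universal d Hd) as [i Hi].
    exists (fun x => m i (Phi i x)); split; [now exists i|].
    apply (solves_car_automorphism (m i)); [exact HU|apply Hm|exact Hi].
Qed.

Theorem minimal_universal_family :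
  (exists S, minimal_universal_set U S) /\
  (forall S S', minimal_universal_set U S -> minimal_universal_set U S' -> equivalent S S').
Proof.
  split; [eexists; apply Phi_minimal|].
  intros S S' HS HS'.
  destruct (minimal_universal_set_shape S HS) as [m [Hm HmS]].
  destruct (minimal_universal_set_shape S' HS') as [n [Hn HnS]].
  (* Distinct indices give distinct members of S, so the index of a member, and hence the
     automorphism attached to it, is well defined. *)
  assert (Hij : forall i j, (fun x => m i (Phi i x)) = (fun x => m j (Phi j x)) -> i = j).
  { intros i j E. symmetry. apply delta_separates.
    destruct (Hm j) as [_ [m' [Hm' [E1 E2]]]].
    assert (Em : Phi j = (fun x => m' (m i (Phi i x)))).
    { apply functional_extensionality; intros x. rewrite (f_equal (fun f => f x) E : m i (Phi i x) = m j (Phi j x)).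
      now rewrite E1. }
    rewrite Em.
    apply (solves_car_automorphism m' (fun x => m i (Phi i x))); [exact HU| |].
    - split; [exact Hm'|]. exists (m j). destruct (Hm j) as [Hj _]. now repeat split.
    - apply (solves_car_automorphism (m i)); [exact HU|apply Hm|apply Phi_solves_delta]. }
  (* The automorphism wanted for F = m i o Phi i is n i composed with the inverse of m i. *)
  set (P F (k : pts unit_disc -> pts unit_disc) := disc_automorphism k /\
     exists i, F = (fun x => m i (Phi i x)) /\ (fun x => k (F x)) = (fun x => n i (Phi i x))).
  set (M F := epsilon (inhabits (fun x => x)) (P F)).
  assert (HM : forall F, In _ S F -> P F (M F)).
  { intros F HF. unfold M; apply epsilon_spec.
    destruct (proj1 (HmS F) HF) as [i Ei].
    destruct (Hm i) as [Hmi [m' [Hm' [E1 E2]]]].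
    exists (fun x => n i (m' x)). split.
    - apply disc_automorphism_comp; [apply Hn|]. split; [exact Hm'|]. now exists (m i).
    - exists i; split; [exact Ei|]. rewrite Ei. apply functional_extensionality; intros x. now rewrite E1. }
  exists M. split; [intros F HF; now apply HM|].
  intros G. rewrite HnS. split.
  - intros [i ->]. exists (fun x => m i (Phi i x)).
    assert (HF : In _ S (fun x => m i (Phi i x))) by (apply HmS; now exists i).
    split; [exact HF|]. destruct (HM _ HF) as [_ [j [Ej Ek]]].
    rewrite Ek. now rewrite (Hij i j Ej).
  - intros [F [HF ->]]. destruct (HM F HF) as [_ [j [Ej Ek]]]. now exists j.
Qed.

End Family.

(** * The disc and the bidisc *)

(** By the parallelogram law the two hypotheses add up to |Y|^2 <= 0. Here X will be an extremal
    derivative along a disc and Y the change caused by tilting the disc. *)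
Lemma parallelogram_vanish (X Y : C) : Csq (X + Y) <= Csq X -> Csq (X - Y) <= Csq X -> Y = 0.
Proof.
  intros H1 H2. apply Csq_eq_0. unfold Csq in *; destruct X, Y; simpl in *. nra.
Qed.

Lemma Csq_le_of_Cmod (X Y : C) : Cmod X <= Cmod Y -> Csq X <= Csq Y.
Proof. apply Cmod_le_Csq. Qed.

(** The left inverse g has the reciprocal derivative at f a, so Schwarz-Pick for g is the reverse
    inequality for f. *)
Lemma schwarz_pick_equality f g a l : maps_disc f -> maps_disc g -> (forall z, Csq z < 1 -> g (f z) = z) ->
  Csq a < 1 -> cdiff f a l -> 1 - Csq (f a) <= Cmod l * (1 - Csq a).
Proof.
  intros Hf Hg Hgf Ha Hl. destruct (Hf a Ha) as [Hfa _].
  destruct (Hg (f a) Hfa) as [_ [l' Hl']].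
  assert (H := schwarz_pick_derivative g (f a) l' Hg Hfa Hl').
  rewrite Hgf in H by trivial.
  assert (E : (l' * l)%C = 1).
  { apply (cdiff_unique (fun z => g (f z)) a); [now apply cdiff_comp|].
    apply Csq_Cmod in Ha.
    apply (cdiff_locally (fun z => z) _ _ _ (1 - Cmod a)); [lra| |apply cdiff_id].
    intros w Hw. symmetry; apply Hgf. apply Csq_Cmod.
    assert (T := Cmod_triangle (w - a) a). replace (w - a + a)%C with w in T by ring. lra. }
  assert (E' : Cmod l' * Cmod l = 1) by (rewrite <- Cmod_mult, E; apply Cmod_1).
  apply (Rmult_le_compat_l (Cmod l)) in H; [|apply Cmod_ge_0].
  replace (Cmod l * (Cmod l' * (1 - Csq (f a)))) with (Cmod l' * Cmod l * (1 - Csq (f a))) in H by ring.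
  rewrite E' in H. lra.
Qed.

Lemma automorphism_extremal m a l : disc_automorphism m -> Csq a < 1 -> cdiff (ext m) a l ->
  1 - Csq (ext m a) <= Cmod l * (1 - Csq a).
Proof.
  intros [Hm [m' [Hm' [E1 E2]]]] Ha Hl.
  apply (schwarz_pick_equality (ext m) (ext m')); trivial; try now apply maps_disc_ext.
  intros z Hz. assert (Hz' : unit_disc z) by now apply Csq_Cmod.
  rewrite (ext_in m z Hz'), ext_pt, E1. reflexivity.
Qed.

Lemma extremal_automorphism f a l : maps_disc f -> Csq a < 1 -> cdiff f a l ->
  1 - Csq (f a) <= Cmod l * (1 - Csq a) ->
  exists m, disc_automorphism m /\ forall z, Csq z < 1 -> f z = ext m z.
Proof.
  intros Hf Ha Hl Heq. destruct (Hf a Ha) as [Hfa _].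
  assert (H := schwarz_pick_rigid f a l Hf Ha Hl Heq).
  assert (Hle := schwarz_pick_derivative f a l Hf Ha Hl).
  set (c := (l * RtoC (1 - Csq a) / RtoC (1 - Csq (f a)))%C) in *.
  assert (Hc : Csq c = 1).
  { rewrite <- Cmod_sq. unfold c; rewrite Cmod_scaled by trivial.
    replace (Cmod l * (1 - Csq a)) with (1 - Csq (f a)) by lra. field; lra. }
  destruct (disc_automorphism_mob (f a) c (- a)) as [m [Hm Em]]; trivial; [now rewrite Csq_opp|].
  exists m; split; [exact Hm|]. intros z Hz. rewrite Em by trivial. now apply H.
Qed.

(** By [schwarz_pick_rigid] a map attaining equality at a is determined by its value and derivative
    there. *)
Lemma automorphism_jet f m a l : maps_disc f -> disc_automorphism m -> Csq a < 1 ->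
  cdiff f a l -> cdiff (ext m) a l -> f a = ext m a -> forall z, Csq z < 1 -> f z = ext m z.
Proof.
  intros Hf Hm Ha Hl Hl' E z Hz.
  assert (Heq := automorphism_extremal m a l Hm Ha Hl').
  rewrite (schwarz_pick_rigid (ext m) a l) by (trivial; apply maps_disc_ext, Hm).
  rewrite <- E in Heq |- *. now apply schwarz_pick_rigid.
Qed.

(** * The unit disc: the identity alone is universal *)

Section Disc.

Let id_disc (x : pts unit_disc) : pts unit_disc := x.

Lemma ext_id_disc z : unit_disc z -> ext id_disc z = z.
Proof. intros h. now rewrite (ext_in _ z h). Qed.

Lemma vdiff_id (z : C) : vdiff (V := C_NormedModule) (fun w => w) z (fun v => v).
Proof. exact (filterdiff_id (K := C_AbsRing) (V := C_NormedModule) _). Qed.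

Lemma holomorphic_id_disc : holomorphic id_disc.
Proof.
  apply (holomorphic_formula _ (fun z : C => z)); [apply open_unit_disc|apply ext_id_disc|].
  intros s _. eexists; apply vdiff_id.
Qed.

Lemma disc_0 : unit_disc (RtoC 0).
Proof. unfold unit_disc; rewrite Cmod_0; lra. Qed.

Theorem unit_disc_minimal_universal :
  (exists S, minimal_universal_set unit_disc S) /\
  (forall S S', minimal_universal_set unit_disc S -> minimal_universal_set unit_disc S' -> equivalent S S').
Proof.
  apply (minimal_universal_family (I := unit) (fun _ => id_disc)
    (fun _ => Infinitesimal (exist unit_disc (RtoC 0) disc_0) (RtoC 1 : C_NormedModule))).
  - apply open_unit_disc.
  - intros _; apply holomorphic_id_disc.
  - intros d _. exists tt. apply solves_car_iff; split; [apply holomorphic_id_disc|].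
    intros G HG. apply (push_comp_le G id_disc d open_unit_disc HG holomorphic_id_disc).
  - intros _. exact (RtoC_ne_0 1 R1_neq_R0).
  - intros _ F HF. apply solves_car_iff in HF. destruct HF as [HF H].
    specialize (H _ holomorphic_id_disc). apply push_le_iff in H. simpl proj1_sig in H.
    rewrite (dir_deriv_formula id_disc (fun z : C => z) _ (fun v => v) open_unit_disc ext_id_disc
      holomorphic_id_disc disc_0 (vdiff_id 0)), (ext_id_disc _ disc_0) in H.
    assert (H0 : Csq 0 < 1) by (unfold Csq; simpl; lra).
    assert (P := ext_disc F _ disc_0).
    rewrite Cmod_1 in H.
    destruct (extremal_automorphism (ext F) 0 (dir_deriv F (RtoC 0) (RtoC 1 : C_NormedModule))) as [m [Hm E]]; trivial.
    + now apply maps_disc_ext.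
    + apply (cdiff_ext_curve F (fun w => w) 0 (RtoC 1)); [exact HF|exact disc_0|].
      apply filterdiff_cdiff, cdiff_id.
    + apply (Rmult_le_compat_r (1 - Csq (ext F (RtoC 0)))) in H; [|lra].
      unfold Rdiv in H at 2. rewrite Rmult_assoc, Rinv_l in H by lra.
      replace (Csq 0) with 0 in * by (unfold Csq; simpl; ring). lra.
    + exists m; split; [exact Hm|].
      apply map_eq. intros s Hs. rewrite (ext_comp m id_disc s Hs), (ext_id_disc s Hs).
      apply E. now apply Csq_Cmod.
  - now intros [] [].
Qed.

End Disc.

(** Every value and derivative allowed by Schwarz-Pick at al is attained; c is the hyperbolic
    derivative. *)
Lemma mob_interpolation (c al be : C) : Csq c <= 1 -> Csq al < 1 -> Csq be < 1 ->
  let f := fun z => mob be (c * mob (- al) z)%C in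
  maps_disc f /\ f al = be /\ cdiff f al (c * RtoC (1 - Csq be) / RtoC (1 - Csq al)).
Proof.
  intros Hc Hal Hbe f.
  assert (Hal' : Csq (- al) < 1) by now rewrite Csq_opp.
  assert (Hin : maps_disc (fun z => c * mob (- al) z)%C).
  { intros z Hz. destruct (maps_disc_mob _ Hal' z Hz) as [H1 [l Hl]]. split.
    - rewrite Csq_mult. assert (A := Csq_ge_0 c). assert (B := Csq_ge_0 (mob (- al) z)). nra.
    - eexists; apply cdiff_mult; [apply cdiff_const|exact Hl]. }
  assert (E0 : (c * mob (- al) al)%C = 0) by (rewrite mob_opp_self; ring).
  split; [|split].
  - apply (maps_disc_comp (mob be)); [now apply maps_disc_mob|exact Hin].
  - unfold f. rewrite E0. apply mob_0.
  - assert (D := cdiff_mult (fun _ => c) _ al _ _ (cdiff_const c al) (cdiff_mob (- al) al Hal' Hal)).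
    assert (D' := cdiff_mob be (c * mob (- al) al)%C Hbe ltac:(rewrite E0; unfold Csq; simpl; lra)).
    eapply cdiff_eq; [exact (cdiff_comp _ _ _ _ _ D D')|].
    cbv beta. rewrite E0, Csq_opp, Copp_conj.
    replace (1 + Cconj be * 0)%C with (RtoC 1) by ring.
    replace (1 + - Cconj al * al)%C with (RtoC (1 - Csq al)).
    + field. apply RtoC_ne_0; lra.
    + replace (- Cconj al * al)%C with (- (Cconj al * al))%C by ring. rewrite conj_mult_self.
      unfold RtoC, Cplus, Copp; simpl; f_equal; ring.
Qed.

(** * The bidisc: the two coordinates are universal *)

Definition coord (b : bool) (x : C2) : C := if b then fst x else snd x.
(** The boolean names the dominant coordinate, whose value is u, so that one argument serves both
    coordinates. *)
Definition join (b : bool) (u v : C) : C2 := if b then (u, v) else (v, u).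

Lemma coord_join b u v : coord b (join b u v) = u.
Proof. now destruct b. Qed.

Lemma join_coord b x : join b (coord b x) (coord (negb b) x) = x.
Proof. now destruct b, x. Qed.

Lemma bidisc_join b u v : Csq u < 1 -> Csq v < 1 -> bidisc (join b u v).
Proof. intros Hu Hv; apply Csq_Cmod in Hu, Hv. now destruct b. Qed.

Lemma bidisc_coord b x : bidisc x -> Csq (coord b x) < 1.
Proof. intros [H1 H2]; apply Csq_Cmod; now destruct b. Qed.

Lemma filterdiff_join b (k1 k2 : C -> C) z l1 l2 : cdiff k1 z l1 -> cdiff k2 z l2 ->
  filterdiff (K := C_AbsRing) (U := C_NormedModule) (V := C2) (fun w => join b (k1 w) (k2 w)) (locally z)
    (fun h : C => scal (V := C2) h (join b l1 l2)).
Proof. intros H1 H2. destruct b; now apply filterdiff_pair. Qed.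

Lemma open_bidisc (x : C2) : bidisc x -> locally x bidisc.
Proof.
  intros [H1 H2]. apply norm_locally.
  exists (Rmin (1 - Cmod (fst x)) (1 - Cmod (snd x))); split; [apply Rmin_pos; lra|].
  intros y Hy. assert (N1 := norm_fst_le (minus y x)). assert (N2 := norm_snd_le (minus y x)).
  assert (Y1 := Rlt_le_trans _ _ _ Hy (Rmin_l _ _)). assert (Y2 := Rlt_le_trans _ _ _ Hy (Rmin_r _ _)).
  assert (L1 := Rle_lt_trans _ _ _ N1 Y1). assert (L2 := Rle_lt_trans _ _ _ N2 Y2).
  destruct x as [x1 x2], y as [y1 y2].
  change (Cmod (y1 - x1)%C < 1 - Cmod x1) in L1. change (Cmod (y2 - x2)%C < 1 - Cmod x2) in L2.
  assert (T1 := Cmod_triangle (y1 - x1)%C x1). assert (T2 := Cmod_triangle (y2 - x2)%C x2).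
  replace (y1 - x1 + x1)%C with (y1 : C) in T1 by (exact (eq_sym (Cminus_plus_cancel y1 x1))).
  replace (y2 - x2 + x2)%C with (y2 : C) in T2 by (exact (eq_sym (Cminus_plus_cancel y2 x2))).
  split; simpl; lra.
Qed.

Section Bidisc.

Let P b : pts bidisc -> pts unit_disc :=
  to_disc (fun x : pts bidisc => coord b (proj1_sig x)) (fun x => bidisc_coord b _ (proj2_sig x)).

Lemma ext_P b x : bidisc x -> ext (P b) x = coord b x.
Proof. intros h. now rewrite (ext_in _ x h). Qed.

Lemma vdiff_coord b x : vdiff (V := C2) (coord b) x (coord b).
Proof. destruct b; [apply vdiff_fst|apply vdiff_snd]. Qed.

Lemma holomorphic_P b : holomorphic (P b).
Proof.
  apply (holomorphic_formula _ (coord b)); [apply open_bidisc|apply ext_P|].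
  intros s _; eexists; apply vdiff_coord.
Qed.

Lemma dir_deriv_P b x v : bidisc x -> dir_deriv (P b) x v = coord b v.
Proof.
  intros h. apply (dir_deriv_formula _ (coord b) x (coord b) open_bidisc (ext_P b) (holomorphic_P b) h).
  apply vdiff_coord.
Qed.

Lemma graph_curve b f : maps_disc f -> forall z, Csq z < 1 -> bidisc (join b z (f z)) /\
  exists l, cdiff f z l /\
  filterdiff (K := C_AbsRing) (U := C_NormedModule) (V := C2) (fun w => join b w (f w)) (locally z)
    (fun h : C => scal (V := C2) h (join b 1 l)).
Proof.
  intros Hf z Hz. destruct (Hf z Hz) as [H1 [l Hl]]. split; [now apply bidisc_join|].
  exists l; split; [exact Hl|]. apply filterdiff_join; [apply cdiff_id|exact Hl].
Qed.

Lemma maps_disc_graph b f (F : pts bidisc -> pts unit_disc) : holomorphic F -> maps_disc f ->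
  maps_disc (fun z => ext F (join b z (f z))).
Proof.
  intros HF Hf z Hz. destruct (graph_curve b f Hf z Hz) as [H1 [l [Hl H2]]].
  split; [now apply ext_disc|]. eexists. exact (cdiff_ext_curve F _ z _ HF H1 H2).
Qed.

Lemma cdiff_graph b f (F : pts bidisc -> pts unit_disc) z l : holomorphic F -> maps_disc f -> Csq z < 1 ->
  cdiff f z l -> cdiff (fun z => ext F (join b z (f z))) z (dir_deriv F (join b z (f z)) (join b 1 l)).
Proof.
  intros HF Hf Hz Hl. destruct (Hf z Hz) as [H1 _].
  apply (cdiff_ext_curve F (fun z => join b z (f z)) z (join b 1 l) HF); [now apply bidisc_join|].
  apply filterdiff_join; [apply cdiff_id|exact Hl].
Qed.

(** If coordinate b dominates, Schwarz-Pick interpolation gives a self-map f of the disc carrying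
    that coordinate of the datum to the other. The graph of f passes through the datum, and on it
    every competitor G is bounded by Schwarz-Pick. *)
Lemma coordinate_solves b (d : datum bidisc) : nondegenerate d ->
  datum_abs (push (P (negb b)) d) <= datum_abs (push (P b) d) -> solves_car (P b) d.
Proof.
  intros Hd H. apply solves_car_iff; split; [apply holomorphic_P|].
  intros G HG. apply push_le_iff in H. apply push_le_iff.
  destruct d as [[x hx] [y hy]|[x hx] v]; simpl proj1_sig in *.
  - rewrite (ext_P b x hx), (ext_P b y hy), (ext_P _ x hx), (ext_P _ y hy) in *.
    assert (Ex := join_coord b x). assert (Ey := join_coord b y).
    assert (X1 := bidisc_coord b x hx). assert (X2 := bidisc_coord (negb b) x hx).
    assert (Y1 := bidisc_coord b y hy). assert (Y2 := bidisc_coord (negb b) y hy).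
    set (a1 := coord b x) in *. set (b1 := coord (negb b) x) in *.
    set (a2 := coord b y) in *. set (b2 := coord (negb b) y) in *.
    assert (Y1' : Csq (- a2) < 1) by now rewrite Csq_opp.
    assert (Y2' : Csq (- b2) < 1) by now rewrite Csq_opp.
    rewrite !pdist_mob in H. apply Cmod_le_Csq in H.
    (* If the dominant coordinates agreed, so would the others, and the datum would be
       degenerate. *)
    assert (N : mob (- a2) a1 <> 0).
    { intros N. rewrite N in H. replace (Csq 0) with 0 in H by (unfold Csq; simpl; ring).
      assert (N' : mob (- b2) b1 = 0) by (apply Csq_eq_0, Rle_antisym; [exact H|apply Csq_ge_0]).
      assert (E1 := mob_opp' a2 a1 Y1 X1). assert (E2 := mob_opp' b2 b1 Y2 X2).
      rewrite N, mob_0 in E1. rewrite N', mob_0 in E2.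
      apply Hd. apply eq_sig_hprop; [intros; apply proof_irrelevance|]. simpl.
      rewrite <- Ex, <- Ey. now rewrite E1, E2. }
    assert (HN := Csq_pos _ N).
    (* The quotient is the factor for which the interpolating map also sends a1 to b1; domination
       says that its modulus is at most 1. *)
    destruct (mob_interpolation (mob (- b2) b1 / mob (- a2) a1)%C a2 b2) as [I1 [I2 _]]; trivial.
    { rewrite Csq_div by trivial. apply (Rmult_le_reg_r (Csq (mob (- a2) a1))); [exact HN|].
      unfold Rdiv. rewrite Rmult_assoc, Rinv_l by lra. lra. }
    set (f := fun z => mob b2 (mob (- b2) b1 / mob (- a2) a1 * mob (- a2) z)%C) in *.
    assert (I3 : f a1 = b1).
    { unfold f. replace (mob (- b2) b1 / mob (- a2) a1 * mob (- a2) a1)%C with (mob (- b2) b1) by (field; trivial).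
      now apply mob_opp'. }
    assert (SP := schwarz_pick _ a1 a2 (maps_disc_graph b f G HG I1) X1 Y1). cbv beta in SP.
    change (f a2 = b2) in I2. now rewrite I2, I3, Ex, Ey in SP.
  - rewrite (ext_P b x hx), (ext_P _ x hx), !dir_deriv_P in * by trivial.
    assert (Ex := join_coord b x). assert (Ev := join_coord b v).
    assert (X1 := bidisc_coord b x hx). assert (X2 := bidisc_coord (negb b) x hx).
    set (a1 := coord b x) in *. set (b1 := coord (negb b) x) in *.
    set (v1 := coord b v) in *. set (v2 := coord (negb b) v) in *.
    assert (N : v1 <> 0).
    { intros N. rewrite N, Cmod_0 in H. unfold Rdiv in H. rewrite Rmult_0_l in H.
      assert (0 < / (1 - Csq b1)) by (apply Rinv_0_lt_compat; lra).
      assert (A := Cmod_ge_0 v2).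
      assert (N' : v2 = 0) by (apply Cmod_eq_0; nra).
      apply Hd. rewrite <- Ev, N, N'. now destruct b. }
    assert (HN : 0 < Cmod v1) by now apply Cmod_gt_0.
    (* The hyperbolic derivative of a map with slope v2 / v1 sending a1 to b1; domination says |c|
       <= 1. *)
    set (c := (v2 * RtoC (1 - Csq a1) / (v1 * RtoC (1 - Csq b1)))%C).
    assert (Na : RtoC (1 - Csq a1) <> 0) by (apply RtoC_ne_0; lra).
    assert (Nb : RtoC (1 - Csq b1) <> 0) by (apply RtoC_ne_0; lra).
    assert (Hc : Csq c <= 1).
    { rewrite <- Cmod_sq. assert (Hc : Cmod c <= 1); [|assert (A := Cmod_ge_0 c); nra].
      unfold c. rewrite Cmod_div, !Cmod_mult, !Cmod_R, !Rabs_pos_eq by (try lra; now apply Cmult_neq_0).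
      apply (Rmult_le_reg_r (Cmod v1 * (1 - Csq b1))); [nra|].
      unfold Rdiv; rewrite Rmult_assoc, Rinv_l by nra.
      apply (Rmult_le_compat_r ((1 - Csq b1) * (1 - Csq a1))) in H; [|nra].
      replace (Cmod v2 / (1 - Csq b1) * ((1 - Csq b1) * (1 - Csq a1))) with (Cmod v2 * (1 - Csq a1)) in H by (field; lra).
      replace (Cmod v1 / (1 - Csq a1) * ((1 - Csq b1) * (1 - Csq a1))) with (Cmod v1 * (1 - Csq b1)) in H by (field; lra).
      lra. }
    destruct (mob_interpolation c a1 b1 Hc X1 X2) as [I1 [I2 I3]].
    set (f := fun z => mob b1 (c * mob (- a1) z)%C) in *.
    replace (c * RtoC (1 - Csq b1) / RtoC (1 - Csq a1))%C with (v2 / v1)%C in I3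
      by (unfold c; field; repeat split; trivial).
    assert (D := cdiff_graph b f G a1 _ HG I1 X1 I3).
    assert (SP := schwarz_pick_derivative _ a1 _ (maps_disc_graph b f G HG I1) X1 D). cbv beta in SP.
    change (f a1 = b1) in I2. rewrite I2, Ex in SP.
    assert (Escal : v = scal (V := C2) v1 (join b 1 (v2 / v1)%C)).
    { rewrite <- Ev at 1. transitivity (join b (v1 * 1)%C (v1 * (v2 / v1))%C); [|now destruct b].
      f_equal; field; trivial. }
    rewrite Escal, (proj2 (dir_deriv_linear G x HG hx)), Cmod_mult.
    assert (PG := ext_disc G x hx).
    apply (Rmult_le_reg_r ((1 - Csq (ext G x)) * (1 - Csq a1))); [nra|].
    set (q := Cmod (dir_deriv G x (join b 1 (v2 / v1)%C))) in *.
    replace (Cmod v1 * q / (1 - Csq (ext G x)) * ((1 - Csq (ext G x)) * (1 - Csq a1)))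
      with (Cmod v1 * (q * (1 - Csq a1))) by (field; lra).
    replace (Cmod v1 / (1 - Csq a1) * ((1 - Csq (ext G x)) * (1 - Csq a1)))
      with (Cmod v1 * (1 - Csq (ext G x))) by (field; lra).
    apply Rmult_le_compat_l; lra.
Qed.

Lemma bidisc_0 b : bidisc (join b 0 0).
Proof. apply bidisc_join; unfold Csq; simpl; lra. Qed.

Lemma coordinate_unique b (F : pts bidisc -> pts unit_disc) : holomorphic F ->
  1 - Csq (ext F (join b 0 0)) <= Cmod (dir_deriv F (join b 0 0) (join b 1 0)) ->
  exists m, disc_automorphism m /\ forall z w, Csq z < 1 -> Csq w < 1 -> ext F (join b z w) = ext m z.
Proof.
  intros HF H.
  assert (Hz0 : maps_disc (fun _ => RtoC 0)).
  { intros z _; split; [unfold Csq; simpl; lra|]. eexists; apply cdiff_const. }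
  assert (C0 : Csq 0 = 0) by (unfold Csq; simpl; ring).
  assert (HM := maps_disc_graph b _ F HF Hz0).
  assert (HD := fun z Hz => cdiff_graph b _ F z _ HF Hz0 Hz (cdiff_const 0 z)). cbv beta in HM, HD.
  destruct (extremal_automorphism _ 0 _ HM ltac:(lra) (HD (RtoC 0) ltac:(lra))) as [m [Hm E]].
  { rewrite C0; lra. }
  exists m; split; [exact Hm|].
  assert (HDm : forall a, Csq a < 1 -> cdiff (ext m) a (dir_deriv F (join b a 0) (join b 1 0))).
  { intros a Ha. assert (Ha' := proj2 (Csq_Cmod a) Ha).
    apply (cdiff_locally (fun z => ext F (join b z 0)) _ _ _ (1 - Cmod a)); [lra| |now apply HD].
    intros w Hw. apply E. apply Csq_Cmod.
    assert (T := Cmod_triangle (w - a) a). replace (w - a + a)%C with w in T by ring. lra. }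
  (* The derivative of F across the flat disc vanishes: the graphs of c * [mob (- a)] with c = 1 and
     c = -1 pass through (a, 0) with opposite slopes, and neither may beat the extremal flat
     disc. *)
  assert (HY : forall a, Csq a < 1 -> dir_deriv F (join b a 0) (join b 0 1) = 0).
  { intros a Ha.
    assert (Hex := automorphism_extremal m a _ Hm Ha (HDm a Ha)).
    rewrite <- E in Hex by trivial.
    assert (Hb : bidisc (join b a 0)) by (apply bidisc_join; lra).
    destruct (dir_deriv_linear F _ HF Hb) as [L1 L2].
    set (X := dir_deriv F (join b a 0) (join b 1 0)) in *. set (Y := dir_deriv F (join b a 0) (join b 0 1)).
    set (k := RtoC (/ (1 - Csq a))).
    assert (Hk : k <> 0) by (apply RtoC_ne_0, Rinv_neq_0_compat; lra).
    assert (Q : forall c, Csq c <= 1 -> Csq (X + c * (k * Y)) <= Csq X).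
    { intros c Hc. destruct (mob_interpolation c a 0 Hc Ha ltac:(lra)) as [I1 [I2 I3]].
      assert (D := cdiff_graph b _ F a _ HF I1 Ha I3).
      assert (SP := schwarz_pick_derivative _ a _ (maps_disc_graph b _ F HF I1) Ha D). cbv beta in SP, I2.
      rewrite I2 in SP.
      assert (Ej : join b 1 (c * RtoC (1 - Csq 0) / RtoC (1 - Csq a))%C =
        plus (join b 1 0) (scal (V := C2) (c * k)%C (join b 0 1))).
      { assert (Ec : (c * RtoC (1 - Csq 0) / RtoC (1 - Csq a))%C = (0 + c * k * 1)%C).
        { rewrite C0, Rminus_0_r. unfold k. rewrite RtoC_inv by lra. field. apply RtoC_ne_0; lra. }
        assert (E1 : RtoC 1 = (1 + c * k * 0)%C) by ring.
        rewrite Ec. destruct b.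
        - exact (f_equal (fun t : C => (t, (0 + c * k * 1)%C)) E1).
        - exact (f_equal (fun t : C => ((0 + c * k * 1)%C, t)) E1). }
      rewrite Ej, L1, L2 in SP. fold X Y in SP.
      apply Csq_le_of_Cmod.
      replace (X + c * (k * Y))%C with (X + c * k * Y)%C by ring.
      apply (Rmult_le_reg_r (1 - Csq a)); lra. }
    assert (Z : (k * Y)%C = 0).
    { apply (parallelogram_vanish X).
      - replace (X + k * Y)%C with (X + 1 * (k * Y))%C by ring. apply Q. unfold Csq; simpl; lra.
      - replace (X - k * Y)%C with (X + (- (1)) * (k * Y))%C by ring. apply Q. unfold Csq; simpl; lra. }
    replace Y with (/ k * (k * Y))%C by (field; trivial). rewrite Z; ring. }
  (* Since the transversal derivative is 0 at (a, 0), F along the tilted disc has the same value and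
     derivative there as m, hence equals m along it. *)
  assert (HG : forall a c, Csq a < 1 -> Csq c <= 1 -> forall z, Csq z < 1 ->
    ext F (join b z (c * mob (- a) z)%C) = ext m z).
  { intros a c Ha Hc z Hz.
    destruct (mob_interpolation c a 0 Hc Ha ltac:(lra)) as [I1 [I2 I3]].
    assert (Em : forall u, mob 0 u = u).
    { intros u. unfold mob. replace (Cconj 0) with (RtoC 0) by (unfold Cconj, RtoC; simpl; f_equal; ring).
      replace (1 + 0 * u)%C with (RtoC 1) by ring. field. }
    assert (D := cdiff_graph b _ F a _ HF I1 Ha I3). cbv beta in D, I2.
    assert (J := automorphism_jet _ m a _ (maps_disc_graph b _ F HF I1) Hm Ha D). cbv beta in J.
    rewrite I2 in J.
    rewrite <- (J) with (z := z); trivial.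
    - now rewrite Em.
    - assert (Hb : bidisc (join b a 0)) by (apply bidisc_join; lra).
      destruct (dir_deriv_linear F _ HF Hb) as [L1 L2].
      set (t := (c * RtoC (1 - Csq 0) / RtoC (1 - Csq a))%C).
      assert (Ej : join b 1 t = plus (join b 1 0) (scal (V := C2) t (join b 0 1))).
      { assert (Ec : t = (0 + t * 1)%C) by ring. assert (E1 : RtoC 1 = (1 + t * 0)%C) by ring.
        rewrite Ec at 1. destruct b.
        - exact (f_equal (fun s : C => (s, (0 + t * 1)%C)) E1).
        - exact (f_equal (fun s : C => ((0 + t * 1)%C, s)) E1). }
      rewrite Ej, L1, L2, HY by trivial.
      replace (dir_deriv F (join b a 0) (join b 1 0) + t * 0)%C with (dir_deriv F (join b a 0) (join b 1 0)) by ring.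
      now apply HDm.
    - now apply E. }
  intros z w Hz Hw.
  destruct (Ceq_dec w 0) as [->|Hw0]; [now apply E|].
  (* A point at pseudohyperbolic distance |w| from z: then w / [mob (- a) z] has modulus 1, and the
     tilted disc with this factor goes through (z, w). *)
  set (a := mob z w). assert (Ha : Csq a < 1) by now apply mob_disc.
  assert (Hmod : Csq (mob (- a) z) = Csq w).
  { rewrite <- (mob_opp z w Hz Hw). fold a. rewrite <- !Cmod_sq.
    assert (S : Cmod (mob (- a) z) = Cmod (mob (- z) a)); [|now rewrite S].
    assert (D1 : (1 - Cconj a * z)%C <> 0).
    { assert (D := mob_den (- a) z ltac:(now rewrite Csq_opp) Hz). rewrite Copp_conj in D.
      replace (1 - Cconj a * z)%C with (1 + - Cconj a * z)%C by ring. exact D. }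
    assert (D2 : (1 - Cconj z * a)%C <> 0).
    { assert (D := mob_den (- z) a ltac:(now rewrite Csq_opp) Ha). rewrite Copp_conj in D.
      replace (1 - Cconj z * a)%C with (1 + - Cconj z * a)%C by ring. exact D. }
    rewrite <- !pdist_mob. unfold pdist. rewrite !Cmod_div by trivial. f_equal.
    - rewrite <- Cmod_opp. f_equal; ring.
    - rewrite <- Cmod_conj. f_equal. rewrite Cminus_conj, Cmult_conj, Cconj_conj.
      replace (Cconj 1) with (RtoC 1) by (unfold Cconj, RtoC; simpl; f_equal; ring). ring. }
  assert (Hw1 := Csq_pos _ Hw0).
  assert (Hm0 : mob (- a) z <> 0) by (apply Csq_neq_0; lra).
  assert (HH := HG a (w / mob (- a) z)%C Ha ltac:(rewrite Csq_div, Hmod by trivial; apply Req_le; field; lra) z Hz).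
  rewrite <- HH. f_equal. f_equal. field; trivial.
Qed.

Theorem bidisc_minimal_universal :
  (exists S, minimal_universal_set bidisc S) /\
  (forall S S', minimal_universal_set bidisc S -> minimal_universal_set bidisc S' -> equivalent S S').
Proof.
  assert (N10 : RtoC 1 <> 0) by (apply RtoC_ne_0; lra).
  assert (C0 : Csq 0 = 0) by (unfold Csq; simpl; ring).
  apply (minimal_universal_family (I := bool) P
    (fun b => Infinitesimal (exist bidisc (join b 0 0) (bidisc_0 b)) (join b 1 0))).
  - apply open_bidisc.
  - apply holomorphic_P.
  - intros d Hd.
    destruct (Rle_dec (datum_abs (push (P false) d)) (datum_abs (push (P true) d))) as [L|L].
    + exists true. now apply coordinate_solves.
    + exists false. apply coordinate_solves; [exact Hd|simpl negb; lra].
  - intros b E. apply N10. rewrite <- (coord_join b 1 0), E. now destruct b.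
  - intros b F HF. apply solves_car_iff in HF. destruct HF as [HF H].
    specialize (H _ (holomorphic_P b)). apply push_le_iff in H. simpl proj1_sig in H.
    assert (PF := ext_disc F _ (bidisc_0 b)).
    rewrite (dir_deriv_P b _ _ (bidisc_0 b)), (ext_P b _ (bidisc_0 b)), !coord_join, Cmod_1, C0 in H.
    destruct (coordinate_unique b F HF) as [m [Hm E]].
    + apply (Rmult_le_compat_r (1 - Csq (ext F (join b 0 0)))) in H; [|lra].
      unfold Rdiv in H at 2. rewrite Rmult_assoc, Rinv_l in H by lra. lra.
    + exists m; split; [exact Hm|]. apply map_eq. intros s Hs.
      rewrite (ext_comp m (P b) s Hs), (ext_P b s Hs).
      rewrite <- (join_coord b s) at 1. apply E; now apply bidisc_coord.
  - intros b b' H. apply solves_car_iff in H. destruct H as [_ H].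
    specialize (H _ (holomorphic_P b)). apply push_le_iff in H. simpl proj1_sig in H.
    rewrite !dir_deriv_P, !(ext_P _ _ (bidisc_0 b)) in H by apply bidisc_0.
    destruct (Bool.bool_dec b' b) as [E|E]; [exact E|exfalso].
    replace (coord b' (join b 1 0)) with (RtoC 0) in H by (destruct b, b'; (reflexivity || now elim E)).
    replace (coord b' (join b 0 0)) with (RtoC 0) in H by (destruct b, b'; reflexivity).
    rewrite !coord_join, Cmod_0, Cmod_1, C0 in H. lra.
Qed.

End Bidisc.

(** * The upper half-plane *)

Lemma Im_neq_0 (z : C) : Im z <> 0 -> z <> 0.
Proof. intros H E. apply H. now rewrite E. Qed.

Definition cayley (l : C) : C := ((l - Ci) / (l + Ci))%C.
Definition cayley_inv (z : C) : C := (Ci * (1 + z) / (1 - z))%C.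

Lemma plus_Ci_ne_0 (l : C) : 0 < Im l -> (l + Ci)%C <> 0.
Proof. intros H. apply Im_neq_0. unfold Im in *; simpl; lra. Qed.

Lemma one_minus_ne_0 (z : C) : Csq z < 1 -> (1 - z)%C <> 0.
Proof.
  intros H E. assert (E' : z = 1) by (replace z with (1 - (1 - z))%C by ring; rewrite E; ring).
  rewrite E' in H. unfold Csq in H; simpl in H; lra.
Qed.

Lemma one_minus_Csq_cayley (l : C) : 0 < Im l -> 1 - Csq (cayley l) = 4 * Im l / Csq (l + Ci).
Proof.
  intros H. assert (N := plus_Ci_ne_0 l H). assert (P := Csq_pos _ N).
  unfold cayley; rewrite Csq_div by trivial.
  apply (Rmult_eq_reg_r (Csq (l + Ci))); [|lra].
  replace ((1 - Csq (l - Ci) / Csq (l + Ci)) * Csq (l + Ci)) with (Csq (l + Ci) - Csq (l - Ci)) by (field; lra).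
  replace (4 * Im l / Csq (l + Ci) * Csq (l + Ci)) with (4 * Im l) by (field; lra).
  unfold Csq, Im; destruct l; simpl; ring.
Qed.

Lemma cayley_disc (l : C) : 0 < Im l -> Csq (cayley l) < 1.
Proof.
  intros H. assert (E := one_minus_Csq_cayley l H).
  assert (P := Csq_pos _ (plus_Ci_ne_0 l H)).
  assert (0 < 4 * Im l / Csq (l + Ci)) by (apply Rdiv_lt_0_compat; lra). lra.
Qed.

Lemma Im_cayley_inv (z : C) : Csq z < 1 -> Im (cayley_inv z) = (1 - Csq z) / Csq (1 - z).
Proof.
  intros H. assert (N := one_minus_ne_0 z H). assert (P := Csq_pos _ N).
  unfold cayley_inv. replace (Ci * (1 + z) / (1 - z))%C with (Ci * (1 + z) * Cconj (1 - z) / RtoC (Csq (1 - z)))%C.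
  - unfold Cdiv. rewrite <- RtoC_inv by lra.
    unfold Csq, Im in *; destruct z; simpl in *. field. lra.
  - rewrite <- conj_mult_self. field. split; [exact N|].
    intros E. apply N. rewrite <- (Cconj_conj (1 - z)), E. unfold Cconj, RtoC; simpl; f_equal; ring.
Qed.

Lemma Im_cayley_inv_pos (z : C) : Csq z < 1 -> 0 < Im (cayley_inv z).
Proof.
  intros H. rewrite Im_cayley_inv by trivial.
  apply Rdiv_lt_0_compat; [lra|]. now apply Csq_pos, one_minus_ne_0.
Qed.

Lemma Ci_ne_0 : Ci <> 0.
Proof. apply Im_neq_0; simpl; lra. Qed.

Lemma two_Ci_ne_0 : (2 * Ci)%C <> 0.
Proof. apply Im_neq_0; simpl; lra. Qed.

Lemma Ci_sq : (Ci * Ci)%C = (- (1))%C.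
Proof. unfold Ci, RtoC, Cmult, Copp; simpl; f_equal; ring. Qed.

Lemma cayley_cayley_inv (z : C) : Csq z < 1 -> cayley (cayley_inv z) = z.
Proof.
  intros H. assert (N := one_minus_ne_0 z H). unfold cayley, cayley_inv. field.
  split; [exact N|].
  replace (Ci * (1 + z) + Ci * (1 - z))%C with (2 * Ci)%C by ring. exact two_Ci_ne_0.
Qed.

Lemma cayley_inv_cayley (l : C) : 0 < Im l -> cayley_inv (cayley l) = l.
Proof.
  intros H. assert (N := plus_Ci_ne_0 l H). unfold cayley, cayley_inv. field.
  split; [exact N|].
  replace (l + Ci - (l - Ci))%C with (2 * Ci)%C by ring. exact two_Ci_ne_0.
Qed.

Lemma cdiff_cayley_inv (z : C) : Csq z < 1 -> cdiff cayley_inv z (2 * Ci / ((1 - z) * (1 - z))).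
Proof.
  intros H. assert (N := one_minus_ne_0 z H). eapply cdiff_eq.
  - apply cdiff_div; [| |exact N].
    + apply cdiff_mult; [apply cdiff_const|]. apply cdiff_plus; [apply cdiff_const|apply cdiff_id].
    + apply cdiff_minus; [apply cdiff_const|apply cdiff_id].
  - cbv beta. field; exact N.
Qed.

Lemma cdiff_cayley (l : C) : 0 < Im l -> cdiff cayley l (2 * Ci / ((l + Ci) * (l + Ci))).
Proof.
  intros H. assert (N := plus_Ci_ne_0 l H). eapply cdiff_eq.
  - apply cdiff_div; [| |exact N].
    + apply cdiff_minus; [apply cdiff_id|apply cdiff_const].
    + apply cdiff_plus; [apply cdiff_id|apply cdiff_const].
  - cbv beta. field; exact N.
Qed.

Definition maps_halfplane (f : C -> C) : Prop :=
  forall l, 0 < Im l -> Csq (f l) < 1 /\ exists d, cdiff f l d.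

Lemma maps_disc_halfplane f : maps_halfplane f -> maps_disc (fun z => f (cayley_inv z)).
Proof.
  intros Hf z Hz. destruct (Hf _ (Im_cayley_inv_pos z Hz)) as [H1 [d Hd]].
  split; [exact H1|]. eexists; exact (cdiff_comp _ _ _ _ _ (cdiff_cayley_inv z Hz) Hd).
Qed.

(** The Cayley transform is an isometry from the half-plane with density 1 / (2 Im l) to the disc
    with density 1 / (1 - |z|^2). *)
Lemma cdiff_halfplane f l d : 0 < Im l -> cdiff f l d ->
  exists d', cdiff (fun z => f (cayley_inv z)) (cayley l) d' /\
    Cmod d' * (1 - Csq (cayley l)) = Cmod d * (2 * Im l).
Proof.
  intros Hl Hd. assert (Hz := cayley_disc l Hl).
  rewrite <- (cayley_inv_cayley l Hl) in Hd.
  eexists; split; [exact (cdiff_comp _ _ _ _ _ (cdiff_cayley_inv _ Hz) Hd)|].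
  assert (N := one_minus_ne_0 _ Hz). assert (P := Csq_pos _ N).
  replace (Im l) with ((1 - Csq (cayley l)) / Csq (1 - cayley l))
    by (rewrite <- Im_cayley_inv by exact Hz; now rewrite cayley_inv_cayley).
  rewrite Cmod_mult, Cmod_div, !Cmod_mult, Cmod_sq, Cmod_Ci, Cmod_R, Rabs_pos_eq by (lra || now apply Cmult_neq_0).
  field. lra.
Qed.

Lemma schwarz_pick_halfplane_derivative f l d : maps_halfplane f -> 0 < Im l -> cdiff f l d ->
  Cmod d * (2 * Im l) <= 1 - Csq (f l).
Proof.
  intros Hf Hl Hd. destruct (cdiff_halfplane f l d Hl Hd) as [d' [Hd' E]].
  assert (H := schwarz_pick_derivative _ _ _ (maps_disc_halfplane f Hf) (cayley_disc l Hl) Hd').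
  cbv beta in H. rewrite cayley_inv_cayley in H by trivial. lra.
Qed.

Lemma schwarz_pick_halfplane f l1 l2 : maps_halfplane f -> 0 < Im l1 -> 0 < Im l2 ->
  pdist (f l1) (f l2) <= pdist (cayley l1) (cayley l2).
Proof.
  intros Hf H1 H2.
  assert (H := schwarz_pick _ _ _ (maps_disc_halfplane f Hf) (cayley_disc _ H1) (cayley_disc _ H2)).
  cbv beta in H. now rewrite !cayley_inv_cayley in H.
Qed.

Lemma extremal_halfplane f l d : maps_halfplane f -> 0 < Im l -> cdiff f l d ->
  1 - Csq (f l) <= Cmod d * (2 * Im l) ->
  exists m, disc_automorphism m /\ forall l', 0 < Im l' -> f l' = ext m (cayley l').
Proof.
  intros Hf Hl Hd H. destruct (cdiff_halfplane f l d Hl Hd) as [d' [Hd' E]].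
  destruct (extremal_automorphism _ _ _ (maps_disc_halfplane f Hf) (cayley_disc l Hl) Hd') as [m [Hm Em]].
  - rewrite cayley_inv_cayley by trivial. lra.
  - exists m; split; [exact Hm|]. intros l' Hl'. rewrite <- Em by (now apply cayley_disc).
    now rewrite cayley_inv_cayley.
Qed.

Lemma halfplane_radius (l w : C) : Cmod (w - l) < Im l -> 0 < Im w.
Proof.
  intros H. assert (B := im_le_Cmod (w - l)). assert (T := Rle_lt_trans _ _ _ B H).
  apply Rabs_def2 in T. unfold Im in *; simpl in T. lra.
Qed.

Lemma cayley_automorphism_extremal m l d : disc_automorphism m -> 0 < Im l ->
  cdiff (fun l => ext m (cayley l)) l d -> 1 - Csq (ext m (cayley l)) <= Cmod d * (2 * Im l).
Proof.
  intros Hm Hl Hd. destruct (cdiff_halfplane _ l d Hl Hd) as [d' [Hd' E]].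
  rewrite <- E. apply automorphism_extremal; [exact Hm|now apply cayley_disc|].
  assert (Hz := cayley_disc l Hl). assert (Hz' := proj2 (Csq_Cmod _) Hz).
  apply (cdiff_locally (fun z => ext m (cayley (cayley_inv z))) _ _ _ (1 - Cmod (cayley l))); [lra| |exact Hd'].
  intros w Hw. rewrite cayley_cayley_inv; [reflexivity|]. apply Csq_Cmod.
  assert (T := Cmod_triangle (w - cayley l) (cayley l)).
  replace (w - cayley l + cayley l)%C with w in T by ring. lra.
Qed.

Lemma cayley_jet f m l d : maps_halfplane f -> disc_automorphism m -> 0 < Im l ->
  cdiff f l d -> cdiff (fun l => ext m (cayley l)) l d -> f l = ext m (cayley l) ->
  forall l', 0 < Im l' -> f l' = ext m (cayley l').
Proof.
  intros Hf Hm Hl Hd Hd' E l' Hl'.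
  assert (Hz := cayley_disc l Hl). assert (Hz' := proj2 (Csq_Cmod _) Hz).
  assert (C1 := cdiff_comp f cayley_inv (cayley l) _ _ (cdiff_cayley_inv _ Hz) ltac:(rewrite cayley_inv_cayley by trivial; exact Hd)).
  assert (C2 := cdiff_comp _ cayley_inv (cayley l) _ _ (cdiff_cayley_inv _ Hz) ltac:(rewrite cayley_inv_cayley by trivial; exact Hd')).
  cbv beta in C2.
  assert (J := automorphism_jet (fun z => f (cayley_inv z)) m (cayley l) _ (maps_disc_halfplane f Hf) Hm Hz C1).
  rewrite <- (cayley_inv_cayley l' Hl') at 1. apply J.
  - apply (cdiff_locally (fun z => ext m (cayley (cayley_inv z))) _ _ _ (1 - Cmod (cayley l))); [lra| |exact C2].
    intros w Hw. rewrite cayley_cayley_inv; [reflexivity|]. apply Csq_Cmod.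
    assert (T := Cmod_triangle (w - cayley l) (cayley l)).
    replace (w - cayley l + cayley l)%C with w in T by ring. lra.
  - rewrite cayley_inv_cayley by trivial. exact E.
  - now apply cayley_disc.
Qed.

(** * Complex square roots and real polynomials of low degree *)

Lemma Csqrt_exists (q : C) : exists r, q = (r * r)%C.
Proof.
  destruct q as [u w].
  set (m := sqrt (u * u + w * w)).
  assert (Hm : m * m = u * u + w * w) by (apply sqrt_sqrt; nra).
  assert (Hm0 : 0 <= m) by apply sqrt_pos.
  assert (Hu1 : 0 <= (m + u) / 2).
  { assert (- m <= u); [apply Rnot_lt_le; intros L; nra|lra]. }
  assert (Hu2 : 0 <= (m - u) / 2).
  { assert (u <= m); [apply Rnot_lt_le; intros L; nra|lra]. }
  set (al := sqrt ((m + u) / 2)). set (be := sqrt ((m - u) / 2)).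
  assert (A1 : al * al = (m + u) / 2) by now apply sqrt_sqrt.
  assert (A2 : be * be = (m - u) / 2) by now apply sqrt_sqrt.
  assert (A3 : al * be = Rabs w / 2).
  { unfold al, be. rewrite <- sqrt_mult by trivial.
    replace ((m + u) / 2 * ((m - u) / 2)) with ((Rabs w / 2) * (Rabs w / 2)).
    - apply sqrt_square. assert (P := Rabs_pos w); lra.
    - assert (E : Rabs w * Rabs w = w * w) by (rewrite <- Rabs_mult; apply Rabs_pos_eq; nra). nra. }
  destruct (Rle_dec 0 w) as [L|L].
  - rewrite Rabs_pos_eq in A3 by trivial. exists (al, be). unfold Cmult; simpl; f_equal; lra.
  - rewrite Rabs_left in A3 by lra. exists (al, - be). unfold Cmult; simpl; f_equal; lra.
Qed.

Lemma cubic_nonneg c3 c2 c1 c0 : (forall t, 0 <= c3 * t ^ 3 + c2 * t ^ 2 + c1 * t + c0) -> c3 = 0.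
Proof.
  assert (Hpos : forall c3 c2 c1 c0, (forall t, 0 <= c3 * t ^ 3 + c2 * t ^ 2 + c1 * t + c0) -> 0 <= c3).
  { clear. intros c3 c2 c1 c0 H. destruct (Rle_dec 0 c3) as [L|L]; [exact L|exfalso].
    (* For T >= 1 the polynomial is at most T^2 (c3 T + s), and T is chosen so that c3 T + s = c3 <
       0. *)
    set (s := Rabs c2 + Rabs c1 + Rabs c0). set (T := 1 + s / - c3).
    assert (P2 := Rle_abs c2). assert (P1 := Rle_abs c1). assert (P0 := Rle_abs c0).
    assert (Q2 := Rabs_pos c2). assert (Q1 := Rabs_pos c1). assert (Q0 := Rabs_pos c0).
    assert (Hs : 0 <= s) by (unfold s; lra).
    assert (HT : 1 <= T) by (unfold T; assert (0 <= s / - c3) by (apply Rdiv_le_0_compat; lra); lra).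
    assert (HT' : - c3 * T = - c3 + s) by (unfold T; field; lra).
    specialize (H T).
    assert (B1 : c2 * T ^ 2 <= Rabs c2 * T ^ 2) by (apply Rmult_le_compat_r; [nra|exact P2]).
    assert (TT : T <= T ^ 2) by nra. assert (T1 : 1 <= T ^ 2) by nra.
    assert (B2 : c1 * T <= Rabs c1 * T ^ 2).
    { apply (Rle_trans _ (Rabs c1 * T)); [apply Rmult_le_compat_r; lra|now apply Rmult_le_compat_l]. }
    assert (B3 : c0 <= Rabs c0 * T ^ 2).
    { apply (Rle_trans _ (Rabs c0 * 1)); [lra|now apply Rmult_le_compat_l]. }
    assert (B4 : c3 * T ^ 3 = - (- c3 + s) * T ^ 2) by (rewrite <- HT'; ring).
    unfold s in *. nra. }
  intros H. apply Rle_antisym; [|now apply (Hpos c3 c2 c1 c0)].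
  assert (0 <= - c3); [|lra].
  apply (Hpos (- c3) c2 (- c1) c0). intros t. specialize (H (- t)).
  replace (- c3 * t ^ 3 + c2 * t ^ 2 + - c1 * t + c0) with (c3 * (- t) ^ 3 + c2 * (- t) ^ 2 + c1 * - t + c0) by ring.
  exact H.
Qed.

Lemma quadratic_nonneg a b c : (forall t, 0 <= a * t ^ 2 + b * t + c) -> 0 <= a.
Proof.
  intros H. destruct (Rle_dec 0 a) as [L|L]; [exact L|exfalso].
  set (s := Rabs b + Rabs c). set (T := 1 + s / - a).
  assert (P1 := Rle_abs b). assert (P0 := Rle_abs c).
  assert (Q1 := Rabs_pos b). assert (Q0 := Rabs_pos c).
  assert (HT : 1 <= T) by (unfold T, s; assert (0 <= (Rabs b + Rabs c) / - a) by (apply Rdiv_le_0_compat; lra); lra).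
  assert (HT' : - a * T = - a + s) by (unfold T; field; lra).
  specialize (H T). unfold s in *. nra.
Qed.

Lemma quadratic_discriminant a b c : (forall t, 0 <= a * t ^ 2 + b * t + c) -> b * b <= 4 * a * c.
Proof.
  intros H. destruct (quadratic_nonneg a b c H) as [Ha| <-].
  - specialize (H (- b / (2 * a))).
    replace (a * (- b / (2 * a)) ^ 2 + b * (- b / (2 * a)) + c) with ((4 * a * c - b * b) / (4 * a)) in H by (field; lra).
    apply (Rmult_le_compat_r (4 * a)) in H; [|lra].
    replace ((4 * a * c - b * b) / (4 * a) * (4 * a)) with (4 * a * c - b * b) in H by (field; lra). lra.
  - destruct (Req_dec b 0) as [->|N]; [lra|].
    specialize (H ((- c - 1) / b)).
    replace (0 * ((- c - 1) / b) ^ 2 + b * ((- c - 1) / b) + c) with (-1) in H by (field; trivial). lra.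
Qed.

(* Here l_j = x_j + i y_j and q_j = u_j + i w_j are the data and A = Ar + i Ai is the slope of q in l.
   The hypothesis for all t says that the boundary point at infinity maximizes the hyperbolic
   distance of the means; its cubic coefficient is the stationarity condition
   2 Re A = w1 / y1 + w2 / y2, which makes the real quadratic exist.  Once q is a real quadratic,
   the difference of the two sides is (1 - a) q(t) up to a positive factor. *)
Lemma extremal_quadratic x1 y1 u1 w1 x2 y2 u2 w2 Ar Ai :
  0 < y1 -> 0 < y2 ->
  w1 * w1 < 4 * (y1 * y1) * (y1 * y1 + u1) ->
  u1 - u2 = Ar * (x1 - x2) - Ai * (y1 - y2) ->
  w1 - w2 = Ar * (y1 - y2) + Ai * (x1 - x2) ->
  (forall t,
     (((x1 - t) * (x2 - t) - y1 * y2 - (Ar * (x2 - t) - Ai * y2) + u2) ^ 2 +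
      ((x1 - t) * y2 + y1 * (x2 - t) - (Ar * y2 + Ai * (x2 - t)) + w2) ^ 2) * (y1 * y2) <=
     (y1 * ((x1 - t) ^ 2 + y1 ^ 2) - (w1 * (x1 - t) - u1 * y1)) *
     (y2 * ((x2 - t) ^ 2 + y2 ^ 2) - (w2 * (x2 - t) - u2 * y2))) ->
  exists a b c, 0 <= a <= 1 /\ (forall t, 0 <= a * t ^ 2 + b * t + c) /\ (a < 1 \/ b * b < 4 * a * c) /\
    u1 = a * (x1 * x1 - y1 * y1) + b * x1 + c /\ w1 = 2 * a * x1 * y1 + b * y1 /\
    u2 = a * (x2 * x2 - y2 * y2) + b * x2 + c /\ w2 = 2 * a * x2 * y2 + b * y2 /\
    Ar = a * (x1 + x2) + b /\ Ai = a * (y1 + y2).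
Proof.
  intros Hy1 Hy2 HE1 Hu Hw H.
  assert (Hstat : y1 * w2 + y2 * w1 - 2 * Ar * (y1 * y2) = 0).
  { set (b1 := Ar - x1 - x2). set (b2 := Ai - y1 - y2).
    set (g1 := x1 * x2 - y1 * y2 - (Ar * x2 - Ai * y2) + u2).
    set (g2 := x1 * y2 + y1 * x2 - (Ar * y2 + Ai * x2) + w2).
    set (m1 := -2 * x1 * y1 + w1). set (m2 := -2 * x2 * y2 + w2).
    set (n1 := y1 * (x1 ^ 2 + y1 ^ 2) - w1 * x1 + u1 * y1).
    set (n2 := y2 * (x2 ^ 2 + y2 ^ 2) - w2 * x2 + u2 * y2).
    apply (cubic_nonneg _ (y1 * n2 + y2 * n1 + m1 * m2 - (y1 * y2) * (b1 ^ 2 + b2 ^ 2 + 2 * g1))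
      (m1 * n2 + m2 * n1 - (y1 * y2) * (2 * (b1 * g1 + b2 * g2))) (n1 * n2 - (y1 * y2) * (g1 ^ 2 + g2 ^ 2))).
    intros t. specialize (H t). apply Rminus_le_0 in H.
    eapply Rle_trans; [exact H|]. apply Req_le.
    unfold b1, b2, g1, g2, m1, m2, n1, n2. ring. }
  set (al1 := w1 / y1). set (al2 := w2 / y2).
  assert (E1 : w1 = al1 * y1) by (unfold al1; field; lra).
  assert (E2 : w2 = al2 * y2) by (unfold al2; field; lra).
  clearbody al1 al2. subst w1 w2.
  assert (HAr : 2 * Ar = al1 + al2).
  { apply (Rmult_eq_reg_r (y1 * y2)); [|nra]. lra. }
  (* The slope between l1 and l2 of a real quadratic is a (l1 + l2) + b, so its imaginary part
     determines a. *)
  set (a := Ai / (y1 + y2)).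
  assert (EAi : Ai = a * (y1 + y2)) by (unfold a; field; lra).
  clearbody a. subst Ai.
  assert (Hal : al1 - al2 = 2 * a * (x1 - x2)).
  { apply (Rmult_eq_reg_r ((y1 + y2) / 2)); [|lra].
    assert (EA : Ar = (al1 + al2) / 2) by lra. subst Ar. lra. }
  set (b := Ar - a * (x1 + x2)).
  assert (Eb : Ar = a * (x1 + x2) + b) by (unfold b; ring). clearbody b. subst Ar.
  assert (Ea1 : al1 = 2 * a * x1 + b) by lra. assert (Ea2 : al2 = 2 * a * x2 + b) by lra.
  subst al1 al2.
  set (c := u1 - a * (x1 * x1 - y1 * y1) - b * x1).
  assert (Ec : u1 = a * (x1 * x1 - y1 * y1) + b * x1 + c) by (unfold c; ring). clearbody c. subst u1.
  assert (Eu2 : u2 = a * (x2 * x2 - y2 * y2) + b * x2 + c) by lra. subst u2.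
  assert (HQ : forall t, 0 <= (1 - a) * (a * t ^ 2 + b * t + c)).
  { intros t. specialize (H t). apply Rminus_le_0 in H.
    apply (Rmult_le_reg_r ((y1 * y2) * ((x1 - x2) ^ 2 + (y1 + y2) ^ 2))).
    { apply Rmult_lt_0_compat; [now apply Rmult_lt_0_compat|].
      assert (0 < (y1 + y2) ^ 2) by (apply pow_lt; lra). assert (P := pow2_ge_0 (x1 - x2)). lra. }
    rewrite Rmult_0_l. eapply Rle_trans; [exact H|]. apply Req_le. ring. }
  (* For a = 1 the inequality defining the domain at the first point becomes, after division by
     y1^2, exactly the strict discriminant condition. *)
  assert (Hdisc : a = 1 -> b * b < 4 * a * c).
  { intros ->. clear - HE1 Hy1.
    assert (0 < y1 * y1) by nra.
    apply (Rmult_lt_reg_l (y1 * y1)); [trivial|]. nra. }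
  exists a, b, c.
  assert (Hab : 0 <= a <= 1 /\ (forall t, 0 <= a * t ^ 2 + b * t + c) /\ (a < 1 \/ b * b < 4 * a * c)).
  { destruct (Rtotal_order a 1) as [L|[L|L]].
    - assert (Q : forall t, 0 <= a * t ^ 2 + b * t + c).
      { intros t. specialize (HQ t). apply (Rmult_le_reg_l (1 - a)); lra. }
      assert (Q1 := quadratic_nonneg a b c Q). repeat split; try lra. exact Q.
    - specialize (Hdisc L). repeat split; try lra. intros t.
      assert (Q := pow2_ge_0 (2 * t + b)).
      replace (a * t ^ 2 + b * t + c) with (((2 * t + b) ^ 2 + (4 * a * c - b * b)) / 4 + (a - 1) * (t ^ 2 - c)) by field.
      rewrite L in *. lra.
    - exfalso. assert (Q1 : 0 <= - a); [|lra]. apply (quadratic_nonneg (- a) (- b) (- c)).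
      intros t. specialize (HQ t). apply (Rmult_le_reg_l (a - 1)); lra. }
  destruct Hab as [H1 [H2 H3]]. repeat split; trivial; lra.
Qed.

(** * The symmetrized bidisc *)

(** A form free of square roots: with q = (al + i be)^2 and y = Im l > 0 the inequality is 0 < (y^2
    - be^2) (y^2 + al^2), that is |be| < y. *)
Definition region (l q : C) : Prop :=
  0 < Im l /\ Im q * Im q < 4 * (Im l * Im l) * (Im l * Im l + Re q).

(** With q = r * r this is (l + r + i) (l - r + i), the common denominator of the Cayley transforms
    of the two roots. *)
Definition kden (l q : C) : C := ((l + Ci) * (l + Ci) - q)%C.

(* The point (z1 + z2, z1 z2) for z1, z2 = cayley (l +- sqrt q) / w: moving the boundary point
   1 / w to infinity turns a pair in the disc into a pair in the half-plane with mean l and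
   squared half-difference q.  [region] says that both l + sqrt q and l - sqrt q lie there. *)
Definition kappa (w l q : C) : C2 :=
  ((2 * ((l + Ci) * (l - Ci) - q) / (w * kden l q))%C,
   (((l - Ci) * (l - Ci) - q) / (w * w * kden l q))%C).

Lemma region_root l q : region l q -> exists r, q = (r * r)%C /\ 0 < Im (l + r) /\ 0 < Im (l - r).
Proof.
  intros [Hl Hq]. destruct (Csqrt_exists q) as [r Hr]. exists r; split; [exact Hr|].
  subst q. destruct l as [x y], r as [al be]. unfold Im, Re in *; simpl in *.
  assert (H : be * be < y * y).
  { apply Rnot_le_lt; intros L.
    assert (0 <= (be * be - y * y) * (y * y + al * al)) by (apply Rmult_le_pos; nra). nra. }
  split; nra.
Qed.

Lemma root_region (l r : C) : 0 < Im (l + r) -> 0 < Im (l - r) -> region l (r * r).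
Proof.
  intros H1 H2. destruct l as [x y], r as [al be]. unfold region, Im, Re in *; simpl in *.
  assert (Hy : 0 < y) by lra. split; [exact Hy|].
  assert (H : 0 < (y * y - be * be) * (y * y + al * al)).
  { replace (y * y - be * be) with ((y + be) * (y + - be)) by ring.
    apply Rmult_lt_0_compat; [now apply Rmult_lt_0_compat|nra]. }
  nra.
Qed.

Lemma kden_ne_0 l q : region l q -> kden l q <> 0.
Proof.
  intros H. destruct (region_root l q H) as [r [-> [H1 H2]]].
  unfold kden. replace ((l + Ci) * (l + Ci) - r * r)%C with ((l + r + Ci) * (l - r + Ci))%C by ring.
  apply Cmult_neq_0; now apply plus_Ci_ne_0.
Qed.

Lemma kappa_roots (w l r : C) : w <> 0 -> 0 < Im (l + r) -> 0 < Im (l - r) ->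
  kappa w l (r * r) = ((cayley (l + r) / w + cayley (l - r) / w)%C, (cayley (l + r) / w * (cayley (l - r) / w))%C).
Proof.
  intros Hw H1 H2. assert (N1 := plus_Ci_ne_0 _ H1). assert (N2 := plus_Ci_ne_0 _ H2).
  unfold kappa, kden, cayley.
  replace ((l + Ci) * (l + Ci) - r * r)%C with ((l + r + Ci) * (l - r + Ci))%C by ring.
  f_equal; field; repeat split; trivial.
Qed.

Lemma unimodular_ne_0 (w : C) : Csq w = 1 -> w <> 0.
Proof. intros H; apply Csq_neq_0; lra. Qed.

Lemma sym_bidisc_kappa w l q : Csq w = 1 -> region l q -> sym_bidisc (kappa w l q).
Proof.
  intros Hw H. assert (Hw0 := unimodular_ne_0 w Hw).
  destruct (region_root l q H) as [r [-> [H1 H2]]].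
  exists (cayley (l + r) / w)%C, (cayley (l - r) / w)%C.
  rewrite !Csq_Cmod, !Csq_div, Hw by trivial.
  assert (C1 := cayley_disc _ H1). assert (C2 := cayley_disc _ H2).
  split; [lra|split; [lra|]]. now apply kappa_roots.
Qed.

Lemma sym_bidisc_chart w x : Csq w = 1 -> sym_bidisc x -> exists l q, region l q /\ x = kappa w l q.
Proof.
  intros Hw [z1 [z2 [H1 [H2 ->]]]]. assert (Hw0 := unimodular_ne_0 w Hw).
  apply Csq_Cmod in H1, H2.
  assert (D1 : Csq (w * z1) < 1) by (rewrite Csq_mult, Hw; lra).
  assert (D2 : Csq (w * z2) < 1) by (rewrite Csq_mult, Hw; lra).
  assert (P1 := Im_cayley_inv_pos _ D1). assert (P2 := Im_cayley_inv_pos _ D2).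
  assert (E1 := cayley_cayley_inv _ D1). assert (E2 := cayley_cayley_inv _ D2).
  set (Z := cayley_inv (w * z1)) in *. set (W := cayley_inv (w * z2)) in *.
  exists ((Z + W) / 2)%C, ((Z - W) / 2 * ((Z - W) / 2))%C.
  assert (N2 : RtoC 2 <> 0) by (apply RtoC_ne_0; lra).
  assert (F1 : ((Z + W) / 2 + (Z - W) / 2)%C = Z) by (field; trivial).
  assert (F2 : ((Z + W) / 2 - (Z - W) / 2)%C = W) by (field; trivial).
  split.
  - apply root_region; [now rewrite F1|now rewrite F2].
  - rewrite kappa_roots by (trivial; rewrite ?F1, ?F2; trivial).
    rewrite F1, F2, E1, E2. f_equal; field; trivial.
Qed.

(* This is - w Phi_w for the usual Phi_w (s, p) = (2 w p - s) / (2 - w s). *)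
Definition phif (w : C) (x : C2) : C :=
  ((w * fst x - 2 * (w * w) * snd x) / (2 - w * fst x))%C.

(** For x = (s, p) this is |2 - w s|^2 (1 - |phif w x|^2); it clears the denominators when the
    lengths of data under different [phif] are compared. *)
Definition den (w : C) (x : C2) : R :=
  Csq (2 - w * fst x) - Csq (w * fst x - 2 * (w * w) * snd x).

Lemma sum_minus_ne_0 (w z1 z2 : C) : Csq w = 1 -> Cmod z1 < 1 -> Cmod z2 < 1 -> (2 - w * (z1 + z2))%C <> 0.
Proof.
  intros Hw H1 H2 E.
  assert (E' : (w * (z1 + z2))%C = 2) by (replace (w * (z1 + z2))%C with (2 - (2 - w * (z1 + z2)))%C by ring; rewrite E; ring).
  assert (Hw' : Cmod w = 1) by (rewrite <- Cmod_sq in Hw; assert (P := Cmod_ge_0 w); nra).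
  assert (T := Cmod_triangle z1 z2).
  assert (M : Cmod (w * (z1 + z2)) = 2) by (rewrite E', Cmod_R, Rabs_pos_eq; lra).
  rewrite Cmod_mult, Hw' in M. lra.
Qed.

Lemma phif_den_ne_0 w x : Csq w = 1 -> sym_bidisc x -> (2 - w * fst x)%C <> 0.
Proof. intros Hw [z1 [z2 [H1 [H2 ->]]]]. now apply sum_minus_ne_0. Qed.

Lemma phif_kappa w l q : Csq w = 1 -> region l q -> phif w (kappa w l q) = cayley l.
Proof.
  intros Hw H. assert (Hw0 := unimodular_ne_0 w Hw).
  assert (N1 := kden_ne_0 l q H). assert (N2 := plus_Ci_ne_0 l (proj1 H)).
  unfold phif, kappa, cayley; simpl fst; simpl snd.
  unfold kden in *. field. repeat split; trivial; cbv beta.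
  replace (2 * ((l + Ci) * (l + Ci) - q) - 2 * ((l + Ci) * (l - Ci) - q))%C with (2 * (2 * Ci) * (l + Ci))%C by ring.
  apply Cmult_neq_0; [|exact N2]. apply Cmult_neq_0; [apply RtoC_ne_0; lra|exact two_Ci_ne_0].
Qed.

Lemma phif_disc w x : Csq w = 1 -> sym_bidisc x -> Csq (phif w x) < 1.
Proof.
  intros Hw Hx. destruct (sym_bidisc_chart w x Hw Hx) as [l [q [H ->]]].
  rewrite phif_kappa by trivial. apply cayley_disc, H.
Qed.

Lemma den_pos w x : Csq w = 1 -> sym_bidisc x -> 0 < den w x.
Proof.
  intros Hw Hx. assert (H := phif_disc w x Hw Hx). assert (N := phif_den_ne_0 w x Hw Hx).
  unfold phif in H; rewrite Csq_div in H by trivial. assert (P := Csq_pos _ N).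
  apply (Rmult_lt_compat_r _ _ _ P) in H. unfold Rdiv in H. rewrite Rmult_assoc, Rinv_l in H by lra.
  unfold den. lra.
Qed.

Lemma RtoC_minus_Ci_ne_0 (t : R) : (RtoC t - Ci)%C <> 0.
Proof. apply Im_neq_0; simpl; lra. Qed.

Lemma Csq_RtoC_minus_Ci (t : R) : Csq (RtoC t - Ci) = t * t + 1.
Proof. unfold Csq; simpl; ring. Qed.

Lemma Csq_RtoC_plus_Ci (t : R) : Csq (RtoC t + Ci) = t * t + 1.
Proof. unfold Csq; simpl; ring. Qed.

(* The conjugate of [boundary_pt w t] is the boundary point sent to t by z |-> cayley_inv (w * z);
   the conjugate of [w] itself is sent to infinity. *)
Definition boundary_pt (w : C) (t : R) : C := (w * (RtoC t + Ci) / (RtoC t - Ci))%C.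

Lemma Csq_boundary_pt w t : Csq w = 1 -> Csq (boundary_pt w t) = 1.
Proof.
  intros Hw. unfold boundary_pt. rewrite Csq_div by apply RtoC_minus_Ci_ne_0.
  rewrite Csq_mult, Hw, Csq_RtoC_minus_Ci, Csq_RtoC_plus_Ci. field. nra.
Qed.

Lemma den_kappa w l q : Csq w = 1 -> region l q -> den w (kappa w l q) = 64 * Im l / Csq (kden l q).
Proof.
  intros Hw H. assert (Hw0 := unimodular_ne_0 w Hw). assert (N1 := kden_ne_0 l q H).
  assert (P := Csq_pos _ N1).
  unfold den, kappa; simpl fst; simpl snd.
  replace (2 - w * (2 * ((l + Ci) * (l - Ci) - q) / (w * kden l q)))%C
    with (2 * (2 * Ci) * (l + Ci) / kden l q)%C by (unfold kden in *; field; auto).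
  replace (w * (2 * ((l + Ci) * (l - Ci) - q) / (w * kden l q)) -
    2 * (w * w) * (((l - Ci) * (l - Ci) - q) / (w * w * kden l q)))%C
    with (2 * (2 * Ci) * (l - Ci) / kden l q)%C by (unfold kden in *; field; auto).
  rewrite !Csq_div, !Csq_mult by trivial.
  unfold Rdiv. rewrite <- Rmult_minus_distr_r. f_equal.
  unfold Csq, Im; destruct l; simpl; ring.
Qed.

(** The factor of 64 in the numerator is |l - t|^2 times the imaginary part of l - t - q / (l - t),
    the half-plane form of the map attached to t. *)
Lemma den_kappa_boundary w t l q : Csq w = 1 -> region l q ->
  den (boundary_pt w t) (kappa w l q) =
  64 * (Im l * ((Re l - t) ^ 2 + Im l ^ 2) - (Im q * (Re l - t) - Re q * Im l)) / ((t * t + 1) * Csq (kden l q)).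
Proof.
  intros Hw H. assert (Hw0 := unimodular_ne_0 w Hw). assert (N1 := kden_ne_0 l q H).
  assert (P := Csq_pos _ N1). assert (Nt := RtoC_minus_Ci_ne_0 t).
  set (D := kden l q) in *. set (N := ((l + Ci) * (l - Ci) - q)%C). set (M := ((l - Ci) * (l - Ci) - q)%C).
  set (tm := (RtoC t - Ci)%C) in *. set (tp := (RtoC t + Ci)%C).
  unfold den, kappa, boundary_pt; simpl fst; simpl snd. fold D N M tm tp.
  replace (2 - w * tp / tm * (2 * N / (w * D)))%C with (2 * (tm * D - tp * N) / (tm * D))%C by (field; auto).
  replace (w * tp / tm * (2 * N / (w * D)) - 2 * (w * tp / tm * (w * tp / tm)) * (M / (w * w * D)))%C
    with (2 * tp * (tm * N - tp * M) / (tm * tm * D))%C by (field; auto).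
  rewrite !Csq_div by (repeat apply Cmult_neq_0; trivial).
  rewrite !Csq_mult.
  assert (Em : Csq tm = t * t + 1) by apply Csq_RtoC_minus_Ci.
  assert (Ep : Csq tp = t * t + 1) by apply Csq_RtoC_plus_Ci.
  rewrite Em, Ep.
  assert (Ht : 0 < t * t + 1) by nra.
  apply (Rmult_eq_reg_r ((t * t + 1) * Csq D)); [|nra].
  transitivity (Csq 2 * (Csq (tm * D - tp * N) - Csq (tm * N - tp * M))); [field; split; lra|].
  transitivity (64 * (Im l * ((Re l - t) ^ 2 + Im l ^ 2) - (Im q * (Re l - t) - Re q * Im l)));
    [|field; split; lra].
  unfold D, N, M, tm, tp, kden, Csq, Im, Re; destruct l, q; simpl; ring.
Qed.

(* The numerator of the derivative of [phif h] at x along v, up to the factor 2 h; for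
   v = x - y it is also the numerator of phif h x - phif h y. *)
Definition ncoef (h : C) (x v : C2) : C :=
  (fst v - 2 * h * snd v + h * h * (fst x * snd v - snd x * fst v))%C.

(** [kappa_l] and [kappa_q] are the partial derivatives of [kappa w], and [kappa_v] is its
    differential; [kappa_curve] is the corresponding chain rule. *)
Definition kappa_l (w l q : C) : C2 :=
  ((4 * Ci * ((l + Ci) * (l + Ci) + q) / (w * kden l q * kden l q))%C,
   (4 * Ci * ((l + Ci) * (l - Ci) + q) / (w * w * kden l q * kden l q))%C).

Definition kappa_q (w l q : C) : C2 :=
  ((- 4 * Ci * (l + Ci) / (w * kden l q * kden l q))%C,
   (- 4 * Ci * l / (w * w * kden l q * kden l q))%C).

Definition kappa_v (w l q dl dq : C) : C2 :=
  ((dl * fst (kappa_l w l q) + dq * fst (kappa_q w l q))%C,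
   (dl * snd (kappa_l w l q) + dq * snd (kappa_q w l q))%C).

(** At w this is the difference of the means l; at [boundary_pt w t] it is the numerator of the
    difference of the values of l - t - q / (l - t). The terms are arranged so that replacing l1 -
    l2 and q1 - q2 by dl and dq gives the infinitesimal formula. *)
Lemma ncoef_discrete w l1 q1 l2 q2 : Csq w = 1 -> region l1 q1 -> region l2 q2 ->
  let v : C2 := ((fst (kappa w l1 q1) - fst (kappa w l2 q2))%C, (snd (kappa w l1 q1) - snd (kappa w l2 q2))%C) in
  ncoef w (kappa w l1 q1) v = (16 * Ci * Ci * Ci * (l1 - l2) / (w * kden l1 q1 * kden l2 q2))%C /\
  forall t : R, ncoef (boundary_pt w t) (kappa w l1 q1) v =
    (16 * Ci * Ci * Ci * ((l1 - l2) * (l1 - t) * (l2 - t) - (q1 - q2) * (l2 - t) + q2 * (l1 - l2)) /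
     (w * (t - Ci) * (t - Ci) * kden l1 q1 * kden l2 q2))%C.
Proof.
  intros Hw H1 H2. assert (Hw0 := unimodular_ne_0 w Hw).
  assert (N1 := kden_ne_0 _ _ H1). assert (N2 := kden_ne_0 _ _ H2).
  unfold ncoef, kappa, boundary_pt; simpl fst; simpl snd. unfold kden in *.
  split; [field; auto|]. intros t. assert (Nt := RtoC_minus_Ci_ne_0 t). field; auto.
Qed.

Lemma ncoef_infinitesimal w l q dl dq : Csq w = 1 -> region l q ->
  ncoef w (kappa w l q) (kappa_v w l q dl dq) = (16 * Ci * Ci * Ci * dl / (w * kden l q * kden l q))%C /\
  forall t : R, ncoef (boundary_pt w t) (kappa w l q) (kappa_v w l q dl dq) =
    (16 * Ci * Ci * Ci * (dl * (l - t) * (l - t) - dq * (l - t) + q * dl) /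
     (w * (t - Ci) * (t - Ci) * kden l q * kden l q))%C.
Proof.
  intros Hw H. assert (Hw0 := unimodular_ne_0 w Hw). assert (N1 := kden_ne_0 _ _ H).
  unfold ncoef, kappa_v, kappa_l, kappa_q, kappa, boundary_pt; simpl fst; simpl snd. unfold kden in *.
  split; [field; auto|]. intros t. assert (Nt := RtoC_minus_Ci_ne_0 t). field; auto.
Qed.

(** As a polynomial of degree at most 2 in h, [ncoef] has zero coefficients once it vanishes at the
    three points 1, -1 and i. *)
Lemma ncoef_vanish x v : (forall h, Csq h = 1 -> ncoef h x v = 0) -> (fst v : C) = 0 /\ (snd v : C) = 0.
Proof.
  intros H.
  assert (H1 := H (RtoC 1) ltac:(unfold Csq; simpl; ring)).
  assert (H2 := H (RtoC (-1)) ltac:(unfold Csq; simpl; ring)).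
  assert (H3 := H Ci ltac:(unfold Csq; simpl; ring)).
  unfold ncoef in *. destruct x as [s p], v as [a b]. simpl fst in *; simpl snd in *.
  set (X := (s * b - p * a)%C) in *. clearbody X.
  destruct a as [a1 a2], b as [b1 b2], X as [X1 X2].
  apply pair_equal_spec in H1, H2, H3. simpl in H1, H2, H3.
  split; apply pair_equal_spec; split; lra.
Qed.

Lemma kappa_v_surjective w l q (v1 v2 : C) : Csq w = 1 -> region l q ->
  exists dl dq, ((v1, v2) : C2) = kappa_v w l q dl dq.
Proof.
  intros Hw H. assert (Hw0 := unimodular_ne_0 w Hw). assert (N1 := kden_ne_0 _ _ H).
  assert (NC := Ci_ne_0). assert (N4 : RtoC 4 <> 0) by (apply RtoC_ne_0; lra).
  (* The Jacobian determinant of [kappa w]; the witnesses come from Cramer's rule. *)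
  set (d := (- 16 * Ci * Ci * Ci / (w * w * w * kden l q * kden l q * kden l q))%C).
  assert (N16 : (- RtoC 16)%C <> 0).
  { intros E; apply (f_equal fst) in E; simpl in E; lra. }
  exists ((v1 * snd (kappa_q w l q) - v2 * fst (kappa_q w l q)) / d)%C,
    ((fst (kappa_l w l q) * v2 - snd (kappa_l w l q) * v1) / d)%C.
  assert (Hd : d <> 0).
  { intros E. assert (NK : (- RtoC 16 * Ci * Ci * Ci)%C <> 0) by (repeat apply Cmult_neq_0; trivial).
    apply NK. transitivity (d * (w * w * w * kden l q * kden l q * kden l q))%C; [unfold d; field; auto|].
    rewrite E; ring. }
  assert (Ed : (fst (kappa_l w l q) * snd (kappa_q w l q) - fst (kappa_q w l q) * snd (kappa_l w l q))%C = d).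
  { unfold d, kappa_l, kappa_q; simpl fst; simpl snd. unfold kden in *. field. auto. }
  unfold kappa_v.
  set (a := fst (kappa_l w l q)) in *. set (b := snd (kappa_l w l q)) in *.
  set (c := fst (kappa_q w l q)) in *. set (e := snd (kappa_q w l q)) in *.
  clearbody a b c e d. subst d.
  f_equal; field; trivial.
Qed.

(** * Existence of a maximizing member of the family *)

Lemma unit_circle_angle h : Csq h = 1 -> exists t, 0 <= t <= 2 * PI /\ h = cis 1 t.
Proof.
  destruct h as [x y]; unfold Csq, cis; simpl; intros H.
  assert (HPI := PI_RGT_0).
  assert (Hx : -1 <= x <= 1) by nra.
  assert (B := acos_bound x).
  assert (S : sin (acos x) = Rabs y).
  { rewrite sin_acos by trivial. replace (1 - x²) with (Rsqr y) by (unfold Rsqr; lra). apply sqrt_Rsqr_abs. }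
  destruct (Rle_dec 0 y) as [L|L].
  - exists (acos x); split; [lra|]. rewrite cos_acos, S, Rabs_pos_eq, !Rmult_1_l by trivial. reflexivity.
  - exists (2 * PI - acos x); split; [lra|].
    rewrite cos_minus, sin_minus, cos_2PI, sin_2PI, cos_acos, S, Rabs_left by (trivial; lra).
    f_equal; ring.
Qed.

Definition ccont (f : R -> C) (t : R) : Prop :=
  continuity_pt (fun t => fst (f t)) t /\ continuity_pt (fun t => snd (f t)) t.

Lemma ccont_const c t : ccont (fun _ => c) t.
Proof. split; apply continuity_pt_const; now intros ? ?. Qed.

Lemma ccont_plus f g t : ccont f t -> ccont g t -> ccont (fun t => f t + g t)%C t.
Proof.
  intros [F1 F2] [G1 G2]; split; simpl;
    [exact (continuity_pt_plus _ _ _ F1 G1)|exact (continuity_pt_plus _ _ _ F2 G2)].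
Qed.

Lemma ccont_minus f g t : ccont f t -> ccont g t -> ccont (fun t => f t - g t)%C t.
Proof.
  intros [F1 F2] [G1 G2]; split; simpl;
    [exact (continuity_pt_minus _ _ _ F1 G1)|exact (continuity_pt_minus _ _ _ F2 G2)].
Qed.

Lemma ccont_mult f g t : ccont f t -> ccont g t -> ccont (fun t => f t * g t)%C t.
Proof.
  intros [F1 F2] [G1 G2]; split; simpl.
  - apply (continuity_pt_minus _ _ _ (continuity_pt_mult _ _ _ F1 G1) (continuity_pt_mult _ _ _ F2 G2)).
  - apply (continuity_pt_plus _ _ _ (continuity_pt_mult _ _ _ F1 G2) (continuity_pt_mult _ _ _ F2 G1)).
Qed.

Lemma ccont_cis t : ccont (cis 1) t.
Proof.
  split; simpl.
  - apply (continuity_pt_mult (fun _ => 1) cos); [apply continuity_pt_const; now intros ? ?|apply continuity_cos].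
  - apply (continuity_pt_mult (fun _ => 1) sin); [apply continuity_pt_const; now intros ? ?|apply continuity_sin].
Qed.

Lemma continuity_Csq f t : ccont f t -> continuity_pt (fun t => Csq (f t)) t.
Proof.
  intros [F1 F2].
  apply (continuity_pt_plus _ _ _ (continuity_pt_mult _ _ _ F1 F1) (continuity_pt_mult _ _ _ F2 F2)).
Qed.

Lemma Csq_cis t : Csq (cis 1 t) = 1.
Proof. unfold Csq, cis; simpl. assert (H := sin2_cos2 t); unfold Rsqr in H. lra. Qed.

Lemma continuity_den (x : C2) t : continuity_pt (fun t => den (cis 1 t) x) t.
Proof.
  unfold den. apply continuity_pt_minus; apply continuity_Csq;
    repeat (apply ccont_minus || apply ccont_mult || apply ccont_cis || apply ccont_const).
Qed.

(** Up to a factor 4, Csq (ncoef h x1 v) / (den h x1 * den h x2) is the squared length of the image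
    of an infinitesimal datum if x1 = x2, and p^2 / (1 - p^2) for the pseudohyperbolic distance p of
    the images if v = x1 - x2. Both increase with the length of the datum, so w maximizes that
    length. The quotient attains its maximum by compactness of the circle. *)
Lemma ncoef_maximizer (x1 x2 v : C2) : sym_bidisc x1 -> sym_bidisc x2 ->
  exists w, Csq w = 1 /\ forall h, Csq h = 1 ->
    Csq (ncoef h x1 v) * (den w x1 * den w x2) <= Csq (ncoef w x1 v) * (den h x1 * den h x2).
Proof.
  intros H1 H2. assert (HPI := PI_RGT_0).
  assert (Hden : forall h, Csq h = 1 -> 0 < den h x1 * den h x2).
  { intros h Hh; apply Rmult_lt_0_compat; now apply den_pos. }
  destruct (continuity_ab_maj (fun t => Csq (ncoef (cis 1 t) x1 v) / (den (cis 1 t) x1 * den (cis 1 t) x2)) 0 (2 * PI))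
    as [t0 [Ht0 _]]; [lra| |].
  - intros t _. apply (continuity_pt_div (fun t => Csq (ncoef (cis 1 t) x1 v)) (fun t => den (cis 1 t) x1 * den (cis 1 t) x2)).
    + apply continuity_Csq. unfold ncoef.
      repeat (apply ccont_minus || apply ccont_plus || apply ccont_mult || apply ccont_cis || apply ccont_const).
    + apply continuity_pt_mult; apply continuity_den.
    + assert (P := Hden _ (Csq_cis t)); lra.
  - exists (cis 1 t0); split; [apply Csq_cis|]. intros h Hh.
    destruct (unit_circle_angle h Hh) as [t [Ht ->]]. specialize (Ht0 t Ht). cbv beta in Ht0.
    assert (P := Hden _ (Csq_cis t)). assert (P0 := Hden _ (Csq_cis t0)).
    set (A := den (cis 1 t) x1 * den (cis 1 t) x2) in *. set (B := den (cis 1 t0) x1 * den (cis 1 t0) x2) in *.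
    apply (Rmult_le_compat_r (A * B)) in Ht0; [|apply Rlt_le, Rmult_lt_0_compat; trivial].
    replace (Csq (ncoef (cis 1 t) x1 v) / A * (A * B)) with (Csq (ncoef (cis 1 t) x1 v) * B) in Ht0 by (field; lra).
    replace (Csq (ncoef (cis 1 t0) x1 v) / B * (A * B)) with (Csq (ncoef (cis 1 t0) x1 v) * A) in Ht0 by (field; lra).
    exact Ht0.
Qed.

(** * Analytic discs given by real quadratics *)

Definition quad (a b c : R) (l : C) : C := (RtoC a * (l * l) + RtoC b * l + RtoC c)%C.

(** The last clause excludes only q = (l - t)^2 with t real, for which one of the roots l + sqrt q,
    l - sqrt q is the boundary point t. *)
Definition admissible (a b c : R) : Prop :=
  0 <= a <= 1 /\ (forall t, 0 <= a * t ^ 2 + b * t + c) /\ (a < 1 \/ b * b < 4 * a * c).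

Lemma region_quad a b c l : admissible a b c -> 0 < Im l -> region l (quad a b c l).
Proof.
  intros [Ha [Hd Hs]] Hl. split; [exact Hl|].
  destruct l as [x y]. unfold quad, Im, Re in *; simpl in *.
  replace (a * (x * y + y * x) + 0 * (x * x - y * y) + (b * y + 0 * x) + 0) with ((2 * a * x + b) * y) by ring.
  replace (a * (x * x - y * y) - 0 * (x * y + y * x) + (b * x - 0 * y) + c) with (a * (x * x - y * y) + b * x + c) by ring.
  assert (Hq : 0 <= a * x * x + b * x + c) by (specialize (Hd x); lra).
  assert (Hy2 : 0 < y * y) by nra.
  assert (K : (2 * a * x + b) * (2 * a * x + b) < 4 * (y * y + (a * (x * x - y * y) + b * x + c))).
  { assert (Hdis := quadratic_discriminant a b c Hd).
    apply Rminus_lt_0.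
    (* Divided by y^2, the inequality of [region] becomes the positivity of a sum of three
       nonnegative terms; the last clause of admissibility makes one of them positive. *)
    replace (4 * (y * y + (a * (x * x - y * y) + b * x + c)) - (2 * a * x + b) * (2 * a * x + b))
      with (4 * ((1 - a) * (a * x * x + b * x + c)) + 4 * ((1 - a) * (y * y)) + (4 * a * c - b * b)) by ring.
    assert (0 <= (1 - a) * (a * x * x + b * x + c)) by (apply Rmult_le_pos; lra).
    assert (0 <= (1 - a) * (y * y)) by (apply Rmult_le_pos; lra).
    destruct Hs as [L|L]; [|lra].
    assert (0 < (1 - a) * (y * y)) by (apply Rmult_lt_0_compat; lra). lra. }
  replace ((2 * a * x + b) * y * ((2 * a * x + b) * y)) with ((y * y) * ((2 * a * x + b) * (2 * a * x + b))) by ring.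
  replace (4 * (y * y) * (y * y + (a * (x * x - y * y) + b * x + c))) with
    ((y * y) * (4 * (y * y + (a * (x * x - y * y) + b * x + c)))) by ring.
  now apply Rmult_lt_compat_l.
Qed.

Lemma cdiff_quad a b c l : cdiff (quad a b c) l (RtoC a * (l + l) + RtoC b)%C.
Proof.
  eapply cdiff_eq.
  - unfold quad. apply cdiff_plus; [|apply cdiff_const]. apply cdiff_plus.
    + apply cdiff_mult; [apply cdiff_const|]. apply cdiff_mult; apply cdiff_id.
    + apply cdiff_mult; [apply cdiff_const|apply cdiff_id].
  - cbv beta. ring.
Qed.

(* [dl] and [dq] are the differences of the data, or their derivatives when the two points
   coincide; this covers discrete and infinitesimal data at once. *)
Lemma maximizer_disc w l1 q1 l2 q2 dl dq (v : C2) :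
  Csq w = 1 -> region l1 q1 -> region l2 q2 -> ((q1 - q2) * dl)%C = (dq * (l1 - l2))%C ->
  ~ ((fst v : C) = 0 /\ (snd v : C) = 0) ->
  ncoef w (kappa w l1 q1) v = (16 * Ci * Ci * Ci * dl / (w * kden l1 q1 * kden l2 q2))%C ->
  (forall t : R, ncoef (boundary_pt w t) (kappa w l1 q1) v =
    (16 * Ci * Ci * Ci * (dl * (l1 - t) * (l2 - t) - dq * (l2 - t) + q2 * dl) /
     (w * (t - Ci) * (t - Ci) * kden l1 q1 * kden l2 q2))%C) ->
  (forall h, Csq h = 1 ->
    Csq (ncoef h (kappa w l1 q1) v) * (den w (kappa w l1 q1) * den w (kappa w l2 q2)) <=
    Csq (ncoef w (kappa w l1 q1) v) * (den h (kappa w l1 q1) * den h (kappa w l2 q2))) ->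
  dl <> 0 /\ exists a b c, admissible a b c /\ q1 = quad a b c l1 /\ q2 = quad a b c l2 /\
    dq = (dl * (RtoC a * (l1 + l2) + RtoC b))%C.
Proof.
  intros Hw R1 R2 Hdq Hv Nw Nt Hmax.
  assert (Hw0 := unimodular_ne_0 w Hw).
  assert (K1 := kden_ne_0 _ _ R1). assert (K2 := kden_ne_0 _ _ R2).
  assert (P1 := Csq_pos _ K1). assert (P2 := Csq_pos _ K2).
  assert (G1 := sym_bidisc_kappa w _ _ Hw R1). assert (G2 := sym_bidisc_kappa w _ _ Hw R2).
  (* If dl = 0, the maximal value is 0, so [ncoef] vanishes on the whole circle and v = 0. *)
  assert (Hdl : dl <> 0).
  { intros E. apply Hv, (ncoef_vanish (kappa w l1 q1)). intros h Hh.
    specialize (Hmax h Hh). rewrite Nw, E in Hmax.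
    replace (16 * Ci * Ci * Ci * 0 / (w * kden l1 q1 * kden l2 q2))%C with (RtoC 0) in Hmax by (field; auto).
    replace (Csq 0) with 0 in Hmax by (unfold Csq; simpl; ring). rewrite Rmult_0_l in Hmax.
    assert (D1 := den_pos w _ Hw G1). assert (D2 := den_pos w _ Hw G2).
    apply Csq_eq_0, Rle_antisym; [|apply Csq_ge_0].
    apply (Rmult_le_reg_r (den w (kappa w l1 q1) * den w (kappa w l2 q2))); [now apply Rmult_lt_0_compat|lra]. }
  split; [exact Hdl|].
  assert (Pdl := Csq_pos _ Hdl).
  assert (C16 : Csq (16 * Ci * Ci * Ci) = 256) by (unfold Csq; simpl; ring).
  set (A := (dq / dl)%C).
  assert (EA : dq = (A * dl)%C) by (unfold A; field; trivial).
  assert (EqA : (q1 - q2)%C = (A * (l1 - l2))%C).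
  { transitivity ((q1 - q2) * dl / dl)%C; [field; trivial|]. rewrite Hdq, EA. field; trivial. }
  (* Maximality of w tested against [boundary_pt w t], freed of the positive factor k that both
     sides share. *)
  assert (H : forall t : R,
    Csq ((l1 - t) * (l2 - t) - A * (l2 - t) + q2) * (Im l1 * Im l2) <=
    (Im l1 * ((Re l1 - t) ^ 2 + Im l1 ^ 2) - (Im q1 * (Re l1 - t) - Re q1 * Im l1)) *
    (Im l2 * ((Re l2 - t) ^ 2 + Im l2 ^ 2) - (Im q2 * (Re l2 - t) - Re q2 * Im l2))).
  { intros t. assert (Ht := Hmax _ (Csq_boundary_pt w t Hw)).
    assert (Mt := RtoC_minus_Ci_ne_0 t).
    rewrite Nw, Nt, !den_kappa, !den_kappa_boundary in Ht by trivial.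
    rewrite EA in Ht.
    replace (dl * (l1 - t) * (l2 - t) - A * dl * (l2 - t) + q2 * dl)%C
      with (dl * ((l1 - t) * (l2 - t) - A * (l2 - t) + q2))%C in Ht by ring.
    rewrite !Csq_div in Ht by (repeat apply Cmult_neq_0; trivial).
    rewrite !(Csq_mult (16 * Ci * Ci * Ci)), C16, !Csq_mult, Hw, Csq_RtoC_minus_Ci in Ht.
    set (B := Csq ((l1 - t) * (l2 - t) - A * (l2 - t) + q2)) in *.
    set (N1 := Im l1 * ((Re l1 - t) ^ 2 + Im l1 ^ 2) - (Im q1 * (Re l1 - t) - Re q1 * Im l1)) in *.
    set (N2 := Im l2 * ((Re l2 - t) ^ 2 + Im l2 ^ 2) - (Im q2 * (Re l2 - t) - Re q2 * Im l2)) in *.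
    assert (Ht0 : 0 < t * t + 1) by nra.
    set (T := t * t + 1) in *. set (D1 := Csq (kden l1 q1)) in *. set (D2 := Csq (kden l2 q2)) in *.
    set (k := 256 * Csq dl * 64 * 64 / (T * T * (D1 * D1) * (D2 * D2))).
    assert (Hk : 0 < k).
    { unfold k. apply Rdiv_lt_0_compat; [lra|]. repeat apply Rmult_lt_0_compat; trivial. }
    apply (Rmult_le_reg_l k); [exact Hk|].
    replace (k * (B * (Im l1 * Im l2))) with
      (256 * (Csq dl * B) / (1 * T * T * D1 * D2) * (64 * Im l1 / D1 * (64 * Im l2 / D2)))
      by (unfold k; field; repeat split; lra).
    replace (k * (N1 * N2)) with
      (256 * Csq dl / (1 * D1 * D2) * (64 * N1 / (T * D1) * (64 * N2 / (T * D2))))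
      by (unfold k; field; repeat split; lra).
    exact Ht. }
  destruct R1 as [Y1 E1]. destruct R2 as [Y2 E2]. clear Nw Nt Hmax G1 G2 K1 K2 P1 P2 Hdq.
  clearbody A. subst dq.
  destruct l1 as [x1 y1], q1 as [u1 w1], l2 as [x2 y2], q2 as [u2 w2], A as [Ar Ai].
  unfold Im, Re in *; simpl in Y1, Y2, E1, E2.
  apply pair_equal_spec in EqA; simpl in EqA. destruct EqA as [Eu Ew].
  destruct (extremal_quadratic x1 y1 u1 w1 x2 y2 u2 w2 Ar Ai) as [a [b [c [Q1 [Q2 [Q3 [Q4 [Q5 [Q6 [Q7 [Q8 Q9]]]]]]]]]]];
    trivial; try lra.
  - intros t. specialize (H t). unfold Csq in H; simpl in H.
    eapply Rle_trans; [|eapply Rle_trans; [exact H|]]; apply Req_le; ring.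
  - exists a, b, c. split; [now repeat split; try apply Q1|].
    unfold quad, Cmult, Cplus, RtoC; simpl.
    split; [apply pair_equal_spec; split; lra|]. split; [apply pair_equal_spec; split; lra|].
    destruct dl as [d1 d2]; simpl. apply pair_equal_spec; rewrite Q8, Q9; split; ring.
Qed.

(** At a root with |Z| >= 1 the product (Z - z) (Z - w) has modulus at least (1 - r)^2 |Z|^2,
    whereas the change of coefficients accounts for less than 2 del |Z|. This stability of the roots
    makes the symmetrized bidisc open. *)
Lemma root_stays_in_disc (z w s p Z : C) r del : Cmod z <= r -> Cmod w <= r -> r < 1 ->
  Cmod (s - (z + w)) < del -> Cmod (p - z * w) < del -> 2 * del <= (1 - r) ^ 2 ->
  (Z * Z - s * Z + p)%C = 0 -> Cmod Z < 1.
Proof.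
  intros Hz Hw Hr Hs Hp Hdel HZ.
  destruct (Rlt_le_dec (Cmod Z) 1) as [L|L]; [exact L|exfalso].
  assert (E : ((Z - z) * (Z - w))%C = ((s - (z + w)) * Z - (p - z * w))%C).
  { transitivity ((Z * Z - s * Z + p) + ((s - (z + w)) * Z - (p - z * w)))%C; [ring|rewrite HZ; ring]. }
  assert (T1 := Cmod_triangle (Z - z) z). assert (T2 := Cmod_triangle (Z - w) w).
  replace (Z - z + z)%C with Z in T1 by ring. replace (Z - w + w)%C with Z in T2 by ring.
  assert (T3 := Cmod_triangle ((s - (z + w)) * Z) (- (p - z * w))).
  rewrite Cmod_opp in T3.
  replace ((s - (z + w)) * Z + - (p - z * w))%C with ((Z - z) * (Z - w))%C in T3 by (rewrite E; ring).
  rewrite !Cmod_mult in T3.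
  assert (P1 := Cmod_ge_0 z). assert (P2 := Cmod_ge_0 (s - (z + w))). 
  set (m := Cmod Z) in *.
  assert (B : (m - r) * (m - r) <= Cmod (Z - z) * Cmod (Z - w)) by (apply Rmult_le_compat; lra).
  assert (B2 : (1 - r) * m <= m - r) by nra.
  assert (B3 : ((1 - r) * m) * ((1 - r) * m) <= (m - r) * (m - r)) by (apply Rmult_le_compat; nra).
  assert (B4 : Cmod (s - (z + w)) * m < del * m) by (apply Rmult_lt_compat_r; lra).
  assert (Hm : m <= m * m) by nra.
  nra.
Qed.

Lemma open_sym_bidisc (x : C2) : sym_bidisc x -> locally x sym_bidisc.
Proof.
  intros [z [w [Hz [Hw ->]]]]. apply norm_locally.
  set (r := Rmax (Cmod z) (Cmod w)).
  assert (Hr : r < 1) by (now apply Rmax_lub_lt).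
  assert (Hd : 0 < (1 - r) ^ 2) by (apply pow_lt; lra).
  exists ((1 - r) ^ 2 / 2); split; [lra|].
  intros y Hy.
  assert (L1 := Rle_lt_trans _ _ _ (norm_fst_le _) Hy). assert (L2 := Rle_lt_trans _ _ _ (norm_snd_le _) Hy).
  destruct y as [s p].
  change (Cmod (s - (z + w))%C < (1 - r) ^ 2 / 2) in L1. change (Cmod (p - z * w)%C < (1 - r) ^ 2 / 2) in L2.
  change C in (type of s); change C in (type of p).
  destruct (Csqrt_exists (s / 2 * (s / 2) - p)%C) as [q Hq].
  assert (N2 : RtoC 2 <> 0) by (apply RtoC_ne_0; lra).
  assert (Ep : (p : C) = (s / 2 * (s / 2) - q * q)%C) by (rewrite <- Hq; ring).
  assert (Hroot : forall Z : C, (Z * Z - s * Z + p)%C = 0 -> Cmod Z < 1).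
  { intros Z HZ. apply (root_stays_in_disc z w s p Z r ((1 - r) ^ 2 / 2)); trivial; [apply Rmax_l|apply Rmax_r|lra]. }
  exists (s / 2 + q)%C, (s / 2 - q)%C.
  split; [|split].
  - apply Hroot. rewrite Ep. field; trivial.
  - apply Hroot. rewrite Ep. field; trivial.
  - apply (f_equal2 (fun a b : C => (a, b))); [field; trivial|rewrite Ep; field; trivial].
Qed.

Lemma vdiff_phif w (x : C2) : Csq w = 1 -> sym_bidisc x ->
  vdiff (V := C2) (phif w) x (fun v => 2 * w * ncoef w x v / ((2 - w * fst x) * (2 - w * fst x)))%C.
Proof.
  intros Hw Hx. assert (N := phif_den_ne_0 w x Hw Hx).
  assert (M : forall c f l, vdiff (V := C2) f x l -> vdiff (V := C2) (fun y => c * f y)%C x (fun v => c * l v)%C).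
  { intros c f l Hf. eapply vdiff_ext; [apply vdiff_mult; [apply vdiff_const|exact Hf]|].
    intros v; cbv beta; ring. }
  assert (D1 := M w fst _ (vdiff_fst x)). assert (D2 := M (2 * (w * w))%C snd _ (vdiff_snd x)).
  assert (Dn := vdiff_plus _ _ _ _ _ D1 (vdiff_opp _ _ _ D2)).
  assert (Dd := vdiff_plus _ _ _ _ _ (vdiff_const (V := C2) (RtoC 2) x) (vdiff_opp _ _ _ D1)).
  eapply vdiff_ext; [exact (vdiff_div _ _ _ _ _ Dn Dd N)|].
  intros v; cbv beta. unfold ncoef. field. exact N.
Qed.

Definition unimodular : Type := {w : C | Csq w = 1}.

Definition phi (i : unimodular) : pts sym_bidisc -> pts unit_disc :=
  to_disc (fun x : pts sym_bidisc => phif (proj1_sig i) (proj1_sig x))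
    (fun x => phif_disc _ _ (proj2_sig i) (proj2_sig x)).

Lemma ext_phi i x : sym_bidisc x -> ext (phi i) x = phif (proj1_sig i) x.
Proof. intros h. now rewrite (ext_in _ x h). Qed.

Lemma holomorphic_phi i : holomorphic (phi i).
Proof.
  apply (holomorphic_formula _ (phif (proj1_sig i))); [apply open_sym_bidisc|apply ext_phi|].
  intros s Hs. eexists; apply vdiff_phif; [apply (proj2_sig i)|exact Hs].
Qed.

Lemma dir_deriv_phi i x v : sym_bidisc x -> dir_deriv (phi i) x v =
  (2 * proj1_sig i * ncoef (proj1_sig i) x v / ((2 - proj1_sig i * fst x) * (2 - proj1_sig i * fst x)))%C.
Proof.
  intros Hx.
  exact (dir_deriv_formula _ _ x _ open_sym_bidisc (ext_phi i) (holomorphic_phi i) Hx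
    (vdiff_phif _ x (proj2_sig i) Hx) v).
Qed.

Lemma kappa_curve w (f : C -> C) l f' : Csq w = 1 -> region l (f l) -> cdiff f l f' ->
  filterdiff (K := C_AbsRing) (U := C_NormedModule) (V := C2) (fun l => kappa w l (f l)) (locally l)
    (fun h : C => scal (V := C2) h (kappa_v w l (f l) 1 f')).
Proof.
  intros Hw H Hf. assert (Hw0 := unimodular_ne_0 w Hw). assert (N1 := kden_ne_0 _ _ H).
  assert (Dp : cdiff (fun l => l + Ci)%C l 1).
  { eapply cdiff_eq; [apply cdiff_plus; [apply cdiff_id|apply cdiff_const]|ring]. }
  assert (Dm : cdiff (fun l => l - Ci)%C l 1).
  { eapply cdiff_eq; [apply cdiff_minus; [apply cdiff_id|apply cdiff_const]|ring]. }
  assert (Dden := cdiff_minus _ _ _ _ _ (cdiff_mult _ _ _ _ _ Dp Dp) Hf).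
  assert (Dn1 := cdiff_mult _ _ _ _ _ (cdiff_const 2 l) (cdiff_minus _ _ _ _ _ (cdiff_mult _ _ _ _ _ Dp Dm) Hf)).
  assert (Dn2 := cdiff_minus _ _ _ _ _ (cdiff_mult _ _ _ _ _ Dm Dm) Hf).
  assert (Q1 := cdiff_div _ _ _ _ _ Dn1 (cdiff_mult _ _ _ _ _ (cdiff_const w l) Dden)
    ltac:(apply Cmult_neq_0; [exact Hw0|exact N1])).
  assert (Q2 := cdiff_div _ _ _ _ _ Dn2 (cdiff_mult _ _ _ _ _ (cdiff_const (w * w) l) Dden)
    ltac:(apply Cmult_neq_0; [now apply Cmult_neq_0|exact N1])).
  cbv beta in Q1, Q2. unfold kden in N1.
  unfold kappa_v, kappa_l, kappa_q; simpl fst; simpl snd.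
  refine (filterdiff_pair _ _ _ _ _ (cdiff_eq _ _ _ _ Q1 _) (cdiff_eq _ _ _ _ Q2 _)).
  - unfold kden. field. auto.
  - unfold kden. field. auto.
Qed.

Lemma kappa_v_plus w l q dl dq :
  kappa_v w l q dl dq = plus (scal (V := C2) dl (kappa_l w l q)) (scal (V := C2) dq (kappa_q w l q)).
Proof. reflexivity. Qed.

Section Curve.

Variable F : pts sym_bidisc -> pts unit_disc.
Hypothesis HF : holomorphic F.
Variable w : C.
Hypothesis Hw : Csq w = 1.

Lemma dir_deriv_kappa_v l q dl dq : region l q -> dir_deriv F (kappa w l q) (kappa_v w l q dl dq) =
  (dl * dir_deriv F (kappa w l q) (kappa_l w l q) + dq * dir_deriv F (kappa w l q) (kappa_q w l q))%C.
Proof.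
  intros H. destruct (dir_deriv_linear F _ HF (sym_bidisc_kappa w l q Hw H)) as [L1 L2].
  now rewrite kappa_v_plus, L1, !L2.
Qed.

Lemma cdiff_F_curve f l f' : region l (f l) -> cdiff f l f' ->
  cdiff (fun l => ext F (kappa w l (f l))) l (dir_deriv F (kappa w l (f l)) (kappa_v w l (f l) 1 f')).
Proof.
  intros H Hf. apply (cdiff_ext_curve F (fun l => kappa w l (f l)) l _ HF).
  - now apply sym_bidisc_kappa.
  - now apply kappa_curve.
Qed.

Lemma maps_halfplane_curve a b c : admissible a b c ->
  maps_halfplane (fun l => ext F (kappa w l (quad a b c l))).
Proof.
  intros Ha l Hl. assert (R := region_quad a b c l Ha Hl). split.
  - apply ext_disc. now apply sym_bidisc_kappa.
  - eexists; apply cdiff_F_curve; [exact R|apply cdiff_quad].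
Qed.

End Curve.

Lemma extremal_cayley l d : 0 < Im l -> cdiff cayley l d -> Cmod d * (2 * Im l) = 1 - Csq (cayley l).
Proof.
  intros Hl Hd. rewrite (cdiff_unique _ _ _ _ Hd (cdiff_cayley l Hl)).
  assert (N := plus_Ci_ne_0 l Hl). assert (P := Csq_pos _ N).
  rewrite (one_minus_Csq_cayley l Hl), Cmod_div, !Cmod_mult, Cmod_sq, Cmod_Ci, Cmod_R, Rabs_pos_eq
    by (lra || now apply Cmult_neq_0).
  field. lra.
Qed.

(** Along any disc l |-> kappa w l (f l) the map [phi] is the Cayley transform of l, whose
    derivative attains equality in Schwarz-Pick. *)
Lemma phi_curve_derivative (i : unimodular) l q dq : region l q ->
  forall f, f l = q -> cdiff f l dq -> (forall l', 0 < Im l' -> region l' (f l')) ->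
  Cmod (dir_deriv (phi i) (kappa (proj1_sig i) l q) (kappa_v (proj1_sig i) l q 1 dq)) * (2 * Im l) =
  1 - Csq (cayley l).
Proof.
  intros R f <- Hf Hreg. destruct i as [w Hw]. set (i := exist _ w Hw : unimodular).
  apply extremal_cayley; [apply R|].
  apply (cdiff_locally (fun l => ext (phi i) (kappa w l (f l))) _ _ _ (Im l)); [apply R| |].
  - intros l' Hl'. apply halfplane_radius in Hl'. assert (R' := Hreg l' Hl').
    rewrite ext_phi by now apply sym_bidisc_kappa. now apply phif_kappa.
  - apply cdiff_F_curve; trivial. apply holomorphic_phi.
Qed.

Lemma kappa_v_scale w l q dl m :
  kappa_v w l q dl (dl * m) = scal (V := C2) dl (kappa_v w l q 1 m).
Proof.
  unfold kappa_v. transitivity ((dl * (1 * fst (kappa_l w l q) + m * fst (kappa_q w l q)))%C,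
    (dl * (1 * snd (kappa_l w l q) + m * snd (kappa_q w l q)))%C); [|reflexivity].
  apply (f_equal2 (fun a b : C => (a, b))); unfold kappa_l, kappa_q; simpl fst; simpl snd; ring.
Qed.

Lemma phi_universal (d : datum sym_bidisc) : nondegenerate d -> exists i, solves_car (phi i) d.
Proof.
  intros Hd. destruct d as [[x1 h1] [x2 h2]|[x h] v]; simpl in Hd.
  - set (v := ((fst x1 - fst x2)%C, (snd x1 - snd x2)%C) : C2).
    destruct (ncoef_maximizer x1 x2 v h1 h2) as [w [Hw Hmax]].
    destruct (sym_bidisc_chart w x1 Hw h1) as [l1 [q1 [R1 E1]]].
    destruct (sym_bidisc_chart w x2 Hw h2) as [l2 [q2 [R2 E2]]].
    destruct (ncoef_discrete w l1 q1 l2 q2 Hw R1 R2) as [Nw Nt].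
    rewrite <- E1, <- E2 in Nw, Nt.
    destruct (maximizer_disc w l1 q1 l2 q2 (l1 - l2) (q1 - q2) v Hw R1 R2) as [Hdl [a [b [c [Ha [Q1 [Q2 _]]]]]]].
    + ring.
    + intros [V1 V2]. apply Hd. apply eq_sig_hprop; [intros; apply proof_irrelevance|]. simpl.
      destruct x1 as [a1 b1], x2 as [a2 b2]. simpl in V1, V2.
      apply (f_equal2 (fun a b : C => (a, b))).
      * transitivity (a1 - a2 + a2)%C; [exact (eq_sym (Cminus_plus_cancel a1 a2))|rewrite V1; apply Cplus_0_l].
      * transitivity (b1 - b2 + b2)%C; [exact (eq_sym (Cminus_plus_cancel b1 b2))|rewrite V2; apply Cplus_0_l].
    + rewrite <- E1. exact Nw.
    + rewrite <- E1. exact Nt.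
    + rewrite <- E1, <- E2. exact Hmax.
    + set (i := exist _ w Hw : unimodular). exists i. apply solves_car_iff; split; [apply holomorphic_phi|].
      intros G HG. apply push_le_iff. simpl proj1_sig.
      rewrite (ext_phi i x1 h1), (ext_phi i x2 h2). simpl proj1_sig.
      rewrite E1, E2, !phif_kappa by trivial. rewrite Q1, Q2.
      apply (schwarz_pick_halfplane (fun l => ext G (kappa w l (quad a b c l))));
        [now apply maps_halfplane_curve|apply R1|apply R2].
  - destruct (ncoef_maximizer x x v h h) as [w [Hw Hmax]].
    destruct (sym_bidisc_chart w x Hw h) as [l [q [R E]]].
    destruct (kappa_v_surjective w l q (fst v) (snd v) Hw R) as [dl [dq Ev0]].
    assert (Ev : v = kappa_v w l q dl dq) by (rewrite <- Ev0; now destruct v). clear Ev0.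
    destruct (ncoef_infinitesimal w l q dl dq Hw R) as [Nw Nt].
    destruct (maximizer_disc w l q l q dl dq v Hw R R) as [Hdl [a [b [c [Ha [Q1 [_ Qd]]]]]]].
    + ring.
    + intros [V1 V2]. apply Hd. destruct v as [v1 v2]. simpl in V1, V2. now rewrite V1, V2.
    + rewrite Ev. exact Nw.
    + rewrite Ev. exact Nt.
    + rewrite <- E. exact Hmax.
    + set (i := exist _ w Hw : unimodular). exists i. apply solves_car_iff; split; [apply holomorphic_phi|].
      intros G HG. apply push_le_iff. simpl proj1_sig.
      set (m := (RtoC a * (l + l) + RtoC b)%C) in *.
      assert (Ev' : v = scal (V := C2) dl (kappa_v w l q 1 m)) by (rewrite Ev, Qd; apply kappa_v_scale).
      assert (R0 := R). destruct R0 as [Hl _].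
      assert (SG := schwarz_pick_halfplane_derivative _ l _ (maps_halfplane_curve G HG w Hw a b c Ha) Hl
        (cdiff_F_curve G HG w Hw (quad a b c) l _ (region_quad a b c l Ha Hl) (cdiff_quad a b c l))).
      cbv beta in SG. rewrite <- Q1 in SG. fold m in SG.
      assert (SP := phi_curve_derivative i l q m R (quad a b c) (eq_sym Q1) (cdiff_quad a b c l)
        (fun l' => region_quad a b c l' Ha)).
      simpl proj1_sig in SP.
      rewrite <- E in SG, SP.
      rewrite Ev', !(proj2 (dir_deriv_linear _ _ HG h)), !(proj2 (dir_deriv_linear _ _ (holomorphic_phi i) h)), !Cmod_mult.
      rewrite (ext_phi i x h). simpl proj1_sig.
      assert (EP : phif w x = cayley l) by (rewrite E; now apply phif_kappa).
      rewrite EP.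
      assert (PG := ext_disc G x h). assert (PC := cayley_disc l Hl).
      assert (Pdl := Cmod_ge_0 dl).
      set (X := Cmod (dir_deriv G x (kappa_v w l q 1 m))) in *.
      set (Y := Cmod (dir_deriv (phi i) x (kappa_v w l q 1 m))) in *.
      (* The middle term is the length of (l, dl) in the half-plane: Schwarz-Pick bounds G by it,
         and [phi] attains it. *)
      apply (Rle_trans _ (Cmod dl * / (2 * Im l))).
      * unfold Rdiv. rewrite Rmult_assoc. apply Rmult_le_compat_l; [exact Pdl|].
        apply (Rmult_le_reg_r ((1 - Csq (ext G x)) * (2 * Im l))); [nra|].
        replace (X * / (1 - Csq (ext G x)) * ((1 - Csq (ext G x)) * (2 * Im l))) with (X * (2 * Im l)) by (field; lra).
        replace (/ (2 * Im l) * ((1 - Csq (ext G x)) * (2 * Im l))) with (1 - Csq (ext G x)) by (field; lra).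
        exact SG.
      * apply Req_le. rewrite <- SP. field. split; [lra|].
        assert (0 < Y * (2 * Im l)) by lra. intros Y0. rewrite Y0 in H. lra.
Qed.

(** * Uniqueness of the extremal maps of the symmetrized bidisc *)

Definition definite (a b c : R) : Prop := 0 < a /\ b * b < 4 * a * c.

Lemma definite_pos a b c t : definite a b c -> 0 <= a * t ^ 2 + b * t + c.
Proof.
  intros [Ha Hd]. apply (Rmult_le_reg_l (4 * a)); [lra|].
  assert (P := pow2_ge_0 (2 * a * t + b)).
  replace (4 * a * (a * t ^ 2 + b * t + c)) with ((2 * a * t + b) ^ 2 + (4 * a * c - b * b)) by ring. lra.
Qed.

Lemma admissible_definite a b c : a < 1 -> definite a b c -> admissible a b c.
Proof.
  intros H1 H. split; [destruct H; lra|split; [|now left]]. intros t; now apply definite_pos.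
Qed.

Lemma definite_root a b c : definite a b c -> exists l, 0 < Im l /\ quad a b c l = 0.
Proof.
  intros [Ha Hd]. set (s := sqrt (4 * a * c - b * b)).
  assert (Hs : 0 < s) by (apply sqrt_lt_R0; lra).
  assert (Es : s * s = 4 * a * c - b * b) by (apply sqrt_sqrt; lra).
  exists (- b / (2 * a), s / (2 * a)). split.
  - unfold Im; simpl. apply Rdiv_lt_0_compat; lra.
  - unfold quad, Cplus, Cmult, RtoC; simpl. apply pair_equal_spec; split.
    + transitivity ((4 * a * c - b * b - s * s) / (4 * a)); [field; lra|rewrite Es; field; lra].
    + field. lra.
Qed.

Lemma quad_minus a b c a' b' c' l : quad (a' - a) (b' - b) (c' - c) l = (quad a' b' c' l - quad a b c l)%C.
Proof. unfold quad. rewrite !RtoC_minus. ring. Qed.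

(** The polynomial s (l - z) (l - conj z), z = x + i y, is added. It is real and vanishes at z, so
    the disc keeps its point over z while its direction there changes; strict positivity and a < 1
    survive for small s of either sign. *)
Lemma definite_perturb a b c x y : a < 1 -> definite a b c -> exists eps, 0 < eps /\
  forall s, s = eps \/ s = - eps -> a + s < 1 /\ definite (a + s) (b - 2 * s * x) (c + s * (x * x + y * y)).
Proof.
  intros H1 [Ha Hd].
  set (K := 4 * a * (x * x + y * y) + 4 * c + 4 * b * x).
  set (D := 4 * a * c - b * b).
  assert (HK := Rabs_pos K).
  (* The first two bounds keep a + s between 0 and 1. The third keeps D + s K + 4 s^2 y^2, which is
     4 a c - b^2 for the perturbed quadratic, at least D / 2. *)
  set (e := Rmin (Rmin (a / 2) ((1 - a) / 2)) (D / (2 * (Rabs K + 1)))).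
  assert (He : 0 < e).
  { unfold e. repeat apply Rmin_pos; try lra. apply Rdiv_lt_0_compat; unfold D; lra. }
  assert (He1 : e <= a / 2) by (eapply Rle_trans; [apply Rmin_l|apply Rmin_l]).
  assert (He2 : e <= (1 - a) / 2) by (eapply Rle_trans; [apply Rmin_l|apply Rmin_r]).
  assert (He3 : e * (Rabs K + 1) <= D / 2).
  { assert (H : e <= D / (2 * (Rabs K + 1))) by apply Rmin_r.
    apply (Rmult_le_compat_r (Rabs K + 1)) in H; [|lra].
    replace (D / (2 * (Rabs K + 1)) * (Rabs K + 1)) with (D / 2) in H by (field; lra). exact H. }
  exists e; split; [exact He|]. intros s Hs.
  assert (Hs' : - e <= s <= e) by (destruct Hs; lra).
  assert (HsK : - (D / 2) <= s * K).
  { assert (Rabs (s * K) <= e * Rabs K).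
    { rewrite Rabs_mult. apply Rmult_le_compat_r; [exact HK|]. apply Rabs_le; lra. }
    assert (B := Rle_abs (- (s * K))). rewrite Rabs_Ropp in B. lra. }
  split; [lra|]. split; [lra|].
  assert (Hss : 0 <= 4 * ((s * y) * (s * y))) by nra.
  apply Rminus_lt_0.
  replace (4 * (a + s) * (c + s * (x * x + y * y)) - (b - 2 * s * x) * (b - 2 * s * x))
    with (D + s * K + 4 * ((s * y) * (s * y))) by (unfold D, K; ring).
  unfold D in *; lra.
Qed.

Section Rigidity.

Variable F : pts sym_bidisc -> pts unit_disc.
Hypothesis HF : holomorphic F.
Variable w : C.
Hypothesis Hw : Csq w = 1.
Variable m : pts unit_disc -> pts unit_disc.
Hypothesis Hm : disc_automorphism m.

Let M l := ext m (cayley l).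
Let X l q := dir_deriv F (kappa w l q) (kappa_l w l q).
Let Y l q := dir_deriv F (kappa w l q) (kappa_q w l q).

Definition agrees a b c : Prop := forall l, 0 < Im l -> ext F (kappa w l (quad a b c l)) = M l.

Lemma cdiff_F_quad a b c l : a < 1 -> definite a b c -> 0 < Im l ->
  cdiff (fun l => ext F (kappa w l (quad a b c l))) l
    (X l (quad a b c l) + (RtoC a * (l + l) + RtoC b) * Y l (quad a b c l))%C.
Proof.
  intros H1 H2 Hl. assert (R := region_quad a b c l (admissible_definite a b c H1 H2) Hl).
  eapply cdiff_eq; [exact (cdiff_F_curve F HF w Hw (quad a b c) l _ R (cdiff_quad a b c l))|].
  rewrite (dir_deriv_kappa_v F HF w Hw _ _ _ _ R). unfold X, Y. ring.
Qed.

(* Two discs through the same point with different directions, both competing with the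
   extremal one, force the derivative of F along kappa_q to vanish. *)
Lemma agrees_derivative a b c l : a < 1 -> definite a b c -> agrees a b c -> 0 < Im l ->
  Y l (quad a b c l) = 0 /\ cdiff M l (X l (quad a b c l)).
Proof.
  intros H1 H2 Hag Hl. destruct l as [x y] eqn:El. rewrite <- El in *.
  assert (Ey : Im l = y) by now rewrite El.
  set (q := quad a b c l).
  set (d := (RtoC a * (l + l) + RtoC b)%C).
  assert (D0 : cdiff M l (X l q + d * Y l q)%C).
  { apply (cdiff_locally (fun l => ext F (kappa w l (quad a b c l))) _ _ _ (Im l)); [exact Hl| |].
    - intros l' Hl'. apply Hag. exact (halfplane_radius l l' Hl').
    - now apply cdiff_F_quad. }
  assert (Hex := cayley_automorphism_extremal m l _ Hm Hl D0).
  destruct (definite_perturb a b c x y H1 H2) as [eps [Heps Hp]].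
  assert (Hs : forall s, s = eps \/ s = - eps ->
    Csq (X l q + d * Y l q + RtoC s * (2 * Ci * RtoC y * Y l q)) <= Csq (X l q + d * Y l q)).
  { intros s Hs. destruct (Hp s Hs) as [P1 P2].
    set (a' := a + s) in *. set (b' := b - 2 * s * x) in *. set (c' := c + s * (x * x + y * y)) in *.
    assert (Eq : quad a' b' c' l = q).
    { unfold q, quad, a', b', c'. rewrite El. unfold Cplus, Cmult, RtoC; simpl. f_equal; ring. }
    (* At l = x + i y the added polynomial has derivative 2 i y s, which is how much the direction
       of the disc changes. *)
    assert (Ed : (RtoC a' * (l + l) + RtoC b')%C = (d + RtoC s * (2 * Ci * RtoC y))%C).
    { unfold d, a', b'. rewrite El. unfold Ci, Cplus, Cmult, RtoC; simpl. f_equal; ring. }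
    assert (D := cdiff_F_quad a' b' c' l P1 P2 Hl). rewrite Eq, Ed in D.
    assert (SP := schwarz_pick_halfplane_derivative _ l _
      (maps_halfplane_curve F HF w Hw a' b' c' (admissible_definite _ _ _ P1 P2)) Hl D).
    cbv beta in SP. rewrite Eq in SP. unfold q in SP at 3. rewrite (Hag l Hl) in SP. fold (M l) in Hex.
    apply Csq_le_of_Cmod.
    replace (X l q + d * Y l q + RtoC s * (2 * Ci * RtoC y * Y l q))%C
      with (X l q + (d + RtoC s * (2 * Ci * RtoC y)) * Y l q)%C by ring.
    apply (Rmult_le_reg_r (2 * Im l)); lra. }
  assert (HY : Y l q = 0).
  { assert (Z : (RtoC eps * (2 * Ci * RtoC y * Y l q))%C = 0).
    { apply (parallelogram_vanish (X l q + d * Y l q)%C).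
      - apply Hs; now left.
      - replace (X l q + d * Y l q - RtoC eps * (2 * Ci * RtoC y * Y l q))%C
          with (X l q + d * Y l q + RtoC (- eps) * (2 * Ci * RtoC y * Y l q))%C by (rewrite RtoC_opp; ring).
        apply Hs; now right. }
    assert (N : (RtoC eps * (2 * Ci * RtoC y))%C <> 0).
    { apply Cmult_neq_0; [apply RtoC_ne_0; lra|]. apply Cmult_neq_0; [exact two_Ci_ne_0|apply RtoC_ne_0; lra]. }
    replace (Y l q) with (RtoC eps * (2 * Ci * RtoC y * Y l q) / (RtoC eps * (2 * Ci * RtoC y)))%C.
    - rewrite Z. unfold Cdiv; ring.
    - assert (N1 : RtoC eps <> 0) by (apply RtoC_ne_0; lra). assert (N2 : RtoC y <> 0) by (apply RtoC_ne_0; lra).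
      assert (N3 := Ci_ne_0). assert (N4 : RtoC 2 <> 0) by (apply RtoC_ne_0; lra). field. auto. }
  split; [exact HY|].
  eapply cdiff_eq; [exact D0|]. rewrite HY; ring.
Qed.

(** At the common point the derivative of F along [kappa_q] vanishes, so F along the second disc has
    the same value and derivative there as M, and rigidity does the rest. *)
Lemma agrees_transfer a b c a' b' c' l : a < 1 -> definite a b c -> a' < 1 -> definite a' b' c' ->
  0 < Im l -> quad a b c l = quad a' b' c' l -> agrees a b c -> agrees a' b' c'.
Proof.
  intros H1 H2 H3 H4 Hl E Hag.
  destruct (agrees_derivative a b c l H1 H2 Hag Hl) as [HY HX].
  assert (D := cdiff_F_quad a' b' c' l H3 H4 Hl).
  rewrite <- E, HY in D.
  refine (cayley_jet _ m l _ (maps_halfplane_curve F HF w Hw a' b' c' (admissible_definite _ _ _ H3 H4)) Hm Hl D _ _).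
  - eapply cdiff_eq; [exact HX|ring].
  - rewrite <- E. now apply Hag.
Qed.

Lemma agrees_all a b c a' b' c' : a < 1 -> definite a b c -> a' < 1 -> definite a' b' c' ->
  agrees a b c -> agrees a' b' c'.
Proof.
  intros H1 H2 H3 H4 Hag.
  (* The quadratic [al * l ^ 2 + N] exceeds both given ones, so each difference has a root in the half-plane. *)
  set (al := (Rmax a a' + 1) / 2).
  assert (B1 := Rmax_l a a'). assert (B2 := Rmax_r a a').
  assert (B3 : Rmax a a' < 1) by now apply Rmax_lub_lt.
  assert (A1 : a < al) by (unfold al; lra). assert (A2 : a' < al) by (unfold al; lra).
  assert (A3 : al < 1) by (unfold al; lra).
  set (N := 1 + Rabs c + Rabs c' + b * b / (4 * (al - a)) + b' * b' / (4 * (al - a'))).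
  assert (Q1 : 0 <= b * b / (4 * (al - a))) by (apply Rdiv_le_0_compat; nra).
  assert (Q2 : 0 <= b' * b' / (4 * (al - a'))) by (apply Rdiv_le_0_compat; nra).
  assert (P1 := Rle_abs c). assert (P2 := Rle_abs c').
  assert (P3 := Rabs_pos c). assert (P4 := Rabs_pos c').
  assert (HN : definite al 0 N).
  { split; [destruct H2; lra|]. rewrite Rmult_0_l. destruct H2.
    apply Rmult_lt_0_compat; [lra|unfold N; lra]. }
  assert (D1 : definite (al - a) (0 - b) (N - c)).
  { split; [lra|].
    replace ((0 - b) * (0 - b)) with (4 * (al - a) * (b * b / (4 * (al - a)))) by (field; lra).
    apply Rmult_lt_compat_l; [lra|unfold N; lra]. }
  assert (D2 : definite (al - a') (0 - b') (N - c')).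
  { split; [lra|].
    replace ((0 - b') * (0 - b')) with (4 * (al - a') * (b' * b' / (4 * (al - a')))) by (field; lra).
    apply Rmult_lt_compat_l; [lra|unfold N; lra]. }
  destruct (definite_root _ _ _ D1) as [l1 [L1 R1]]. destruct (definite_root _ _ _ D2) as [l2 [L2 R2]].
  rewrite quad_minus in R1, R2.
  assert (E1 : quad a b c l1 = quad al 0 N l1).
  { replace (quad al 0 N l1) with (quad al 0 N l1 - quad a b c l1 + quad a b c l1)%C by ring. rewrite R1; ring. }
  assert (E2 : quad al 0 N l2 = quad a' b' c' l2).
  { replace (quad al 0 N l2) with (quad al 0 N l2 - quad a' b' c' l2 + quad a' b' c' l2)%C by ring. rewrite R2; ring. }
  apply (agrees_transfer al 0 N a' b' c' l2); trivial.
  now apply (agrees_transfer a b c al 0 N l1).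
Qed.

End Rigidity.

(** For given a there is exactly one real quadratic through (l, q). As a tends to 1, its 4 a c - b^2
    tends to f, which is positive by the inequality of [region]; hence a = 1 - e works for small
    e. *)
Lemma region_definite_quad l q : region l q -> exists a b c, a < 1 /\ definite a b c /\ q = quad a b c l.
Proof.
  intros [Hl Hq]. destruct l as [x y], q as [u v]. unfold Im, Re in *; simpl in *.
  set (al := v / y). assert (Ev : v = al * y) by (unfold al; field; lra). clearbody al. subst v.
  set (f := 4 * u + 4 * (y * y) - al * al).
  assert (Hf : 0 < f).
  { assert (Hy : 0 < y * y) by nra. apply (Rmult_lt_reg_l (y * y)); [exact Hy|]. unfold f. lra. }
  assert (Pu := Rabs_pos u). assert (Pu' := Rle_abs u).
  set (K := 4 * Rabs u + 8 * (y * y) + 1). assert (HK : 0 < K) by (unfold K; nra).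
  set (e := Rmin (/ 2) (f / (2 * K))).
  assert (He : 0 < e) by (apply Rmin_pos; [lra|apply Rdiv_lt_0_compat; lra]).
  assert (He1 : e <= / 2) by apply Rmin_l.
  assert (He2 : e * K <= f / 2).
  { assert (H : e <= f / (2 * K)) by apply Rmin_r. apply (Rmult_le_compat_r K) in H; [|lra].
    replace (f / (2 * K) * K) with (f / 2) in H by (field; lra). exact H. }
  set (a := 1 - e). set (b := al - 2 * a * x). set (c := u - a * (x * x - y * y) - b * x).
  exists a, b, c. split; [unfold a; lra|]. split.
  - split; [unfold a; lra|]. apply Rminus_lt_0.
    replace (4 * a * c - b * b) with (f - e * (4 * u + 8 * (y * y)) + 4 * (e * y) * (e * y))
      by (unfold c, b, f, a; ring).
    assert (e * (4 * u + 8 * (y * y)) <= e * K) by (apply Rmult_le_compat_l; unfold K; lra).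
    assert (0 <= 4 * (e * y) * (e * y)) by nra. lra.
  - unfold quad, Cplus, Cmult, RtoC; simpl. unfold c, b. f_equal; ring.
Qed.

(* The datum on which [phi w] is the only extremal: the velocity at l = i of the disc
   l |-> kappa w l ((l ^ 2 + 1) / 2). *)
Definition base_point (w : C) : C2 := kappa w Ci 0.
Definition base_vector (w : C) : C2 := kappa_v w Ci 0 1 Ci.

Lemma quad_base : quad (/ 2) 0 (/ 2) Ci = 0.
Proof. unfold quad, Ci, Cplus, Cmult, RtoC; simpl. f_equal; field. Qed.

Lemma quad_base_derivative : (RtoC (/ 2) * (Ci + Ci) + RtoC 0)%C = Ci.
Proof. unfold Ci, Cplus, Cmult, RtoC; simpl. f_equal; field. Qed.

Lemma definite_base : definite (/ 2) 0 (/ 2).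
Proof. split; lra. Qed.

Lemma admissible_base : admissible (/ 2) 0 (/ 2).
Proof. apply admissible_definite; [lra|apply definite_base]. Qed.

Lemma Im_Ci_pos : 0 < Im Ci.
Proof. unfold Im; simpl; lra. Qed.

Lemma region_base : region Ci 0.
Proof. rewrite <- quad_base. apply region_quad; [apply admissible_base|apply Im_Ci_pos]. Qed.

Lemma base_point_in w : Csq w = 1 -> sym_bidisc (base_point w).
Proof. intros Hw. apply sym_bidisc_kappa; [exact Hw|apply region_base]. Qed.

Lemma cayley_Ci : cayley Ci = 0.
Proof. unfold cayley, Cdiv. ring. Qed.

Lemma phi_base_derivative (i : unimodular) :
  Cmod (dir_deriv (phi i) (base_point (proj1_sig i)) (base_vector (proj1_sig i))) = / 2.
Proof.
  assert (H := phi_curve_derivative i Ci 0 Ci region_base (quad (/ 2) 0 (/ 2)) quad_base).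
  assert (D := cdiff_quad (/ 2) 0 (/ 2) Ci). rewrite quad_base_derivative in D.
  specialize (H D (fun l => region_quad _ _ _ l admissible_base)).
  rewrite cayley_Ci in H. unfold base_point, base_vector.
  replace (Csq 0) with 0 in H by (unfold Csq; simpl; ring). unfold Im in H; simpl in H. lra.
Qed.

Lemma phi_base_value (i : unimodular) : ext (phi i) (base_point (proj1_sig i)) = 0.
Proof.
  rewrite ext_phi by (apply base_point_in, (proj2_sig i)).
  unfold base_point. rewrite phif_kappa by (apply (proj2_sig i) || apply region_base). apply cayley_Ci.
Qed.

Lemma base_point_0 (w : C) : w <> 0 -> base_point w = ((RtoC 0, RtoC 0) : C2).
Proof.
  intros Hw. unfold base_point, kappa, Cdiv. apply (f_equal2 (fun a b : C => (a, b))); ring.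
Qed.

Lemma kden_base : kden Ci 0 = (- (4))%C.
Proof. unfold kden, Ci, Cplus, Cminus, Cmult, Copp, RtoC; apply pair_equal_spec; cbn [fst snd]; split; ring. Qed.

Lemma base_vector_value (w : C) : w <> 0 ->
  base_vector w = ((- Ci / (2 * w))%C, (Ci / (4 * (w * w)))%C).
Proof.
  intros Hw. assert (N4 : (- (4))%C <> 0).
  { intros E; apply (f_equal fst) in E; simpl in E; lra. }
  assert (N2 : RtoC 2 <> 0) by (apply RtoC_ne_0; lra). assert (N4' : RtoC 4 <> 0) by (apply RtoC_ne_0; lra).
  unfold base_vector, kappa_v, kappa_l, kappa_q; simpl fst; simpl snd. rewrite kden_base.
  apply (f_equal2 (fun a b : C => (a, b))).
  - transitivity ((4 * Ci * ((Ci + Ci) * (Ci + Ci)) - 4 * Ci * Ci * (Ci + Ci)) / (16 * w))%C; [field; auto|].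
    replace (4 * Ci * ((Ci + Ci) * (Ci + Ci)) - 4 * Ci * Ci * (Ci + Ci))%C with (8 * Ci * (Ci * Ci))%C by ring.
    rewrite Ci_sq. field; auto.
  - transitivity ((- 4 * Ci * (Ci * Ci)) / (16 * (w * w)))%C; [field; auto|].
    rewrite Ci_sq. field; auto.
Qed.

Lemma Csq_add_one_max z : Csq z = 1 -> 4 <= Csq (1 + z) -> z = 1.
Proof.
  destruct z as [x y]; unfold Csq; simpl; intros H1 H2.
  assert (x = 1) by nra. subst x. assert (y = 0) by nra. subst y. reflexivity.
Qed.

(** The base point is the origin, and there [phi] with parameter h has a derivative of modulus |1 +
    h / w| / 4 along the base vector of w. On the circle this reaches 1 / 2 only for h = w. *)
Lemma phi_base_separates (i j : unimodular) :
  / 2 <= Cmod (dir_deriv (phi j) (base_point (proj1_sig i)) (base_vector (proj1_sig i))) /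
    (1 - Csq (ext (phi j) (base_point (proj1_sig i)))) -> j = i.
Proof.
  destruct i as [w Hw], j as [h Hh]; simpl proj1_sig. intros H.
  assert (Hw0 := unimodular_ne_0 w Hw). assert (HG := base_point_in w Hw).
  rewrite dir_deriv_phi, ext_phi in H by exact HG. simpl proj1_sig in H.
  rewrite base_vector_value, base_point_0 in H by exact Hw0.
  unfold phif, ncoef in H; simpl fst in H; simpl snd in H.
  assert (N2 : RtoC 2 <> 0) by (apply RtoC_ne_0; lra).
  replace ((h * 0 - 2 * (h * h) * 0) / (2 - h * 0))%C with (RtoC 0) in H by (unfold Cdiv; ring).
  replace (Csq 0) with 0 in H by (unfold Csq; simpl; ring).
  assert (N4' : RtoC 4 <> 0) by (apply RtoC_ne_0; lra).
  replace (2 * h * (- Ci / (2 * w) - 2 * h * (Ci / (4 * (w * w))) + h * h * (0 * (Ci / (4 * (w * w))) - 0 * (- Ci / (2 * w)))) /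
    ((2 - h * 0) * (2 - h * 0)))%C with (- h * Ci / (4 * w) * (1 + h / w))%C in H.
  - unfold Rdiv in H. rewrite Rminus_0_r, Rinv_1, Rmult_1_r in H.
    assert (Hc : Csq (- h * Ci / (4 * w)) = / 16).
    { rewrite Csq_div by (now apply Cmult_neq_0). rewrite !Csq_mult, Csq_opp, Hh, Hw. unfold Csq; simpl. field. }
    assert (H2 : / 4 <= Csq (- h * Ci / (4 * w) * (1 + h / w))) by (rewrite <- Cmod_sq; nra).
    rewrite Csq_mult, Hc in H2.
    assert (E : (h / w)%C = 1).
    { apply Csq_add_one_max; [rewrite Csq_div, Hh, Hw by exact Hw0; field|lra]. }
    apply eq_sig_hprop; [intros; apply proof_irrelevance|]. simpl.
    transitivity (h / w * w)%C; [field; exact Hw0|rewrite E; ring].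
  - replace (2 - h * 0)%C with (RtoC 2) by ring. field. auto.
Qed.

Lemma phi_unique (i : unimodular) (F : pts sym_bidisc -> pts unit_disc) : holomorphic F ->
  / 2 <= Cmod (dir_deriv F (base_point (proj1_sig i)) (base_vector (proj1_sig i))) /
    (1 - Csq (ext F (base_point (proj1_sig i)))) ->
  exists m, disc_automorphism m /\ F = (fun x => m (phi i x)).
Proof.
  intros HF H. destruct i as [w Hw]; simpl proj1_sig in H.
  assert (HG := base_point_in w Hw). assert (P := ext_disc F _ HG).
  assert (D := cdiff_F_curve F HF w Hw (quad (/ 2) 0 (/ 2)) Ci _
    (region_quad _ _ _ Ci admissible_base Im_Ci_pos) (cdiff_quad (/ 2) 0 (/ 2) Ci)).
  rewrite quad_base_derivative, quad_base in D.
  destruct (extremal_halfplane _ Ci _ (maps_halfplane_curve F HF w Hw (/ 2) 0 (/ 2) admissible_base) Im_Ci_pos D)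
    as [m [Hm E]].
  { rewrite quad_base. fold (base_point w). fold (base_vector w).
    apply (Rmult_le_compat_r (1 - Csq (ext F (base_point w)))) in H; [|lra].
    unfold Rdiv in H. rewrite Rmult_assoc, Rinv_l in H by lra. unfold Im; simpl. lra. }
  exists m; split; [exact Hm|].
  apply map_eq. intros x Hx. set (i := exist _ w Hw : unimodular).
  rewrite (ext_comp m (phi i) x Hx), (ext_phi i x Hx). simpl proj1_sig.
  destruct (sym_bidisc_chart w x Hw Hx) as [l [q [R ->]]].
  rewrite phif_kappa by trivial.
  destruct (region_definite_quad l q R) as [a [b [c [Ha [Hd ->]]]]].
  refine (agrees_all F HF w Hw m Hm (/ 2) 0 (/ 2) a b c _ definite_base Ha Hd E l (proj1 R)). lra.
Qed.

Theorem sym_bidisc_minimal_universal :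
  (exists S, minimal_universal_set sym_bidisc S) /\
  (forall S S', minimal_universal_set sym_bidisc S -> minimal_universal_set sym_bidisc S' -> equivalent S S').
Proof.
  assert (Hvalue : forall i : unimodular,
    Cmod (dir_deriv (phi i) (base_point (proj1_sig i)) (base_vector (proj1_sig i))) /
    (1 - Csq (ext (phi i) (base_point (proj1_sig i)))) = / 2).
  { intros i. rewrite phi_base_derivative, phi_base_value.
    replace (Csq 0) with 0 by (unfold Csq; simpl; ring). field. }
  apply (minimal_universal_family phi
    (fun i => Infinitesimal (exist sym_bidisc (base_point (proj1_sig i)) (base_point_in _ (proj2_sig i)))
       (base_vector (proj1_sig i)))).
  - apply open_sym_bidisc.
  - apply holomorphic_phi.
  - apply phi_universal.
  - intros i E. simpl in E. assert (H := phi_base_derivative i). rewrite E in H.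
    destruct (vdiff_ext_dir (phi i) _ (holomorphic_phi i) (base_point_in _ (proj2_sig i))) as [L _].
    assert (L0 : dir_deriv (phi i) (base_point (proj1_sig i)) zero = RtoC 0) by exact (linear_zero _ L).
    rewrite L0, Cmod_0 in H. lra.
  - intros i F HF. apply solves_car_iff in HF. destruct HF as [HF H].
    specialize (H _ (holomorphic_phi i)). apply push_le_iff in H. simpl proj1_sig in H.
    rewrite Hvalue in H. now apply phi_unique.
  - intros i j H. apply solves_car_iff in H. destruct H as [_ H].
    specialize (H _ (holomorphic_phi i)). apply push_le_iff in H. simpl proj1_sig in H.
    rewrite Hvalue in H. now apply phi_base_separates.
Qed.

Theorem mainTheorem4 :
  ((exists S, minimal_universal_set unit_disc S) /\
   (forall S S', minimal_universal_set unit_disc S ->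
                 minimal_universal_set unit_disc S' -> equivalent S S')) /\
  ((exists S, minimal_universal_set bidisc S) /\
   (forall S S', minimal_universal_set bidisc S ->
                 minimal_universal_set bidisc S' -> equivalent S S')) /\
  ((exists S, minimal_universal_set sym_bidisc S) /\
   (forall S S', minimal_universal_set sym_bidisc S ->
                 minimal_universal_set sym_bidisc S' -> equivalent S S')).
Proof.
  exact (conj unit_disc_minimal_universal (conj bidisc_minimal_universal sym_bidisc_minimal_universal)).
Qed.
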